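(* Let $1<p,q<\infty$, $0<s<1$ and let $u,v\in W^{1,p}(\mathbb{R}^N)\cap W^{1,q}(\mathbb{R}^N)$ be such that $$-H_pu+(-\Delta_p)^su-H_qu+(-\Delta_q)^su\le-H_pv+(-\Delta_p)^sv-H_qv+(-\Delta_q)^sv\quad\text{in }\Omega$$ in the weak sense. If $u\le v$ a.e. in $\mathbb{R}^N\setminus\Omega$, then $u\le v$ a.e. in $\Omega$.
   Context: $\Omega\subset\mathbb{R}^N$, $N\ge2$, is a bounded $C^1$ domain. $H:\mathbb{R}^N\to[0,\infty)$ is a Finsler–Minkowski norm: $H\in C^1(\mathbb{R}^N\setminus\{0\})$; $H(x)=0$ iff $x=0$; $H(tx)=|t|H(x)$ for all $t\in\mathbb{R}$, $x\in\mathbb{R}^N$; there are constants $C_1,C_2>0$ with $C_1|x|\le H(x)\le C_2|x|$ for all $x$; and $H$ is strictly convex as a norm, i.e. $H(x+y)<H(x)+H(y)$ for linearly independent $x,y$. For $m\in\{p,q\}$: the vector field $H(\xi)^{m-1}\nabla H(\xi)$ is understood as $0$ at $\xi=0$, $H_mu=\mathrm{div}(H(\nabla u)^{m-1}\nabla H(\nabla u))$, $(-\Delta_m)^su(x)=\mathrm{P.V.}\int_{\mathbb{R}^N}|u(x)-u(y)|^{m-2}(u(x)-u(y))|x-y|^{-N-ms}\,dy$, and $W_0^{1,m}(\Omega)=\{u\in W^{1,m}(\mathbb{R}^N):u=0\text{ in }\mathbb{R}^N\setminus\Omega\}$. For $w\in W^{1,p}(\mathbb{R}^N)\cap W^{1,q}(\mathbb{R}^N)$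 and $\phi\in W_0^{1,p}(\Omega)\cap W_0^{1,q}(\Omega)$ put $$\mathcal{A}(w,\phi)=\sum_{m\in\{p,q\}}\Big[\int_\Omega H(\nabla w)^{m-1}\nabla H(\nabla w)\cdot\nabla\phi\,dx+\iint_{\mathbb{R}^{2N}}\frac{|w(x)-w(y)|^{m-2}(w(x)-w(y))(\phi(x)-\phi(y))}{|x-y|^{N+ms}}\,dx\,dy\Big]$$ (the $p$-term plus the $q$-term). The inequality holds in the weak sense if $\mathcal{A}(u,\phi)\le\mathcal{A}(v,\phi)$ for every $\phi\in W_0^{1,p}(\Omega)\cap W_0^{1,q}(\Omega)$ with $\phi\ge0$. *)

(* Defs.v *)
From HB Require Import structures.
From mathcomp Require Import all_boot all_order all_algebra.
From mathcomp Require Import all_classical all_reals all_analysis.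
Set Implicit Arguments.
Unset Strict Implicit.
Unset Printing Implicit Defensive.
Import Order.TTheory GRing.Theory Num.Theory.
Import numFieldTopology.Exports numFieldNormedType.Exports.
Local Open Scope classical_set_scope.
Local Open Scope ring_scope.

(* The Borel sigma-algebra of R^n, generated by the coordinates. *)
(* The Borel sigma-algebra of R^n, generated by the coordinates. *)
Definition measure_rV_display : measure_display. Proof. by []. Qed.

Section measurable_rV.
Context (R : realType) (n : nat).

Definition rV_coord (i : 'I_n) (x : 'rV[R]_n) : R := x 0 i.

Let rV_set0 : g_sigma_preimage rV_coord set0.
Proof. exact: sigma_algebra0. Qed.

Let rV_setC A : g_sigma_preimage rV_coord A -> g_sigma_preimage rV_coord (~` A).
Proof. exact: sigma_algebraC. Qed.

Let rV_bigcup (F : _^nat) : (forall i, g_sigma_preimage rV_coord (F i)) ->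
  g_sigma_preimage rV_coord (\bigcup_i (F i)).
Proof. exact: sigma_algebra_bigcup. Qed.

HB.instance Definition _ := @isMeasurable.Build measure_rV_display
  'rV[R]_n (g_sigma_preimage rV_coord) rV_set0 rV_setC rV_bigcup.

Lemma measurable_rV_coord (i : 'I_n) : measurable_fun [set: 'rV[R]_n] (rV_coord i).
Proof.
move=> _ Y mY; rewrite setTI; apply: sub_sigma_algebra => /=.
rewrite -bigcup_seq/=; exists i => /=; first by rewrite mem_index_enum.
by exists Y => //; rewrite setTI.
Qed.

Lemma measurable_fun_rV d (T : measurableType d) (f : T -> 'rV[R]_n) :
  (forall i, measurable_fun setT (rV_coord i \o f)) -> measurable_fun setT f.
Proof.
move=> mf _ A mA; rewrite setTI.
suff : g_sigma_preimage rV_coord `<=` [set B | measurable (f @^-1` B)].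
  by move=> /(_ A mA).
apply: smallest_sub.
  split => /=.
  - by rewrite preimage_set0.
  - by move=> B mB; rewrite setTD preimage_setC; exact: measurableC.
  - by move=> F mF; rewrite preimage_bigcup; exact: bigcup_measurable.
move=> B; rewrite -bigcup_seq => -[i _ [C mC <-]] /=.
by rewrite setTI -comp_preimage -[X in measurable X]setTI; exact: mf.
Qed.

End measurable_rV.

Section lebesgue_rV.
Context (R : realType).

Definition rV_cons n (z : R * 'rV[R]_n) : 'rV[R]_n.+1 :=
  \row_i (if unlift ord0 i is Some j then z.2 0 j else z.1).

Lemma measurable_rV_cons n : measurable_fun setT (@rV_cons n).
Proof.
apply: measurable_fun_rV => i.
case: (unliftP ord0 i) => [j ->|->].
- rewrite (_ : _ \o _ = rV_coord j \o snd); last first.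
    by apply/funext => -[a x]; rewrite /rV_coord/= mxE liftK.
  by apply: measurableT_comp; [exact: measurable_rV_coord|exact: measurable_snd].
- rewrite (_ : _ \o _ = fst); first exact: measurable_fst.
  by apply/funext => -[a x]; rewrite /rV_coord/= mxE unlift_none.
Qed.

Section cons.
Variable n : nat.
Variable mu : {sigma_finite_measure set 'rV[R]_n -> \bar R}.

Definition lebesgue_cons : set 'rV[R]_n.+1 -> \bar R :=
  pushforward (@lebesgue_measure R \x mu)%E (@rV_cons n).

Let cons0 : lebesgue_cons set0 = 0%E.
Proof. by rewrite /lebesgue_cons /pushforward preimage_set0 measure0. Qed.

Let cons_ge0 A : (0 <= lebesgue_cons A)%E.
Proof. by rewrite /lebesgue_cons /pushforward; exact: measure_ge0. Qed.

Let cons_sigma_additive : semi_sigma_additive lebesgue_cons.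
Proof.
exact: (@measure_semi_sigma_additive _ _ _
  (measure_function_pushforward__canonical__measure_function_Measure
    (@lebesgue_measure R \x mu)%E (@measurable_rV_cons n))).
Qed.

HB.instance Definition _ :=
  isMeasure.Build _ _ _ lebesgue_cons cons0 cons_ge0 cons_sigma_additive.

Let cons_sigma_finite : sigma_finite setT lebesgue_cons.
Proof.
have /sigma_finiteP[F [FT ndF Foo]] := sigma_finiteT (@lebesgue_measure R).
have /sigma_finiteP[G [GT ndG Goo]] := sigma_finiteT mu.
pose g (y : 'rV[R]_n.+1) : R * 'rV[R]_n := (y 0 ord0, \row_i y 0 (lift ord0 i)).
have mg : measurable_fun setT g.
  apply/measurable_fun_pair; first exact: (measurable_rV_coord ord0).
  apply: measurable_fun_rV => i.
  rewrite (_ : _ \o _ = rV_coord (lift ord0 i)); last first.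
    by apply/funext => y; rewrite /rV_coord/= mxE.
  exact: measurable_rV_coord.
have gK z : g (rV_cons z) = z.
  case: z => a x; congr pair; first by rewrite mxE unlift_none.
  by apply/rowP => i; rewrite !mxE liftK.
exists (fun k => g @^-1` (F k `*` G k)).
  apply/esym; rewrite -subTset => y _.
  have [k _ Fk] : (\bigcup_k F k) (g y).1 by rewrite -FT.
  have [l _ Gl] : (\bigcup_k G k) (g y).2 by rewrite -GT.
  exists (maxn k l) => //; split.
  - by move: Fk; exact/subsetPset/ndF/leq_maxl.
  - by move: Gl; exact/subsetPset/ndG/leq_maxr.
move=> k; have [mF Fk] := Foo k; have [mG Gk] := Goo k; split.
  by rewrite -[X in measurable X]setTI; apply: mg => //; exact: measurableX.
rewrite /lebesgue_cons /pushforward -comp_preimage.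
rewrite (_ : g \o _ = id) ?preimage_id; last by apply/funext => z; exact: gK.
by rewrite product_measure1E// lte_mul_pinfty// ge0_fin_numE.
Qed.

HB.instance Definition _ :=
  Measure_isSigmaFinite.Build _ _ _ lebesgue_cons cons_sigma_finite.

End cons.

(* Lebesgue measure on R^n, as an n-fold product measure. *)
Fixpoint lebesgue_rV n : {sigma_finite_measure set 'rV[R]_n -> \bar R} :=
  if n is n'.+1 then lebesgue_cons (lebesgue_rV n') else dirac (0 : 'rV[R]_0).

Lemma lebesgue_rV_box n (A : 'I_n -> set R) : (forall i, measurable (A i)) ->
  lebesgue_rV n [set x | forall i, A i (x 0 i)] =
  (\prod_(i < n) lebesgue_measure (A i))%E.
Proof.
elim: n A => [|n IHn] A mA.
  by rewrite big_ord0 /= diracE mem_set//= => -[].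
pose B := [set x : 'rV[R]_n | forall i, A (lift ord0 i) (x 0 i)].
have AE : @rV_cons n @^-1` [set x | forall i, A i (x 0 i)] = A ord0 `*` B.
  apply/seteqP; split => -[a x] /=.
  - by move=> h; split=> [|i];
      [have := h ord0|have := h (lift ord0 i)]; rewrite mxE ?unlift_none ?liftK.
  - by move=> [Aa Ax] i; rewrite mxE; case: (unliftP ord0 i) => [j|] ->.
have mB : measurable B.
  rewrite (_ : B = \bigcap_(i in [set: 'I_n])
      (rV_coord i @^-1` A (lift ord0 i))); last first.
    by apply/seteqP; split => x /= h; [move=> i _; exact: h|move=> i; exact: h].
  apply: fin_bigcap_measurable => // i _.
  by rewrite -[X in measurable X]setTI; apply: measurable_rV_coord.
rewrite big_ord_recl -(IHn (fun i => A (lift ord0 i)))//.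
rewrite -product_measure1E//; last exact: (mA ord0).
by rewrite -AE.
Qed.

End lebesgue_rV.

Section calculus.
Context (R : realType) (n : nat).
Implicit Types (f : 'rV[R]_n -> R) (x y : 'rV[R]_n) (U : set 'rV[R]_n).

(* The library norm on row vectors is the sup norm. *)
Definition edot x y : R := \sum_i x 0 i * y 0 i.

Definition enorm x : R := Num.sqrt (edot x x).

Definition partial (i : 'I_n) f x : R := 'D_(delta_mx 0 i) f x.

Definition grad f x : 'rV[R]_n := \row_i partial i f x.

(* U is meant to be open; values of f outside U play no role. *)
Fixpoint Ck U (k : nat) f : Prop :=
  if k is k'.+1 then
    (forall x, U x -> differentiable f x) /\ (forall i, Ck U k' (partial i f))
  else forall x, U x -> {for x, continuous f}.

(* C^oo_c(R^n) *)
Definition test_function f : Prop :=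
  (forall k, Ck setT k f) /\ compact (closure [set x | f x != 0]).

End calculus.

(* Locally, up to permuting and reflecting the coordinate axes, Omega is the
   strict epigraph of a C^1 function of the remaining n - 1 coordinates. *)
Definition C1_boundary (R : realType) (n : nat) (Omega : set 'rV[R]_n) : Prop :=
  forall x0, (closure Omega `\` Omega°) x0 ->
  exists (r : R) (i : 'I_n) (b : bool) (gamma : 'rV[R]_n.-1 -> R),
    [/\ 0 < r, Ck setT 1 gamma &
     forall x, enorm (x - x0) < r ->
       (Omega x <-> gamma (col' i x) < (-1) ^+ b * x 0 i)].

Definition bounded_C1_domain (R : realType) (n : nat) (Omega : set 'rV[R]_n) :
    Prop :=
  [/\ Omega !=set0, open Omega, connected Omega, bounded_set Omega &
      C1_boundary Omega].

Record finsler_minkowski (R : realType) (n : nat) (H : 'rV[R]_n -> R) : Prop := {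
  finsler_ge0 : forall x, 0 <= H x ;
  finsler_C1 : Ck (~` [set 0]) 1 H ;
  finsler_eq0 : forall x, H x = 0 <-> x = 0 ;
  finsler_homo : forall (t : R) x, H (t *: x) = `|t| * H x ;
  finsler_bounds : exists C1 C2 : R, [/\ 0 < C1, 0 < C2 &
    forall x, C1 * enorm x <= H x <= C2 * enorm x] ;
  finsler_strict : forall x y, free [:: x; y] -> H (x + y) < H x + H y }.

(* xi |-> H(xi)^(m-1) grad H(xi), extended by 0 at the origin *)
Definition finsler_flux (R : realType) (n : nat) (H : 'rV[R]_n -> R) (m : R)
    (xi : 'rV[R]_n) : 'rV[R]_n :=
  if xi == 0 then 0 else H xi `^ (m - 1) *: grad H xi.

Section sobolev.
Context (R : realType) (n : nat).
Local Notation mu := (lebesgue_rV R n).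
Implicit Types (w phi : 'rV[R]_n -> R) (Omega : set 'rV[R]_n) (m s : R).

Definition loc_integrable w : Prop :=
  measurable_fun setT w /\
  forall K, compact K -> mu.-integrable K (EFin \o w).

Definition is_weak_grad w (g : 'rV[R]_n -> 'rV[R]_n) : Prop :=
  (forall i, loc_integrable (fun x => g x 0 i)) /\
  forall psi, test_function psi -> forall i,
    \int[mu]_x (w x * partial i psi x) = - \int[mu]_x (g x 0 i * psi x).

(* W^{1,m}(R^n), each class being given by its Borel representatives *)
Definition sobolev m w : Prop :=
  w \in Lfun mu m%:E /\
  exists g, is_weak_grad w g /\
    forall i, (fun x => g x 0 i) \in Lfun mu m%:E.

Definition sobolev0 Omega m w : Prop :=
  sobolev m w /\ {ae mu, forall x, ~ Omega x -> w x = 0}.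

(* A weak gradient is unique up to a null set; the choice of one is immaterial. *)
Definition wgrad w : 'rV[R]_n -> 'rV[R]_n :=
  xget (fun=> 0) [set g | is_weak_grad w g].

Definition local_form H Omega m w phi : R :=
  \int[mu]_(x in Omega) edot (finsler_flux H m (wgrad w x)) (wgrad phi x).

(* The integrand vanishes on the diagonal, since w z.1 - w z.2 = 0 there. *)
Definition nonlocal_form s m w phi : R :=
  \int[(mu \x mu)%E]_z
    (`|w z.1 - w z.2| `^ (m - 2) * (w z.1 - w z.2) * (phi z.1 - phi z.2)
     / enorm (z.1 - z.2) `^ (n%:R + m * s)).

Definition mixed_form H Omega s p q w phi : R :=
  (local_form H Omega p w phi + nonlocal_form s p w phi) +
  (local_form H Omega q w phi + nonlocal_form s q w phi).

Definition weak_le H Omega s p q u v : Prop :=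
  forall phi, sobolev0 Omega p phi -> sobolev0 Omega q phi ->
    {ae mu, forall x, 0 <= phi x} ->
    mixed_form H Omega s p q u phi <= mixed_form H Omega s p q v phi.

End sobolev.

(* Main.v *)
Require Import Defs.
From HB Require Import structures.
From mathcomp Require Import all_boot all_order all_algebra.
From mathcomp Require Import all_classical all_reals all_analysis.
From mathcomp Require Import measurable_realfun ring lra.
Set Implicit Arguments.
Unset Strict Implicit.
Unset Printing Implicit Defensive.
Import Order.TTheory GRing.Theory Num.Theory.
Import numFieldTopology.Exports numFieldNormedType.Exports.
Local Open Scope classical_set_scope.
Local Open Scope ring_scope.

(** Why the comparison principle holds. Put w = u - v and test the inequality with
phi = G(w), where G is the Huber function: G = 0 on the negative half line, G is
nondecreasing and C^{1,1}, its derivative g lies in [0, 1], and G > 0 on the positive half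
line. Then phi >= 0, and phi vanishes outside Omega because u <= v there. In A(u, phi) -
A(v, phi) every term is nonnegative:
- the gradient of phi is g(w) (grad u - grad v), so the local integrand is g(w) >= 0 times
  (flux(grad u) - flux(grad v)) . (grad u - grad v), and the Finsler flux is monotone
  [flux_monotone];
- a |-> |a|^(m-2) a is increasing, and phi(x) - phi(y) is 0 or has the sign of w(x) - w(y),
  so the nonlocal integrand is nonnegative, and positive wherever phi(x) <> phi(y)
  [nonlocal_integrand_le].
The hypothesis says that the sum is at most 0, so all terms vanish. Hence phi(x) = phi(y)
for almost all pairs, phi is constant almost everywhere, and it is 0 because Omega is
bounded [ae_const_bounded_support]. Thus w <= 0. A cut-off with Lipschitz derivative
replaces the positive part of w because its chain rule is elementary and it is just as
good for the argument.

Two facts about Sobolev functions carry this out. The first is that phi is admissible with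
the expected gradient [weak_grad_huberB]. The weak equation of a partial derivative k of F
is equivalent to F(x + t e) - F(x) = \int_0^t k(x + s e) ds for almost all x, for each
t >= 0 [weak_partial_line, line_partial_weak]; in one direction this is the fundamental
lemma of the calculus of variations, in the other a limit t -> 0 with the test function
carrying the increments. In this form the chain rule is a statement about primitives on an
interval [chain_rule_primitive]. The second is that the nonlocal forms are finite, that is,
W^{1,m} embeds into W^{s,m} [gagliardo_lty]: the identity on lines bounds the L^m norm of
w(. + h) - w by a multiple of |h|, and min(1, |h|^m) / |h|^(N + ms) is integrable. *)

(** * Borel sets of R^n *)

Section rV_measurability.
Context {R : realType} {n : nat}.
Local Notation V := 'rV[R]_n.

Definition box (A : 'I_n -> set R) : set V := [set x | forall i, A i (x 0 i)].

Lemma measurable_box (A : 'I_n -> set R) :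
  (forall i, measurable (A i)) -> measurable (box A).
Proof.
move=> mA; rewrite (_ : box A = \bigcap_(i in [set: 'I_n]) (@rV_coord R n i @^-1` A i)).
  apply: fin_bigcap_measurable => // i _.
  by rewrite -[X in measurable X]setTI; apply: measurable_rV_coord.
by apply/seteqP; split => x /= h; [move=> i _; exact: h|move=> i; exact: h].
Qed.

(** The sigma-algebra is generated by the coordinates, whereas open sets come from the
norm: an open set is the union of the countably many rational cubes it contains. *)
Lemma open_measurable_rV (U : set V) : open U -> measurable U.
Proof.
move=> oU.
pose B (cr : 'rV[rat]_n * rat) : set V :=
  box (fun i => `](ratr (cr.1 0 i) - ratr cr.2), (ratr (cr.1 0 i) + ratr cr.2)[%classic).
have mB cr : measurable (B cr) by apply: measurable_box => i; exact: measurable_itv.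
rewrite (_ : U = \bigcup_(cr in [set: 'rV[rat]_n * rat])
    (if `[< B cr `<=` U >] then B cr else set0)); last first.
  apply/seteqP; split => x; last first.
    by move=> [cr _]; case: ifPn => // /asboolP; apply.
  move=> Ux.
  have /nbhs_ballP[e /= e0 xeU] : nbhs x U by exact: open_nbhs_nbhs.
  have [r /= ] := rat_in_itvoo (ltac:(lra) : (0:R) < e / 2).
  rewrite in_itv/= => /andP[r0 re].
  have ex i : exists c : rat, ratr c \in `](x 0 i - ratr r), (x 0 i + ratr r)[.
    by apply: rat_in_itvoo; lra.
  pose c : 'rV[rat]_n := \row_i projT1 (cid (ex i)).
  have cP i : x 0 i - ratr r < ratr (c 0 i) < x 0 i + ratr r.
    by rewrite mxE; case: cid => /= c'; rewrite in_itv.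
  exists (c, r) => //; rewrite asboolT.
    by move=> i /=; rewrite in_itv/=; have := cP i; lra.
  move=> y By; apply: xeU; split => // i j.
  rewrite ord1 /ball/= ltr_norml.
  by have /= := By j; rewrite in_itv/=; have := cP j; lra.
by apply: countable_bigcupT_measurable => // cr; case: ifPn.
Qed.

Lemma closed_measurable_rV (A : set V) : closed A -> measurable A.
Proof.
by move=> /closed_openC/open_measurable_rV/measurableC; rewrite setCK.
Qed.

Lemma continuous_measurable_rV (f : V -> R) : continuous f -> measurable_fun setT f.
Proof.
move=> /continuousP cf; apply: (measurability _ (RGenOpens.measurableE R)) => //.
move=> _ [_ [a [b ->] <-]]; rewrite setTI.
by apply: open_measurable_rV; apply: cf; exact: interval_open.
Qed.

Definition cube (M : R) : set V := box (fun=> `[- M, M]%classic).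

Lemma cubeE (M : R) x : cube M x <-> forall i, `|x 0 i| <= M.
Proof.
by split=> h i; have /= := h i; rewrite in_itv/= ler_norml.
Qed.

Lemma coord_le_norm (x : V) i : `|x 0 i| <= `|x|.
Proof.
rewrite [leRHS]/Num.norm /= mx_normrE; apply/bigmax_geP; right => /=.
by exists (0, i).
Qed.

Lemma measurable_cube M : measurable (cube M).
Proof. by apply: measurable_box => i; exact: measurable_itv. Qed.

Lemma bounded_sub_cube (A : set V) : bounded_set A -> exists M, A `<=` cube M.
Proof.
move=> [M0 [_ /(_ (M0 + 1))]]; rewrite ltrDl ltr01 => /(_ isT) h.
by exists (M0 + 1) => x /h xM; apply/cubeE => i; exact: le_trans (coord_le_norm x i) xM.
Qed.

Lemma compact_sub_cube (A : set V) : compact A -> exists M, A `<=` cube M.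
Proof. by move=> /compact_bounded; exact: bounded_sub_cube. Qed.

Lemma compact_cube M : compact (cube M).
Proof.
rewrite /cube /box.
by apply: (@rV_compact R n (fun=> `[- M, M]%classic)) => i; exact: segment_compact.
Qed.

Lemma cube_cover : \bigcup_k (cube k%:R) = setT.
Proof.
rewrite -subTset => x _.
exists (Num.truncn `|x|).+1 => //; apply/cubeE => i.
by apply: (le_trans (coord_le_norm x i)); exact/ltW/truncnS_gt.
Qed.

(** Open boxes are stable under intersection, generate the Borel sets (a slab is a union
of boxes), and exhaust the space by boxes of finite measure. *)
Lemma box_measure_unique (m1 m2 : {measure set V -> \bar R}) :
  (forall a b : 'I_n -> R,
     m1 (box (fun i => `]a i, b i[%classic)) = m2 (box (fun i => `]a i, b i[%classic))) ->
  (forall a b : 'I_n -> R, (m1 (box (fun i => `]a i, b i[%classic)) < +oo)%E) ->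
  forall A, measurable A -> m1 A = m2 A.
Proof.
move=> m12 m1oo.
pose G := [set B | exists a b : 'I_n -> R, B = box (fun i => `]a i, b i[%classic)].
have Gm : G `<=` measurable.
  by move=> _ [a [b ->]]; apply: measurable_box => i; exact: measurable_itv.
pose g (k : nat) : set V := box (fun=> `](- k%:R), k%:R[%classic).
have gG k : G (g k) by exists (fun=> - k%:R), (fun=> k%:R).
have gT : \bigcup_k g k = setT.
  rewrite -subTset => x _; have : setT x by []. rewrite -cube_cover => -[k _ /cubeE xk].
  exists k.+1 => // i /=; rewrite in_itv/= -ltr_norml.
  by apply: le_lt_trans (xk i) _; rewrite ltr_nat.
apply: (measure_unique G g) => //.
- apply/seteqP; split; last exact: (smallest_sub (@sigma_algebra_measurable _ V)).
  apply: smallest_sub; first exact: smallest_sigma_algebra.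
  move=> B; rewrite -bigcup_seq => -[i _ /= [C mC <-]]; rewrite setTI.
  pose D := [set C : set R | <<s G >> (@rV_coord R n i @^-1` C)].
  suff : (@RGenOpens.G R).-sigma.-measurable `<=` D.
    by move=> /(_ C); apply; rewrite -RGenOpens.measurableE.
  apply: smallest_sub.
    split => /=.
    - by rewrite /D/= preimage_set0; exact: sigma_algebra0.
    - move=> X DX; rewrite /D/= setTD preimage_setC; exact: sigma_algebraC.
    - move=> X DX; rewrite /D/= preimage_bigcup; exact: sigma_algebra_bigcup.
  move=> _ [a [b ->]]; rewrite /D/=.
  rewrite (_ : _ @^-1` _ = \bigcup_k
      box (fun j => if j == i then `]a, b[%classic else `](- k%:R), k%:R[%classic)).
    apply: sigma_algebra_bigcup => k; apply: sub_sigma_algebra.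
    exists (fun j => if j == i then a else - k%:R), (fun j => if j == i then b else k%:R).
    by congr box; apply/funext => j; case: ifP.
  apply/seteqP; split => x /=.
    move=> xi; have : setT x by []. rewrite -gT => -[k _ xk].
    by exists k => // j; case: eqP => [->|_]; [exact: xi|exact: xk].
  by move=> [k _ /(_ i)]; rewrite eqxx.
- move=> _ _ [a [b ->]] [c [d ->]].
  exists (fun i => Num.max (a i) (c i)), (fun i => Num.min (b i) (d i)).
  apply/seteqP; split => x /=.
    move=> [xa xb] i; have := xa i; have := xb i => /=; rewrite !in_itv/=.
    by rewrite gt_max lt_min => /andP[-> ->] /andP[-> ->].
  move=> xab; split => i; have /= := xab i; rewrite !in_itv/= gt_max lt_min.
    by move=> /andP[/andP[-> _] /andP[-> _]].
  by move=> /andP[/andP[_ ->] /andP[_ ->]].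
- by move=> _ [a [b ->]]; exact: m12.
- by move=> k; exact: m1oo.
Qed.

End rV_measurability.

(** * Fubini's theorem and translations *)

Section ae_tools.
Context {d} {T : measurableType d} {R : realType}.
Variable mu : {measure set T -> \bar R}.

Lemma aeS (P Q : T -> Prop) : (forall x, P x -> Q x) ->
  {ae mu, forall x, P x} -> {ae mu, forall x, Q x}.
Proof. by move=> PQ; apply: filterS. Qed.

Lemma aeS2 (P P' Q : T -> Prop) : (forall x, P x -> P' x -> Q x) ->
  {ae mu, forall x, P x} -> {ae mu, forall x, P' x} -> {ae mu, forall x, Q x}.
Proof. by move=> PQ; apply: filterS2. Qed.

Lemma ae_eqT U (f g : T -> U) : {ae mu, forall x, f x = g x} -> ae_eq mu setT f g.
Proof. exact: aeS. Qed.

Lemma ae_integrable_congr (f g : T -> \bar R) : measurable_fun setT g ->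
  {ae mu, forall x, f x = g x} -> mu.-integrable setT f -> mu.-integrable setT g.
Proof.
move=> mg fg /integrableP[mf foo]; apply/integrableP; split => //.
rewrite -(@ge0_ae_eq_integral _ _ _ mu setT (abse \o f) (abse \o g))//.
- by apply: measurableT_comp.
- by apply: measurableT_comp.
- by move=> x _ /=.
- by move=> x _ /=.
- by apply: ae_eqT; apply: aeS fg => x /= ->.
Qed.

Lemma ae_Rintegral_congr (f g : T -> R) : measurable_fun setT f ->
  measurable_fun setT g -> {ae mu, forall x, f x = g x} ->
  \int[mu]_x f x = \int[mu]_x g x.
Proof.
move=> /measurable_EFinP mf /measurable_EFinP mg fg; congr fine.
apply: ae_eq_integral => //.
by apply: ae_eqT; apply: aeS fg => x /= ->.
Qed.

End ae_tools.

Section Rfubini.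
Context {d1 d2} {T1 : measurableType d1} {T2 : measurableType d2} {R : realType}.
Variables (m1 : {sigma_finite_measure set T1 -> \bar R})
  (m2 : {sigma_finite_measure set T2 -> \bar R}) (f : T1 * T2 -> R).
Hypothesis intf : (m1 \x m2)%E.-integrable setT (EFin \o f).

Let ae1 : ae_eq m1 setT (fubini_F m2 (EFin \o f))
  (EFin \o (fun x => \int[m2]_y f (x, y))).
Proof.
apply: aeS (ae_integrable1 intf) => x ix _ /=.
by rewrite /Rintegral fineK//; exact: integrable_fin_num.
Qed.

Let ae2 : ae_eq m2 setT (fubini_G m1 (EFin \o f))
  (EFin \o (fun y => \int[m1]_x f (x, y))).
Proof.
apply: aeS (ae_integrable2 intf) => x ix _ /=.
by rewrite /Rintegral fineK//; exact: integrable_fin_num.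
Qed.

Let integrable_G : m2.-integrable setT (fubini_G m1 (EFin \o f)).
Proof.
have mf : measurable_fun setT (EFin \o f) by exact: measurable_int intf.
have maf : measurable_fun setT (abse \o (EFin \o f)) by exact: measurableT_comp.
apply/integrableP; split; first exact: (measurable_fubini_G intf).
apply: (@le_lt_trans _ _ (\int[m2]_y \int[m1]_x (`|(EFin \o f) (x, y)|))%E); last first.
  by apply: (integrable21ltyP _ _ mf).1.
apply: ge0_le_integral => //.
- by apply: measurableT_comp => //; exact: (measurable_fubini_G intf).
- by apply: (measurable_fun_fubini_tonelli_G (m1 := m1) (abse \o (EFin \o f)) maf) => z; exact: abse_ge0.
- move=> y Ty; apply: le_abse_integral => //; exact: (measurableT_comp mf (pair2_measurable y)).
Qed.

Lemma integrable_Rfubini1 :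
  m1.-integrable setT (EFin \o (fun x => \int[m2]_y f (x, y))).
Proof.
have mF := measurable_fubini_F intf.
apply: (ae_integrable_congr _ _ (integrable_fubini_F intf)).
  by apply/measurable_EFinP; apply: (measurableT_comp _ mF).
by apply: aeS ae1 => x; exact.
Qed.

Lemma integrable_Rfubini2 :
  m2.-integrable setT (EFin \o (fun y => \int[m1]_x f (x, y))).
Proof.
have mG := measurable_fubini_G intf.
apply: (ae_integrable_congr _ _ (integrable_G)).
  by apply/measurable_EFinP; apply: (measurableT_comp _ mG).
by apply: aeS ae2 => x; exact.
Qed.

(** Fubini's theorem for real-valued integrals. The inner integrals exist only almost
everywhere, and where they do not, the real-valued integral has a default value. *)
Lemma Rfubini :
  \int[m1]_x (\int[m2]_y f (x, y)) = \int[m2]_y (\int[m1]_x f (x, y)).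
Proof.
rewrite {1}/Rintegral [RHS]/Rintegral; congr fine.
have e1 := @ae_eq_integral _ _ _ m1 setT _ _ measurableT (measurable_fubini_F intf)
  (measurable_int _ integrable_Rfubini1) ae1.
have e2 := @ae_eq_integral _ _ _ m2 setT _ _ measurableT (measurable_fubini_G intf)
  (measurable_int _ integrable_Rfubini2) ae2.
by have := Fubini intf; rewrite e1 e2.
Qed.

End Rfubini.

Section shift.
Context {R : realType} {n : nat}.
Local Notation V := 'rV[R]_n.
Local Notation mu := (lebesgue_rV R n).
Implicit Types (a x : V) (A : set V).

Lemma measurable_shift a : measurable_fun setT (fun x : V => x + a).
Proof.
apply: measurable_fun_rV => i.
rewrite (_ : _ \o _ = (fun x => rV_coord i x + a 0 i)); last first.
  by apply/funext => x; rewrite /rV_coord/= mxE.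
by apply: measurable_funD => //; exact: measurable_rV_coord.
Qed.

Lemma measurable_line i : measurable_fun [set: V * R]
  (fun z => z.1 + z.2 *: delta_mx 0 i : V).
Proof.
apply: measurable_fun_rV => j.
rewrite (_ : _ \o _ = (fun z : V * R => rV_coord j z.1 + z.2 * (delta_mx 0 i : V) 0 j)); last first.
  by apply/funext => x; rewrite /rV_coord/= !mxE.
apply: measurable_funD => //.
  by apply: measurableT_comp; [exact: measurable_rV_coord|exact: measurable_fst].
by apply: measurable_funM => //; exact: measurable_snd.
Qed.

Lemma lebesgue_rV_itv_lty (b c : 'I_n -> itv_bound R) :
  (forall i, lebesgue_measure [set` Interval (b i) (c i)] < +oo)%E ->
  (mu (box (fun i => [set` Interval (b i) (c i)])) < +oo)%E.
Proof.
move=> bc; rewrite lebesgue_rV_box => [|i]; last exact: measurable_itv.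
suff /andP[] : (0 <= \prod_(i < n) lebesgue_measure [set` Interval (b i) (c i)] < +oo)%E by [].
apply: (big_ind (fun x : \bar R => 0 <= x < +oo)%E) => [|x y /andP[x0 xoo] /andP[y0 yoo]|i _].
- by rewrite ltry lee01.
- by rewrite mule_ge0//= lte_mul_pinfty// ge0_fin_numE.
- by rewrite measure_ge0 bc.
Qed.

Lemma lebesgue_rV_cube_lty M : (mu (cube M) < +oo)%E.
Proof.
have := @lebesgue_rV_itv_lty (fun=> BLeft (- M)) (fun=> BRight M).
apply => i; by rewrite lebesgue_measure_itv/=; case: ifP; rewrite ?ltry.
Qed.

(** A translate of a box is a box with the same side lengths. *)
Lemma lebesgue_rV_shift a A : measurable A ->
  mu ((fun x => x + a) @^-1` A) = mu A.
Proof.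
move=> mA.
pose m := measure_function_pushforward__canonical__measure_function_Measure
  mu (measurable_shift a).
suff /(_ A mA) : forall B, measurable B -> mu B = m B by move=> ->.
have fin (b c : 'I_n -> R) : (mu (box (fun i => `]b i, c i[%classic)) < +oo)%E.
  have := @lebesgue_rV_itv_lty (fun i => BRight (b i)) (fun i => BLeft (c i)).
  apply => i; by rewrite lebesgue_measure_itv/=; case: ifP; rewrite ?ltry.
apply: box_measure_unique => // b c.
transitivity (mu ((fun x => x + a) @^-1` box (fun i => `]b i, c i[%classic))); last by [].
rewrite (_ : _ @^-1` _ = box (fun i => `](b i - a 0 i), (c i - a 0 i)[%classic)).
  have vol (u w : 'I_n -> R) := lebesgue_rV_box (fun i => measurable_itv `]u i, w i[).
  transitivity (\prod_(i < n) lebesgue_measure `]b i, c i[%classic)%E; first exact: vol.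
  rewrite [RHS]vol.
  apply: eq_bigr => i _; rewrite !lebesgue_measure_itv/= !lte_fin.
  by rewrite ltrD2r; case: ifP => // _; rewrite -!EFinD; congr EFin; ring.
apply/seteqP; split => x /= h i; have /= := h i; rewrite !in_itv/= ?mxE; lra.
Qed.

Lemma ge0_integral_shift a (f : V -> \bar R) : measurable_fun setT f ->
  (forall x, 0 <= f x)%E ->
  (\int[mu]_x f (x + a)%R = \int[mu]_x f x)%E.
Proof.
move=> mf f0.
have := @ge0_integral_pushforward _ _ _ _ R _ (measurable_shift a) mu setT f measurableT mf (fun x _ => f0 x).
rewrite preimage_setT => <-; apply: eq_measure_integral => [|mphi A mA _].
  exact: measurable_shift.
exact: lebesgue_rV_shift.
Qed.

Lemma integral_shift a (f : V -> \bar R) : measurable_fun setT f ->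
  (\int[mu]_x f (x + a)%R = \int[mu]_x f x)%E.
Proof.
move=> mf; rewrite [LHS]integralE [RHS]integralE.
congr (_ - _)%E.
- by apply: etrans (ge0_integral_shift a (measurable_funepos mf) _) => //; apply: eq_integral => x _; rewrite !funeposE.
- by apply: etrans (ge0_integral_shift a (measurable_funeneg mf) _) => //; apply: eq_integral => x _; rewrite !funenegE.
Qed.

Lemma Rintegral_shift a (f : V -> R) : measurable_fun setT f ->
  \int[mu]_x f (x + a) = \int[mu]_x f x.
Proof. by move=> /measurable_EFinP mf; congr fine; exact: (integral_shift a mf). Qed.

Lemma integrable_shift a (f : V -> \bar R) : mu.-integrable setT f ->
  mu.-integrable setT (fun x => f (x + a)).
Proof.
move=> /integrableP[mf foo]; apply/integrableP; split.
  by apply: (measurableT_comp mf); exact: measurable_shift.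
rewrite (ge0_integral_shift a (f := fun x => `|f x|%E))//.
exact: measurableT_comp.
Qed.

Lemma loc_integrable_cube (f : V -> R) : loc_integrable f <->
  measurable_fun setT f /\ forall M, mu.-integrable (cube M) (EFin \o f).
Proof.
split=> [[mf fi]|[mf fi]]; split => //.
  by move=> M; exact/fi/compact_cube.
move=> K cK.
have [M KM] := compact_sub_cube cK.
apply: integrableS (fi M) => //; first exact: measurable_cube.
by apply: closed_measurable_rV; apply: compact_closed => //; exact: norm_hausdorff.
Qed.

End shift.

(** * Flat functions on the real line *)

Section flat.
Context {R : realType}.
Implicit Types (P : {poly R}) (x c : R).

Lemma is_derive_quadratic_bound (f : R -> R) (C a : R) : 0 <= C ->
  (forall x, `|f x - f a| <= C * (x - a) ^+ 2) -> is_derive a 1 f 0.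
Proof.
move=> C0 fC.
have lim0 : (fun h => h^-1 *: ((f \o shift a) (h *: 1) - f a)) @ 0^' --> (0 : R).
  apply/cvgrPdist_le => e e0; near=> h.
  rewrite sub0r normrN normrM normfV ler_pdivrMl ?normr_gt0//; last by near: h; exact: nbhs_dnbhs_neq.
  apply: (le_trans (fC _)); rewrite /= /GRing.scale/= mulr1 addrK -real_normK ?num_real// expr2 mulrCA.
  apply: ler_wpM2l => //.
  have : `|h| <= e / (C + 1).
    near: h; apply: dnbhs0_le; rewrite divr_gt0//; lra.
  rewrite ler_pdivlMr; last lra.
  by have := normr_ge0 h; nra.
by split; [apply/cvg_ex; exists 0|exact/cvg_lim].
Unshelve. all: by end_near. Qed.

(** The functions x |-> P(1/x) exp(-1/x) on the positive half line, extended by 0: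
a family closed under differentiation, which makes every member smooth. *)
Definition flat P x : R := if 0 < x then P.[x^-1] * expR (- x^-1) else 0.

Definition dflat P : {poly R} := 'X^2 * (P - P^`()).

Lemma expR_dominates_poly P : exists2 C, 0 <= C & forall y, 0 <= y -> `|P.[y]| <= C * expR y.
Proof.
exists (\sum_(i < size P) `|P`_i| * i`!%:R).
  by apply: sumr_ge0 => i _; rewrite mulr_ge0.
move=> y y0; rewrite horner_coef mulr_suml; apply: (le_trans (ler_norm_sum _ _ _)).
apply: ler_sum => i _; rewrite normrM -mulrA ler_wpM2l// normrX ger0_norm//.
case: (nat_of_ord i) => [|k].
  by rewrite expr0 mul1r -expR0 ler_expR.
have := expR_ge1Dxn k y0.
have f0 : (0:R) < (k.+1)`!%:R by rewrite ltr0n fact_gt0.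
move=> h; rewrite -ler_pdivrMl// mulrC; apply: le_trans h; lra.
Qed.

(** Away from 0 this is the product rule; at 0 the exponential beats every power of 1/x, so
that the function is O(x^2). *)
Lemma is_derive_flat P x : is_derive x 1 (flat P) (flat (dflat P) x).
Proof.
have [x0|x0|->] := ltrgt0P x; last first.
- have [C C0 hC] := expR_dominates_poly ('X^2 * P).
  rewrite {2}/flat ltxx; apply: (@is_derive_quadratic_bound _ C) => // y.
  rewrite /flat ltxx !subr0; case: ifPn => y0; last by rewrite normr0 mulr_ge0// sqr_ge0.
  have := hC y^-1; rewrite invr_ge0 => /(_ (ltW y0)).
  rewrite hornerM hornerXn normrM [`|y^-1 ^+ 2|]ger0_norm ?sqr_ge0//.
  rewrite normrM (ger0_norm (expR_ge0 _)) expRN ler_pdivrMr ?expR_gt0//.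
  rewrite exprVn -ler_pdivlMl ?invr_gt0 ?exprn_gt0// invrK => h.
  by apply: (le_trans h); rewrite le_eqVlt; apply/orP; left; apply/eqP; ring.
- rewrite {2}/flat ltNge (ltW x0)/=.
  apply: (@near_eq_is_derive _ _ _ (cst 0)).
  near=> y; rewrite /flat ltNge ifF//; apply/negbF.
  by near: y; apply: (filterS (P := [set y : R | y < 0])) => [y /ltW//|]; exact: lt_nbhsl.
- rewrite {2}/flat x0.
  have xn0 : x != 0 by rewrite gt_eqF.
  have dV : is_derive x (1:R) (fun y : R => y^-1) (- x ^- 2).
    apply: is_derive_eq; first by apply: (is_deriveV (f := id)).
    by rewrite /GRing.scale/= mulr1.
  have dP : is_derive x (1:R) (fun y => P.[y^-1]) (P^`().[x^-1] * - x ^- 2).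
    exact: (is_derive1_comp (f := horner P) (g := fun y => y^-1)).
  have dE : is_derive x (1:R) (fun y => expR (- y^-1)) (expR (- x^-1) * x ^- 2).
    apply: (is_derive1_comp (f := expR) (g := fun y => - y^-1)).
    have := @is_deriveN _ _ _ _ _ _ _ dV; rewrite opprK; exact.
  have key : is_derive x (1:R) (fun y : R => P.[y^-1] * expR (- y^-1))
      ((dflat P).[x^-1] * expR (- x^-1)).
    apply: is_derive_eq (is_deriveM dP dE) _.
    rewrite /dflat hornerM hornerXn hornerD hornerN /GRing.scale/= exprVn; ring.
  apply: (near_eq_is_derive _ key); near=> y; rewrite /flat ifT//.
  by near: y; exact: lt_nbhsr.
Unshelve. all: by end_near. Qed.

Lemma flat1_ge0_le1 x : 0 <= flat 1 x <= 1.
Proof.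
rewrite /flat; case: ifPn => x0; last by rewrite lexx ler01.
rewrite hornerC mul1r expR_ge0/= -[leRHS]expR0 ler_expR.
by rewrite oppr_le0 invr_ge0 ltW.
Qed.

(** Steepening exp(-1/x) to exp(-1/(kx)) turns the smooth step into a sharp one. *)
Lemma cvg_flat1 x : flat 1 (k.+1%:R * x) @[k --> \oo] --> (\1_[set y : R | 0 < y] x : R).
Proof.
rewrite indicE; have [x0|x0] := ltP 0 x; last first.
  rewrite memNset//=; last by apply/negP; rewrite -leNgt.
  apply: cvg_near_cst; near=> k; rewrite /flat ifF//; apply/negbTE.
  by rewrite -leNgt mulr_ge0_le0.
rewrite mem_set//.
rewrite (_ : (fun _ => _) = fun k : nat => expR (- (k.+1%:R * x)^-1)); last first.
  by apply/funext => k; rewrite /flat mulr_gt0// hornerC mul1r.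
rewrite (_ : (true%:R : R) = expR (- (0 * x^-1))); last by rewrite mul0r oppr0 expR0.
apply: continuous_cvg; first exact: continuous_expR.
apply: cvgN; under eq_fun do rewrite invfM.
apply: cvgM; last exact: cvg_cst.
exact: cvg_harmonic.
Unshelve. all: by end_near. Qed.

End flat.

(** * Smooth functions and test functions *)

Section smooth.
Context {R : realType} {n : nat}.
Local Notation V := 'rV[R]_n.
Implicit Types (f g : V -> R) (a x : V) (i j : 'I_n).
Local Notation e_ i := (delta_mx 0 i : V).

Lemma CkS k f : Ck setT k.+1 f -> Ck setT k f.
Proof.
elim: k f => [|k IHk] f /= [df Hf].
  by move=> x _; apply: differentiable_continuous; exact: df.
by split=> // i; apply: IHk; exact: Hf.
Qed.

Lemma CkD k f g : Ck setT k f -> Ck setT k g -> Ck setT k (f \+ g).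
Proof.
elim: k f g => [|k IHk] f g /=.
  by move=> cf cg x _; exact: (cvgD (cf x I) (cg x I)).
move=> [df Hf] [dg Hg]; split=> [x _|i].
  by apply: differentiableD; [exact: df|exact: dg].
rewrite (_ : partial i _ = partial i f \+ partial i g); first exact: IHk.
apply/funext => x; rewrite /partial deriveD//.
  by apply: diff_derivable; exact: df.
by apply: diff_derivable; exact: dg.
Qed.

Lemma CkM k f g : Ck setT k f -> Ck setT k g -> Ck setT k (f \* g).
Proof.
elim: k f g => [|k IHk] f g.
  by move=> cf cg x _; exact: (cvgM (cf x I) (cg x I)).
move=> Cf Cg; have [[df Hf] [dg Hg]] := (Cf, Cg); split=> [x _|i].
  by apply: differentiableM; [exact: df|exact: dg].
rewrite (_ : partial i _ = (f \* partial i g) \+ (g \* partial i f)).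
  by apply: CkD; [exact: IHk (CkS Cf) (Hg i)|exact: IHk (CkS Cg) (Hf i)].
apply/funext => x; rewrite /partial deriveM//.
  by apply: diff_derivable; exact: df.
by apply: diff_derivable; exact: dg.
Qed.

Lemma partial_cst i (c : R) : partial i (cst c : V -> R) = cst 0.
Proof. by apply/funext => x; rewrite /partial derive_cst. Qed.

Lemma Ck_cst k (c : R) : Ck setT k (cst c : V -> R).
Proof.
elim: k c => [|k IHk] c; first by move=> x _; exact: cst_continuous.
by split=> [x _|i]; [exact: differentiable_cst|rewrite partial_cst; exact: IHk].
Qed.

Lemma Ck_prod (I : finType) k (F : I -> V -> R) : (forall l, Ck setT k (F l)) ->
  Ck setT k (fun x => \prod_l F l x).
Proof.
move=> CF.
have -> : (fun x => \prod_l F l x) = \big[(fun f g : V -> R => f \* g)/cst 1]_l F l.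
  apply/funext => x; apply/esym.
  by elim/big_ind2 : _ => // f y g z <- <-.
by elim/big_ind: _ => // *; [exact: Ck_cst|exact: CkM].
Qed.

Lemma differentiable_affine j (c b : R) x :
  differentiable (fun x : V => c * x 0 j + b) x.
Proof.
apply: differentiableD; last exact: differentiable_cst.
apply: (@differentiableM _ _ (cst c)); first exact: differentiable_cst.
exact: differentiable_coord.
Qed.

Lemma derive_affine j (c b : R) x v :
  'D_v (fun x : V => c * x 0 j + b) x = c * v 0 j.
Proof.
apply: cvg_lim => //; apply: (@cvg_near_cst _ _ _ _ _ (dnbhs_filter _)).
near=> h.
have h0 : h != 0 by near: h; exact: nbhs_dnbhs_neq.
rewrite /= !mxE /GRing.scale/=.
by field.
Unshelve. all: by end_near. Qed.

Lemma Ck_flat k j (c b : R) (P : {poly R}) :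
  Ck setT k (fun x : V => flat P (c * x 0 j + b)).
Proof.
have diff (Q : {poly R}) x : differentiable (fun x : V => flat Q (c * x 0 j + b)) x.
  apply: (@differentiable_comp _ _ _ _ (fun x : V => c * x 0 j + b) (flat Q)).
    exact: differentiable_affine.
  by apply/derivable1_diffP; have [] := is_derive_flat Q (c * x 0 j + b).
elim: k P => [|k IHk] P; first by move=> x _; exact: differentiable_continuous.
split=> // i.
rewrite (_ : partial i _ = (cst (c * (e_ i) 0 j)) \* (fun x => flat (dflat P) (c * x 0 j + b))).
  by apply: CkM; [exact: Ck_cst|exact: IHk].
apply/funext => x; rewrite /partial deriveE// diff_comp//; last 2 first.
- exact: differentiable_affine.
- by apply/derivable1_diffP; have [] := is_derive_flat P (c * x 0 j + b).
rewrite /= deriv1E; last by have [] := is_derive_flat P (c * x 0 j + b).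
rewrite -deriveE; last exact: differentiable_affine.
rewrite derive_affine derive1E /GRing.scale/=.
by have [_ ->] := is_derive_flat P (c * x 0 j + b).
Qed.

Lemma partial_shift i f a : partial i (fun x => f (x + a)) = (fun x => partial i f (x + a)).
Proof.
apply/funext => x; rewrite /partial /derive.
rewrite (_ : (fun h => _) =
  (fun h : R => h^-1 *: ((f \o shift (x + a)) (h *: e_ i) - f (x + a))))//.
by apply/funext => h /=; rewrite addrA.
Qed.

Lemma Ck_shift k f a : Ck setT k f -> Ck setT k (fun x => f (x + a)).
Proof.
elim: k f => [|k IHk] f /=.
  move=> cf x _; apply: (@continuous_comp _ _ _ (fun x => x + a) f x); last exact: cf.
  exact: (cvgD cvg_id (cvg_cst a)) .
move=> [df Hf]; split=> [x _|i]; last by rewrite partial_shift; exact: IHk.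
apply: (@differentiable_comp _ _ _ _ (fun x => x + a) f); last exact: df.
by apply: differentiableD => //; exact: differentiable_cst.
Qed.

Lemma closed_cube M : closed (cube M : set V).
Proof. by apply: compact_closed; [exact: norm_hausdorff|exact: compact_cube]. Qed.

Lemma test_functionI f M : (forall k, Ck setT k f) ->
  (forall x, f x != 0 -> cube M x) -> test_function f.
Proof.
move=> Cf fM; split=> //.
apply: (@subclosed_compact _ _ (cube M)).
- exact: closed_closure.
- exact: compact_cube.
- have /closure_id-> := @closed_cube M.
  exact: closure_subset.
Qed.

Lemma test_function_supp f : test_function f ->
  exists M, forall x, ~ cube M x -> f x = 0.
Proof.
move=> [_ /compact_sub_cube[M hM]]; exists M => x nx.
by have [//|fx] := eqVneq (f x) 0; case: nx; apply: hM; exact: subset_closure.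
Qed.

Lemma test_function_shift f a : test_function f -> test_function (fun x => f (x + a)).
Proof.
move=> tf; have [M hM] := test_function_supp tf; have [Cf _] := tf.
apply: (@test_functionI _ (M + `|a|)) => [k|x]; first exact: Ck_shift.
move=> fxa; have [/cubeE xaM|/hM fxa0] := pselect (cube M (x + a)); last by rewrite fxa0 eqxx in fxa.
apply/cubeE => i; have := xaM i; rewrite mxE; have := coord_le_norm a i.
have := ler_normB (x 0 i + a 0 i) (a 0 i); rewrite addrK; lra.
Qed.

(** Differentiation does not enlarge the support: off the cube the function is locally 0. *)
Lemma test_function_partial f i : test_function f -> test_function (partial i f).
Proof.
move=> tf; have [M hM] := test_function_supp tf; have [Cf _] := tf.
apply: (@test_functionI _ M) => [k|x]; first by have [_ /(_ i)] := Cf k.+1.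
move=> fx; apply: contrapT => nx; move/negP: fx; apply; apply/eqP; rewrite /partial.
have [df _] := Cf 1%N.
have oU : open (~` (cube M : set V)).
  exact/closed_openC/closed_cube.
rewrite (@near_eq_derive _ _ _ f (cst 0)) ?derive_cst//.
by move/open_nbhs_nbhs: (conj oU nx); apply: filterS => y; exact: hM.
Qed.

Lemma test_function_continuous f : test_function f -> continuous f.
Proof. by move=> [/(_ 0%N) /= cf _] x; exact: cf. Qed.

Lemma test_function_bounded f : test_function f ->
  exists2 C, 0 <= C & forall x, `|f x| <= C.
Proof.
move=> tf; have [M hM] := test_function_supp tf.
have : compact [set f x | x in cube M].
  apply: continuous_compact; last exact: compact_cube.
  by apply: continuous_subspaceT; exact: test_function_continuous.
move=> /compact_bounded[C0 [_ /(_ (`|C0| + 1))]].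
rewrite (le_lt_trans (ler_norm _)) ?ltrDl// => /(_ isT) hC.
exists (`|C0| + 1) => // x; have [xM|/hM ->] := pselect (cube M x).
  by apply: hC; exists x.
by rewrite normr0.
Qed.

Lemma test_function_measurable f : test_function f -> measurable_fun setT f.
Proof. by move=> /test_function_continuous/continuous_measurable_rV. Qed.

(** The fundamental theorem of calculus along a coordinate line. *)
Lemma test_function_line f i (t : R) x : test_function f -> 0 <= t ->
  f (x - t *: e_ i) - f x =
  - \int[lebesgue_measure]_(tau in `[0, t]) partial i f (x - tau *: e_ i).
Proof.
move=> tf; rewrite le_eqVlt => /predU1P[<-|t0].
  by rewrite scale0r subr0 subrr set_itv1 Rintegral_set1 oppr0.
have [df _] := tf.1 1%N.
pose F (s : R) := f (x - s *: e_ i).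
have dF (s : R) : is_derive s 1 F (- partial i f (x - s *: e_ i)).
  have Dl : (fun h : R => h^-1 *: ((F \o shift s) (h *: 1) - F s)) =
     (fun h : R => h^-1 *: ((f \o shift (x - s *: e_ i)) (h *: - e_ i) - f (x - s *: e_ i))).
    apply/funext => h /=; rewrite /F; congr (_ *: (f _ - _)).
    have -> : h *: (1 : R) = h by rewrite /GRing.scale/= mulr1.
    by rewrite scalerDl scalerN opprD addrCA.
  have dv := @diff_derivable _ _ _ _ _ (- e_ i) (df (x - s *: e_ i) I).
  split; first by rewrite /derivable Dl.
  rewrite /derive Dl -/(derive f (x - s *: e_ i) (- e_ i)).
  rewrite /partial !deriveE ?linearN//; exact: df.
pose G (s : R) := - F s.
have dG (s : R) : is_derive s 1 G (partial i f (x - s *: e_ i)).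
  by have := @is_deriveN _ _ _ _ _ _ _ (dF s); rewrite opprK; exact.
have cG : continuous G.
  by move=> s; apply/differentiable_continuous/derivable1_diffP; have [] := dG s.
have cg : continuous (fun s : R => partial i f (x - s *: e_ i)).
  move=> s; have cp := test_function_continuous (test_function_partial i tf).
  apply: (@continuous_comp _ _ _ (fun s : R => x - s *: e_ i) (partial i f) s); last exact: cp.
  exact: (cvgB (cvg_cst x) (cvgZr_tmp cvg_id)).
have h := @continuous_FTC2 R (fun s => partial i f (x - s *: e_ i)) G 0 t t0
  (continuous_subspaceT cg).
rewrite /Rintegral h.
- by rewrite /G/F/= scale0r subr0; ring.
- split; first by move=> s _; have [] := dG s.
    by apply: cvg_at_right_filter; exact: cG.
  by apply: cvg_at_left_filter; exact: cG.
- by move=> s _; rewrite derive1E; have [_ ->] := dG s.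
Qed.

End smooth.

(** * The fundamental lemma of the calculus of variations *)

Section density_measure.
Context {d} {T : measurableType d} {R : realType}.
Variables (mu : {measure set T -> \bar R}) (f : T -> \bar R).
Hypotheses (mf : measurable_fun setT f) (f0 : forall x, (0 <= f x)%E).

Definition density_measure (A : set T) : \bar R := (\int[mu]_(x in A) f x)%E.

Let density0 : density_measure set0 = 0%E.
Proof. by rewrite /density_measure integral_set0. Qed.

Let density_ge0 A : (0 <= density_measure A)%E.
Proof. by apply: integral_ge0 => x _; exact: f0. Qed.

Let density_sigma_additive : semi_sigma_additive density_measure.
Proof.
move=> F mF tF mUF; rewrite /density_measure.
apply: cvg_toP.
  apply: is_cvg_ereal_nneg_natsum_cond => k _ _.
  by apply: integral_ge0 => x _; exact: f0.
by rewrite ge0_integral_bigcup//; exact: measurable_funTS.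
Qed.

HB.instance Definition _ := isMeasure.Build _ _ _ density_measure
  density0 density_ge0 density_sigma_additive.

Definition density_measure_of : {measure set T -> \bar R} := density_measure.
End density_measure.

Section fundamental_lemma.
Context {R : realType} {n : nat}.
Local Notation V := 'rV[R]_n.
Local Notation mu := (lebesgue_rV R n).
Implicit Types (f : V -> R) (a b : 'I_n -> R).

(** Smooth, supported in the box, and converging to its indicator as k grows. *)
Definition box_bump a b (k : nat) (x : V) : R :=
  \prod_i (flat 1 (k.+1%:R * (x 0 i - a i)) * flat 1 (k.+1%:R * (b i - x 0 i))).

Lemma box_bump_ge0_le1 a b k x : 0 <= box_bump a b k x <= 1.
Proof.
apply: (big_ind (fun y : R => 0 <= y <= 1)) => [|y z /andP[y0 y1] /andP[z0 z1]|i _].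
- by rewrite lexx ler01.
- by rewrite mulr_ge0//= mulr_ile1.
have /andP[u0 u1] := flat1_ge0_le1 (k.+1%:R * (x 0 i - a i)).
have /andP[v0 v1] := flat1_ge0_le1 (k.+1%:R * (b i - x 0 i)).
by rewrite mulr_ge0//= mulr_ile1.
Qed.

Lemma box_bump_out a b k x : ~ box (fun i => `]a i, b i[%classic) x ->
  box_bump a b k x = 0.
Proof.
move=> /existsNP[i /=]; rewrite in_itv/= => /negP; rewrite negb_and -!leNgt => xi.
rewrite /box_bump (bigD1 i)//=.
suff -> : flat 1 (k.+1%:R * (x 0 i - a i)) * flat 1 (k.+1%:R * (b i - x 0 i)) = 0 :> R.
  by rewrite mul0r.
by case/orP: xi => xi; [rewrite {1}/flat|rewrite {2}/flat]; rewrite pmulr_rgt0// subr_gt0 ltNge xi ?mul0r ?mulr0.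
Qed.

Lemma box_bump_test a b k : test_function (box_bump a b k).
Proof.
apply: (@test_functionI _ _ _ (\sum_i (`|a i| + `|b i|))) => [m|x].
  apply: Ck_prod => i; apply: CkM.
    rewrite (_ : (fun x => _) = (fun x : V => flat 1 (k.+1%:R * x 0 i + - (k.+1%:R * a i)))).
      exact: Ck_flat.
    by apply/funext => x; rewrite mulrBr.
  rewrite (_ : (fun x => _) = (fun x : V => flat 1 (- k.+1%:R * x 0 i + k.+1%:R * b i))).
    exact: Ck_flat.
  by apply/funext => x; rewrite mulrBr mulNr addrC.
move=> bx; have bxab : box (fun i => `]a i, b i[%classic) x.
  by apply: contrapT => /(box_bump_out k) b0; rewrite b0 eqxx in bx.
apply/cubeE => i; apply: (@le_trans _ _ (`|a i| + `|b i|)).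
  have /= := bxab i; rewrite in_itv/= => /andP[ax xb].
  rewrite ler_norml; have := ler_norm (b i); have := ler_norm (- a i); rewrite normrN.
  have := normr_ge0 (a i); have := normr_ge0 (b i); lra.
rewrite (bigD1 i)//= lerDl; apply: sumr_ge0 => j _; exact: addr_ge0.
Qed.

Lemma cvg_prodr (I : Type) (r : seq I) (F : I -> nat -> R) (l : I -> R) :
  (forall i, F i k @[k --> \oo] --> l i) ->
  \prod_(i <- r) F i k @[k --> \oo] --> \prod_(i <- r) l i.
Proof.
move=> Fl; elim: r => [|i r IHr].
  by rewrite big_nil; under eq_fun do rewrite big_nil; exact: cvg_cst.
by rewrite big_cons; under eq_fun do rewrite big_cons; exact: cvgM.
Qed.

Lemma cvg_box_bump a b x :
  box_bump a b k x @[k --> \oo] --> (\1_(box (fun i => `]a i, b i[%classic)) x : R).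
Proof.
have [xab|xab] := pselect (box (fun i => `]a i, b i[%classic) x); last first.
  rewrite indicE memNset//=; apply: cvg_near_cst; near=> k; exact: box_bump_out.
rewrite indicE mem_set// -(@big1 R 1 *%R 'I_n (index_enum 'I_n) predT (fun=> 1))//.
apply: cvg_prodr => i.
have /= := xab i; rewrite in_itv/= => /andP[ax xb].
rewrite -[X in _ --> X](mul1r (1:R)); apply: cvgM.
- have := @cvg_flat1 R (x 0 i - a i); rewrite indicE mem_set//=; lra.
- have := @cvg_flat1 R (b i - x 0 i); rewrite indicE mem_set//=; lra.
Unshelve. all: by end_near. Qed.

Lemma loc_integrableM_test f psi : loc_integrable f -> test_function psi ->
  mu.-integrable setT (EFin \o (fun x => f x * psi x)).
Proof.
move=> /loc_integrable_cube[mf fi] tp.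
have [M hM] := test_function_supp tp.
have [C C0 hC] := test_function_bounded tp.
have mp := test_function_measurable tp.
have mM : measurable (cube M : set V) by exact: measurable_cube.
have fiM := integrableZl (mu := mu) mM C (fi M).
have /(integrable_mkcond _ mM) fiT := fiM.
apply: (le_integrable measurableT _ _ fiT).
  by apply/measurable_EFinP; exact: measurable_funM.
move=> x _; rewrite patchE; case: ifPn => [_|/negP xM].
  by rewrite /= lee_fin !normrM (ger0_norm C0) mulrC ler_wpM2r.
by rewrite /= hM ?mulr0 ?normr0// => xM'; apply: xM; exact: mem_set.
Qed.

(** Test functions approximate the indicators of boxes, and boxes determine measures. *)
Lemma fundamental_lemma f : loc_integrable f ->
  (forall psi, test_function psi -> \int[mu]_x (f x * psi x) = 0) ->
  {ae mu, forall x, f x = 0}.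
Proof.
move=> lf fpsi; have /loc_integrable_cube[mf fi] := lf.
have mfE : measurable_fun setT (EFin \o f) by exact/measurable_EFinP.
have mbox a b : measurable (box (fun i => `]a i, b i[%classic) : set V).
  by apply: measurable_box => i; exact: measurable_itv.
have fibox a b : mu.-integrable (box (fun i => `]a i, b i[%classic)) (EFin \o f).
  apply: (integrableS _ _ _ (fi (\sum_i (`|a i| + `|b i|)))) => //.
    exact: measurable_cube.
  move=> x bxab; apply/cubeE => i; apply: (@le_trans _ _ (`|a i| + `|b i|)).
    have /= := bxab i; rewrite in_itv/= => /andP[ax xb].
    rewrite ler_norml; have := ler_norm (b i); have := ler_norm (- a i); rewrite normrN.
    have := normr_ge0 (a i); have := normr_ge0 (b i); lra.
  by rewrite (bigD1 i)//= lerDl; apply: sumr_ge0 => j _; exact: addr_ge0.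
(* The bumps are test functions converging boundedly to the indicator of the box. *)
have box0 a b : (\int[mu]_(x in box (fun i => `]a i, b i[%classic)) (f x)%:E = 0)%E.
  set B := box _.
  have := @dominated_convergence _ _ _ mu setT measurableT
    (fun k => EFin \o (fun x => f x * box_bump a b k x)) ((EFin \o f) \_ B)
    (abse \o ((EFin \o f) \_ B)).
  case=> //.
  - move=> k; apply/measurable_EFinP; apply: measurable_funM => //.
    by apply: test_function_measurable; exact: box_bump_test.
  - by apply/(measurable_restrictT _ (mbox a b)); exact: measurable_funTS mfE.
  - apply: aeW => x _; have := @cvg_box_bump a b x; rewrite -/B => h.
    rewrite (_ : (_ \_ B) x = (f x * \1_B x)%:E); last first.
      by rewrite patchE indicE; case: ifPn => /= xB; rewrite ?mulr1 ?mulr0.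
    by apply: cvg_EFin; [exact: nearW|apply: cvgM => //; exact: cvg_cst].
  - by apply: integrable_abse; apply/(integrable_mkcond _ (mbox a b)).
  - apply: aeW => x k _; rewrite /= patchE.
    have /andP[b0 b1] := box_bump_ge0_le1 a b k x.
    case: ifPn => [_|/negP xB].
      by rewrite /= lee_fin normrM (ger0_norm b0) ler_piMr.
    by rewrite box_bump_out ?mulr0 ?normr0 ?abse_ge0// => xB'; apply: xB; exact: mem_set.
  move=> _ _ h; rewrite integral_mkcond.
  rewrite -[LHS](cvg_lim _ h)//.
  rewrite (_ : (fun _ => _) = cst 0%E); first exact: lim_cst.
  apply/funext => k /=; have := fpsi _ (box_bump_test a b k).
  rewrite /Rintegral => /eqP; rewrite fine_eq0 => [/eqP//|].
  exact: integrable_fin_num (loc_integrableM_test lf (box_bump_test a b k)).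
(* The measures with densities f^+ and f^- agree on boxes, hence everywhere. *)
pose fp := EFin \o f^\+; pose fn := EFin \o f^\-.
have mfp : measurable_fun setT fp by apply/measurable_EFinP; exact: measurable_funrpos.
have mfn : measurable_fun setT fn by apply/measurable_EFinP; exact: measurable_funrneg.
have fp0 x : (0 <= fp x)%E by rewrite lee_fin funrpos_ge0.
have fn0 x : (0 <= fn x)%E by rewrite lee_fin funrneg_ge0.
have fE E : measurable E -> mu.-integrable E (EFin \o f) ->
    (\int[mu]_(x in E) (f x)%:E = \int[mu]_(x in E) fp x - \int[mu]_(x in E) fn x /\
     \int[mu]_(x in E) fp x \is a fin_num /\ \int[mu]_(x in E) fn x \is a fin_num)%E.
  move=> mE fiE; split; last first.
    have ip : mu.-integrable E fp by exact: (integrable_funrpos mE fiE).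
    have inn : mu.-integrable E fn by exact: (integrable_funrneg mE fiE).
    by split; exact: integrable_fin_num.
    by rewrite integralE /fp /fn -funerpos -funerneg.
have pn A : measurable A -> (\int[mu]_(x in A) fp x = \int[mu]_(x in A) fn x)%E.
  apply: (@box_measure_unique _ _ (density_measure_of mu mfp fp0)
    (density_measure_of mu mfn fn0)) => a b.
    rewrite /=/density_measure; have [+ [fin fin']] := fE _ (mbox a b) (fibox a b).
    rewrite box0 -(fineK fin) -(fineK fin') -EFinB => -[h]; congr EFin; lra.
  rewrite /=/density_measure; have [_ [fin _]] := fE _ (mbox a b) (fibox a b).
  by move: fin; rewrite ge0_fin_numE// integral_ge0.
have fM0 (k : nat) : ae_eq mu (cube k%:R) (EFin \o f) (cst 0%E).
  apply: integral_ae_eq => //; [exact: measurable_cube|].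
  move=> E EM mE; rewrite integral0.
  have [-> [fin _]] := fE E mE (integrableS (measurable_cube _) mE EM (fi k%:R)).
  by rewrite -pn// subee.
have /ae_foralln := fM0.
apply: aeS => x h; have : setT x by []. rewrite -cube_cover => -[k _ xk].
by have [] := h k xk.
Qed.

End fundamental_lemma.

(** * Integrals along coordinate lines *)

Section param.
Context {d1 d2} {T1 : measurableType d1} {T2 : measurableType d2} {R : realType}.
Variables (m2 : {sigma_finite_measure set T2 -> \bar R}).

Lemma measurable_Rintegral_param (f : T1 * T2 -> R) : measurable_fun setT f ->
  measurable_fun setT (fun x => \int[m2]_y f (x, y)).
Proof.
move=> /measurable_EFinP mf.
rewrite (_ : (fun x => _) = fine \o (fun x =>
    fubini_F m2 (EFin \o f)^\+ x - fubini_F m2 (EFin \o f)^\- x)%E); last first.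
  apply/funext => x /=; rewrite /Rintegral integralE; congr (fine (_ - _)).
  - by apply: eq_integral => y _; rewrite !funeposE.
  - by apply: eq_integral => y _; rewrite !funenegE.
apply: measurableT_comp => //; apply: emeasurable_funB.
- by apply: measurable_fun_fubini_tonelli_F; [exact: measurable_funepos|].
- by apply: measurable_fun_fubini_tonelli_F; [exact: measurable_funeneg|].
Qed.

End param.

Section line.
Context {R : realType} {n : nat}.
Local Notation V := 'rV[R]_n.
Local Notation mu := (lebesgue_rV R n).
Local Notation leb := (@lebesgue_measure R).
Implicit Types (F h k : V -> R) (x : V) (i : 'I_n) (t : R).
Local Notation e_ i := (delta_mx 0 i : V).

Lemma Rintegral_indic (D : set R) (f : R -> R) :
  \int[leb]_(s in D) f s = \int[leb]_s (f s * \1_D s).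
Proof.
rewrite Rintegral_mkcond; apply: eq_Rintegral => s _.
by rewrite patchE indicE; case: ifPn => _; rewrite ?mulr1 ?mulr0.
Qed.

Lemma measurable_line_comp i k : measurable_fun setT k ->
  measurable_fun setT (fun z : V * R => k (z.1 + z.2 *: e_ i)).
Proof. by move=> mk; exact: (measurableT_comp mk (measurable_line i)). Qed.

Lemma measurable_line_compN i k : measurable_fun setT k ->
  measurable_fun setT (fun z : V * R => k (z.1 - z.2 *: e_ i)).
Proof.
move=> mk; have mN : measurable_fun setT (fun z : V * R => (z.1, - z.2)).
  by apply/measurable_fun_pair => //=; exact: measurableT_comp.
have := measurableT_comp (measurable_line_comp i mk) mN.
by congr measurable_fun; apply/funext => z /=; rewrite scaleNr.
Qed.

Lemma measurable_indic_itv t :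
  measurable_fun setT (fun z : V * R => \1_(`[0, t]%classic) z.2 : R).
Proof. by apply: measurableT_comp => //. Qed.

(** For s in [0, t] the translates of chi by s live in one common cube. The resulting bound,
uniform in s, is what justifies every exchange of integrals along lines. *)
Lemma cutoff_bound h (chi : V -> R) (C M t : R) i : loc_integrable h ->
  measurable_fun setT chi -> (forall x, `|chi x| <= C) ->
  (forall x, ~ cube M x -> chi x = 0) -> 0 <= t ->
  exists2 B : R, 0 <= B & forall s, 0 <= s <= t ->
    (\int[mu]_x `|(h x * chi (x - s *: e_ i))%:E| <= B%:E)%E.
Proof.
move=> /loc_integrable_cube[mh ih] mchi hC hM t0.
have C0 : 0 <= C by apply: le_trans (hC 0).
have mQ : measurable (cube (M + t) : set V) by exact: measurable_cube.
have iQ : mu.-integrable (cube (M + t)) (EFin \o (fun x => C * h x)).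
  exact: (integrableZl mQ C (ih (M + t))).
pose B := (\int[mu]_(x in cube (M + t)) `|(C * h x)%:E|)%E.
have Boo : B \is a fin_num.
  by rewrite ge0_fin_numE ?integral_ge0//; have /integrableP[] := iQ.
exists (fine B); first by rewrite fine_ge0// integral_ge0.
move=> s /andP[s0 st]; rewrite fineK// /B [leRHS]integral_mkcond.
have mhs : measurable_fun setT (fun x => h x * chi (x - s *: e_ i)).
  apply: measurable_funM => //; apply: (measurableT_comp mchi).
  exact: (measurable_shift (- (s *: e_ i))).
apply: ge0_le_integral => //.
- by do 2 apply: measurableT_comp => //.
- apply/(measurable_restrictT _ mQ); apply: measurable_funTS.
  by do 2 apply: measurableT_comp => //; exact: measurable_funM.
- move=> x _; rewrite patchE; case: ifPn => [_|/negP xM] /=.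
    by rewrite lee_fin !normrM (ger0_norm C0) mulrC ler_wpM2r.
  rewrite hM ?mulr0 ?normr0// => /cubeE xsM; apply: xM; apply: mem_set; apply/cubeE => j.
  have := xsM j; rewrite !mxE.
  have : `|s * (e_ i) 0 j| <= t.
    rewrite mxE normrM (ger0_norm s0); apply: le_trans st; rewrite ler_piMr//.
    by case: (_ && _); rewrite ?normr1 ?normr0.
  rewrite !mxE; set u := s * _ => ut; have := ler_normD (x 0 j - u) u; rewrite subrK; lra.
Qed.

Lemma integrable_strip (f : V * R -> R) (B t : R) : measurable_fun setT f ->
  (forall s, 0 <= s <= t -> (\int[mu]_x `|(f (x, s))%:E| <= B%:E)%E) ->
  (mu \x leb)%E.-integrable setT (EFin \o (fun z => f z * \1_(`[0, t]%classic) z.2)).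
Proof.
move=> mf fB.
have mf1 : measurable_fun setT (EFin \o (fun z : V * R => f z * \1_(`[0, t]%classic) z.2)).
  by apply/measurable_EFinP; apply: measurable_funM => //; exact: measurable_indic_itv.
apply: (integrable21ltyP _ _ _).2 => //.
have i1 : leb.-integrable setT (fun s => (B%:E * (\1_(`[0, t]%classic) s)%:E)%E).
  by apply: integrableZl => //; exact: (integrable_indic_itv 0 t true false).
apply: (@le_lt_trans _ _ (\int[leb]_s (B%:E * (\1_(`[0, t]%classic) s)%:E))%E); last first.
  by move: i1 => /integrable_fin_num; rewrite ltey_eq => ->.
apply: ge0_le_integral => //.
- by move=> s _; exact: integral_ge0.
- have maf : measurable_fun setT (abse \o (EFin \o
      (fun z : V * R => f z * \1_(`[0, t]%classic) z.2))) by exact: measurableT_comp.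
  by apply: (measurable_fun_fubini_tonelli_G (m1 := mu) _ maf) => z; exact: abse_ge0.
- exact: measurable_int i1.
- move=> s _; rewrite indicE; case: (boolP (s \in _)) => [|].
    rewrite inE/= in_itv/= => st; rewrite mule1.
    rewrite (eq_integral (fun x => `|(f (x, s))%:E|%E)); first exact: fB.
    by move=> x _ /=; rewrite indicE mem_set ?mulr1//= in_itv.
  move=> /negP sN.
  rewrite mule0 (_ : (\int[mu]_x _)%E = 0%E)//.
  by apply: integral0_eq => x _ /=; rewrite indicE (negbTE (introN idP sN)) mulr0 normr0.
Qed.

Section cutoff.
Variables (h chi : V -> R) (C M t : R) (i : 'I_n).
Hypotheses (lh : loc_integrable h) (mchi : measurable_fun setT chi)
  (hC : forall x, `|chi x| <= C) (hM : forall x, ~ cube M x -> chi x = 0)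
  (t0 : 0 <= t).

Let mh : measurable_fun setT h. Proof. by have [] := lh. Qed.

Lemma integrable_cutoffl : (mu \x leb)%E.-integrable setT
  (EFin \o (fun z => h z.1 * chi (z.1 - z.2 *: e_ i) * \1_(`[0, t]%classic) z.2)).
Proof.
have [B B0 hB] := cutoff_bound i lh mchi hC hM t0.
apply: (@integrable_strip (fun z => h z.1 * chi (z.1 - z.2 *: e_ i)) B) => //.
apply: measurable_funM; last exact: measurable_line_compN.
exact: measurableT_comp mh measurable_fst.
Qed.

Lemma integrable_cutoffr : (mu \x leb)%E.-integrable setT
  (EFin \o (fun z => h (z.1 + z.2 *: e_ i) * chi z.1 * \1_(`[0, t]%classic) z.2)).
Proof.
have [B B0 hB] := cutoff_bound i lh mchi hC hM t0.
apply: (@integrable_strip (fun z => h (z.1 + z.2 *: e_ i) * chi z.1) B) => //.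
  apply: measurable_funM; first exact: measurable_line_comp.
  exact: measurableT_comp mchi measurable_fst.
move=> s st; apply: le_trans (hB s st).
rewrite -(ge0_integral_shift (s *: e_ i) (f := fun x => `|(h x * chi (x - s *: e_ i))%:E|%E))//.
  rewrite [leRHS](eq_integral (fun x => `|(h (x + s *: e_ i) * chi x)%:E|%E))//.
  by move=> x _ /=; rewrite addrK.
apply: measurableT_comp => //; apply/measurable_EFinP; apply: measurable_funM => //.
by apply: (measurableT_comp mchi); exact: (measurable_shift (- (s *: e_ i))).
Qed.

End cutoff.

(** Cutting off with the indicators of the cubes j = 0, 1, ... makes the function integrable
on the strip; the countably many exceptional null sets have a null union. *)
Lemma ae_line_integrable k i t : loc_integrable k -> 0 <= t ->
  {ae mu, forall x, leb.-integrable `[0, t] (EFin \o (fun s => k (x + s *: e_ i)))}.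
Proof.
move=> lk t0.
have chiM (j : nat) x : ~ cube j%:R x -> \1_(cube j%:R) x = 0 :> R.
  by move=> xj; rewrite indicE memNset.
have chiC (j : nat) (x : V) : `|\1_(cube j%:R) x : R| <= 1.
  by rewrite indicE; case: (_ \in _); rewrite ?normr1 ?normr0.
have mchi (j : nat) : measurable_fun setT (\1_(cube j%:R) : V -> R).
  by apply: measurable_indic; exact: measurable_cube.
have H (j : nat) := ae_integrable1 (integrable_cutoffr i lk (mchi j) (chiC j) (@chiM j) t0).
have := ae_foralln H.
apply: aeS => x hx; have : setT x by []. rewrite -cube_cover => -[j _ xj].
apply/integrable_mkcond => //.
have := hx j; congr integrable; apply/funext => s /=.
rewrite patchE [X in _ * X * _]indicE mem_set//= mulr1 indicE.
by case: ifPn => _; rewrite ?mulr1 ?mulr0.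
Qed.

Lemma measurable_line_Rintegral k i t : measurable_fun setT k ->
  measurable_fun setT (fun x => \int[leb]_(s in `[0, t]) k (x + s *: e_ i)).
Proof.
move=> mk; under eq_fun do rewrite Rintegral_indic.
apply: (@measurable_Rintegral_param _ _ _ _ _ leb
  (fun z : V * R => k (z.1 + z.2 *: e_ i) * \1_(`[0, t]%classic) z.2)).
by apply: measurable_funM; [exact: measurable_line_comp|exact: measurable_indic_itv].
Qed.

Lemma loc_integrable_line_Rintegral k i t : loc_integrable k -> 0 <= t ->
  loc_integrable (fun x => \int[leb]_(s in `[0, t]) k (x + s *: e_ i)).
Proof.
move=> lk t0; have [mk _] := lk; apply/loc_integrable_cube; split.
  exact: measurable_line_Rintegral.
move=> M.
have mM : measurable (cube M : set V) by exact: measurable_cube.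
have chiM x : ~ cube M x -> \1_(cube M) x = 0 :> R.
  by move=> xj; rewrite indicE memNset.
have chiC (x : V) : `|\1_(cube M) x : R| <= 1.
  by rewrite indicE; case: (_ \in _); rewrite ?normr1 ?normr0.
have mchi : measurable_fun setT (\1_(cube M) : V -> R) by exact: measurable_indic.
have := integrable_Rfubini1 (integrable_cutoffr i lk mchi chiC chiM t0).
move=> /(integrableS measurableT mM (@subsetT _ _)); apply: eq_integrable => // x.
rewrite inE => xM /=; congr EFin; rewrite [RHS]Rintegral_indic; apply: eq_Rintegral => s _.
by rewrite [X in _ * X * _]indicE mem_set// mulr1.
Qed.

Lemma integrable_bounded_itv (g : R -> R) (C t : R) : measurable_fun setT g ->
  (forall s, `|g s| <= C) -> leb.-integrable `[0, t] (EFin \o g).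
Proof.
move=> mg gC; apply: (@le_integrable _ _ _ leb `[0, t]%classic _ (EFin \o g) (cst C%:E)) => //.
- by apply/measurable_EFinP; exact: measurable_funTS.
- by move=> s _; rewrite /= lee_fin (le_trans (gC s))// ler_norm.
- apply/integrableP; split => //; rewrite integral_cst//= lebesgue_measure_itv.
  by case: ifP => _; rewrite ?mule0// -EFinB -EFinM ltry.
Qed.

Lemma line_swapl h i t (chi : V -> R) : loc_integrable h -> test_function chi -> 0 <= t ->
  \int[mu]_x (h x * \int[leb]_(s in `[0, t]) chi (x - s *: e_ i)) =
  \int[leb]_(s in `[0, t]) \int[mu]_x (h x * chi (x - s *: e_ i)).
Proof.
move=> lh tchi t0.
have [M hM] := test_function_supp tchi; have [C C0 hC] := test_function_bounded tchi.
have mchi := test_function_measurable tchi.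
have := Rfubini (integrable_cutoffl i lh mchi hC hM t0) => /= sw.
rewrite [RHS]Rintegral_indic.
transitivity (\int[leb]_s \int[mu]_x (h x * chi (x - s *: e_ i) * \1_(`[0, t]%classic) s)).
  rewrite -sw; apply: eq_Rintegral => x _.
  rewrite -RintegralZl//.
    by rewrite [LHS]Rintegral_indic; apply: eq_Rintegral.
  apply: (@integrable_bounded_itv (fun s => chi (x - s *: e_ i)) C t) => //.
  by have := measurable_fun_pair2 x (measurable_line_compN i mchi).
apply: eq_Rintegral => s _; rewrite RintegralZr//.
by apply: loc_integrableM_test lh _; rewrite -scaleNr; exact: test_function_shift.
Qed.

Lemma line_swapr k i t (chi : V -> R) : loc_integrable k -> test_function chi -> 0 <= t ->
  \int[mu]_x ((\int[leb]_(s in `[0, t]) k (x + s *: e_ i)) * chi x) =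
  \int[leb]_(s in `[0, t]) \int[mu]_x (k x * chi (x - s *: e_ i)).
Proof.
move=> lk tchi t0; have [mk _] := lk.
have [M hM] := test_function_supp tchi; have [C C0 hC] := test_function_bounded tchi.
have mchi := test_function_measurable tchi.
have := Rfubini (integrable_cutoffr i lk mchi hC hM t0) => /= sw.
rewrite [RHS]Rintegral_indic.
have i1 := integrable_Rfubini1 (integrable_cutoffr i lk mchi hC hM t0).
transitivity (\int[leb]_s \int[mu]_x (k (x + s *: e_ i) * chi x * \1_(`[0, t]%classic) s)).
  rewrite -sw; apply: ae_Rintegral_congr.
  - by apply: measurable_funM => //; exact: measurable_line_Rintegral.
  - by apply/measurable_EFinP; exact: measurable_int i1.
  - apply: aeS (ae_line_integrable i lk t0) => x ikx.
    rewrite -RintegralZr// [LHS]Rintegral_indic; apply: eq_Rintegral => s _.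
    by rewrite mulrAC.
apply: eq_Rintegral => s _.
rewrite -(Rintegral_shift (s *: e_ i) (f := fun x => k x * chi (x - s *: e_ i))); last first.
  apply: measurable_funM => //.
  by apply: (measurableT_comp mchi); exact: (measurable_shift (- (s *: e_ i))).
rewrite -RintegralZr//; first by apply: eq_Rintegral => x _; rewrite addrK.
have : mu.-integrable setT (EFin \o (fun x => k x * chi (x - s *: e_ i))).
  by apply: loc_integrableM_test lk _; rewrite -scaleNr; exact: test_function_shift.
exact: integrable_shift.
Qed.

End line.

(** * Weak derivatives and increments along lines *)

Section weak_line.
Context {R : realType} {n : nat}.
Local Notation V := 'rV[R]_n.
Local Notation mu := (lebesgue_rV R n).
Local Notation leb := (@lebesgue_measure R).
Implicit Types (F h k : V -> R) (x : V) (i : 'I_n) (t : R).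
Local Notation e_ i := (delta_mx 0 i : V).

Lemma loc_integrableD F k : loc_integrable F -> loc_integrable k ->
  loc_integrable (fun x => F x + k x).
Proof.
move=> /loc_integrable_cube[mF iF] /loc_integrable_cube[mk ik].
apply/loc_integrable_cube; split=> [|M]; first exact: measurable_funD.
by apply: (integrableD (measurable_cube M) (iF M) (ik M)).
Qed.

Lemma loc_integrable_le F k : measurable_fun setT k -> loc_integrable F ->
  (forall x, `|k x| <= `|F x|) -> loc_integrable k.
Proof.
move=> mk /loc_integrable_cube[mF iF] kF; apply/loc_integrable_cube; split=> // M.
apply: (le_integrable (measurable_cube M) _ _ (iF M)).
  by apply/measurable_EFinP; exact: measurable_funTS.
by move=> x _ /=; rewrite lee_fin.
Qed.

Lemma loc_integrableZ F (c : R) : loc_integrable F -> loc_integrable (fun x => c * F x).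
Proof.
move=> /loc_integrable_cube[mF iF]; apply/loc_integrable_cube; split=> [|M].
  exact: measurable_funM.
exact: (integrableZl (measurable_cube M) c (iF M)).
Qed.

Lemma loc_integrableB F k : loc_integrable F -> loc_integrable k ->
  loc_integrable (fun x => F x - k x).
Proof.
move=> lF lk; have := loc_integrableD lF (loc_integrableZ (-1) lk).
by under eq_fun do rewrite mulN1r.
Qed.

Lemma loc_integrable_shift F (a : V) : loc_integrable F ->
  loc_integrable (fun x => F (x + a)).
Proof.
move=> /loc_integrable_cube[mF iF].
apply/loc_integrable_cube; split=> [|M].
  by apply: (measurableT_comp mF); exact: measurable_shift.
have mQ : measurable (cube (M + `|a|) : set V) by exact: measurable_cube.
have mM : measurable (cube M : set V) by exact: measurable_cube.
have /(integrable_mkcond _ mQ)/(integrable_shift a) := iF (M + `|a|).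
move=> /(integrableS measurableT mM (@subsetT _ _)).
apply: eq_integrable => // x; rewrite inE => /cubeE xM; rewrite patchE mem_set//.
apply/cubeE => i; rewrite mxE; apply: (le_trans (ler_normD _ _)).
by apply: lerD => //; exact: coord_le_norm.
Qed.

(** A translation moves the increment of F onto psi, whose increment is the integral of its
partial derivative. *)
Lemma line_increment F i t (psi : V -> R) : loc_integrable F -> test_function psi ->
  0 <= t ->
  \int[mu]_x ((F (x + t *: e_ i) - F x) * psi x) =
  - \int[leb]_(s in `[0, t]) \int[mu]_x (F x * partial i psi (x - s *: e_ i)).
Proof.
move=> lF tpsi t0; have [mF _] := lF.
have tpN := test_function_shift (- (t *: e_ i)) tpsi.
have i0 := loc_integrableM_test lF tpsi.
have it := loc_integrableM_test lF tpN.
rewrite -(line_swapl i lF (test_function_partial i tpsi) t0).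
under eq_Rintegral do rewrite mulrBl.
rewrite RintegralB//; last exact: loc_integrableM_test (loc_integrable_shift _ lF) tpsi.
have -> : \int[mu]_x (F (x + t *: e_ i) * psi x) = \int[mu]_x (F x * psi (x - t *: e_ i)).
  rewrite -(Rintegral_shift (t *: e_ i) (f := fun x => F x * psi (x - t *: e_ i))).
    by apply: eq_Rintegral => x _; rewrite addrK.
  by apply/measurable_EFinP; exact: measurable_int it.
rewrite -RintegralB//.
transitivity (\int[mu]_x (-1 * (F x * \int[leb]_(s in `[0, t]) partial i psi (x - s *: e_ i)))).
  apply: eq_Rintegral => x _.
  by rewrite -mulrBr test_function_line// mulN1r mulrN.
rewrite RintegralZl ?mulN1r//.
have := integrableB measurableT i0 it; apply: eq_integrable => // x _ /=.
by rewrite -EFinB -mulrBr -opprB test_function_line// opprK.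
Qed.

Lemma Rintegral_cst_itv (c t : R) : 0 <= t -> \int[leb]_(s in `[0, t]) c = c * t.
Proof.
move=> t0; have lE : leb `[0, t]%classic = t%:E.
  rewrite lebesgue_measure_itv/= lte_fin; case: ifPn; first by rewrite -EFinB subr0.
  by rewrite -leNgt => t0'; congr EFin; apply/eqP; rewrite eq_le t0 t0'.
rewrite /Rintegral; suff -> : (\int[leb]_(s in `[0%R, t]) c%:E = (c * t)%:E)%E by [].
by rewrite integral_cst// EFinM; congr (_ * _)%E.
Qed.

Lemma integrable_line_pairing i h (chi : V -> R) t : loc_integrable h ->
  test_function chi -> 0 <= t ->
  leb.-integrable `[0, t] (EFin \o (fun s => \int[mu]_x (h x * chi (x - s *: e_ i)))).
Proof.
move=> lh tchi t0.
have [M hM] := test_function_supp tchi; have [C C0 hC] := test_function_bounded tchi.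
have H := integrable_Rfubini2 (integrable_cutoffl i lh (test_function_measurable tchi) hC hM t0).
have := @integrableS _ _ _ leb setT `[0, t]%classic _ measurableT (measurable_itv _) (@subsetT _ _) H.
apply: eq_integrable => // s; rewrite inE/= => st; congr EFin; apply: eq_Rintegral => x _.
by rewrite indicE mem_set// mulr1.
Qed.

Definition weak_partial F k i := forall psi, test_function psi ->
  \int[mu]_x (F x * partial i psi x) = - \int[mu]_x (k x * psi x).

Definition line_partial F k i := forall t, 0 <= t ->
  {ae mu, forall x, F (x + t *: e_ i) - F x = \int[leb]_(s in `[0, t]) k (x + s *: e_ i)}.

(** Both sides have the same integral against every test function psi: after the increment
has been moved onto psi, this is the weak equation for the translates of psi. *)
Lemma weak_partial_line F k i : loc_integrable F -> loc_integrable k ->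
  weak_partial F k i -> line_partial F k i.
Proof.
move=> lF lk wFk t t0.
have lI := loc_integrable_line_Rintegral i lk t0.
have lD := loc_integrableB (loc_integrable_shift (t *: e_ i) lF) lF.
have := fundamental_lemma (loc_integrableB lD lI).
move=> H; apply: aeS (H _) => [x /eqP|psi tpsi]; first by rewrite subr_eq0 => /eqP.
under eq_Rintegral do rewrite mulrBl.
rewrite RintegralB//; [|exact: loc_integrableM_test lD tpsi|exact: loc_integrableM_test lI tpsi].
rewrite line_increment// line_swapr//.
suff -> : \int[leb]_(s in `[0, t]) (\int[mu]_x (F x * partial i psi (x - s *: e_ i))) =
   \int[leb]_(s in `[0, t]) (-1 * \int[mu]_x (k x * psi (x - s *: e_ i))).
  rewrite RintegralZl ?mulN1r ?opprK ?subrr//.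
  exact: integrable_line_pairing.
apply: eq_Rintegral => s _.
have := wFk _ (test_function_shift (- (s *: e_ i)) tpsi).
by rewrite partial_shift mulN1r.
Qed.

Lemma test_function_lipschitz h i (chi : V -> R) : loc_integrable h ->
  test_function chi ->
  exists2 C, 0 <= C & forall s, 0 <= s <= 1 ->
    `|\int[mu]_x (h x * chi (x - s *: e_ i)) - \int[mu]_x (h x * chi x)| <= C * s.
Proof.
move=> lh tchi.
have /loc_integrable_cube[mh ih] := lh.
have [M hM] := test_function_supp tchi.
have [C C0 hC] := test_function_bounded (test_function_partial i tchi).
have mQ : measurable (cube (M + 1) : set V) by exact: measurable_cube.
exists (\int[mu]_(x in cube (M + 1)) (C * `|h x|)).
  by apply: Rintegral_ge0 => x _; exact: mulr_ge0.
move=> s /andP[s0 s1].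
have i0 := loc_integrableM_test lh tchi.
have is_ := loc_integrableM_test lh (test_function_shift (- (s *: e_ i)) tchi).
rewrite -RintegralB// mulrC -RintegralZl//; last first.
  exact: (integrableZl mQ C (integrable_norm (ih (M + 1)))).
apply: (le_trans (le_normr_Rintegral _ _)) => //.
  exact: (integrableB measurableT is_ i0).
rewrite [leRHS]Rintegral_mkcond; apply: le_Rintegral => //.
- exact: integrable_norm (integrableB measurableT is_ i0).
- have : mu.-integrable (cube (M + 1)) (EFin \o (fun x => s * (C * `|h x|))).
    exact: (integrableZl mQ s (integrableZl mQ C (integrable_norm (ih (M + 1))))).
  by move=> /(integrable_mkcond _ mQ); rewrite restrict_EFin.
move=> x _; rewrite patchE; case: ifPn => [_|/negP xM].
  rewrite -mulrBr test_function_line// normrM normrN mulrA mulrC ler_wpM2r//.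
  have mp := test_function_measurable (test_function_partial i tchi).
  have ip : leb.-integrable `[0, s] (EFin \o (fun tau => partial i chi (x - tau *: e_ i))).
    apply: (@integrable_bounded_itv _ (fun tau => partial i chi (x - tau *: e_ i)) C s) => //.
    by have := measurable_fun_pair2 x (measurable_line_compN i mp).
  apply: (le_trans (le_normr_Rintegral _ ip)) => //.
  apply: (@le_trans _ _ (\int[leb]_(tau in `[0, s]) C)).
    apply: le_Rintegral => //; first exact: integrable_norm.
    by apply: (@integrable_bounded_itv _ (cst C) C s) => // y; rewrite ger0_norm.
  by rewrite Rintegral_cst_itv// mulrC.
have nx1 (tau : R) : 0 <= tau <= 1 -> chi (x - tau *: e_ i) = 0.
  move=> /andP[tau0 tau1]; apply: hM => /cubeE xsM; apply: xM; apply: mem_set; apply/cubeE => j.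
  have := xsM j; rewrite !mxE.
  have : `|tau * ((0 == 0 :> 'I_1) && (j == i))%:R| <= 1.
    rewrite normrM (ger0_norm tau0); apply: le_trans tau1; rewrite ler_piMr//.
    by case: (_ && _); rewrite ?normr1 ?normr0.
  set u := tau * _ => ut; have := ler_normD (x 0 j - u) u; rewrite subrK; lra.
have := nx1 0; rewrite scale0r subr0 lexx ler01 => ->//.
by rewrite nx1 ?s0// !mulr0 subr0 normr0.
Qed.

(** Testing the identity on lines with psi says that the function s |-> a(s) + b(s) of the
pairings with the translates of psi has integral 0 on every [0, t]. It is Lipschitz at 0,
so it vanishes there, and a(0) + b(0) = 0 is the weak equation. *)
Lemma line_partial_weak F k i : loc_integrable F -> loc_integrable k ->
  line_partial F k i -> weak_partial F k i.
Proof.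
move=> lF lk lFk psi tpsi.
have tdp := test_function_partial i tpsi.
pose a s := \int[mu]_x (F x * partial i psi (x - s *: e_ i)).
pose b s := \int[mu]_x (k x * psi (x - s *: e_ i)).
have iab := integrable_line_pairing i.
have ab t : 0 <= t -> \int[leb]_(s in `[0, t]) (a s + b s) = 0.
  move=> t0; rewrite RintegralD//; [|exact: iab|exact: iab].
  rewrite -[X in X + _]opprK -line_increment// -line_swapr// addrC.
  apply/eqP; rewrite subr_eq0; apply/eqP; apply: ae_Rintegral_congr.
  - apply: measurable_funM; last exact: test_function_measurable.
    by apply: measurable_line_Rintegral; have [] := lk.
  - apply: measurable_funM; last exact: test_function_measurable.
    by have [] := loc_integrableB (loc_integrable_shift (t *: e_ i) lF) lF.
  - by apply: aeS (lFk t t0) => x ->.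
have [Ca Ca0 ha] := test_function_lipschitz i lF tdp.
have [Cb Cb0 hb] := test_function_lipschitz i lk tpsi.
set a0 := \int[mu]_x _; set b0 := \int[mu]_x _.
suff : a0 + b0 = 0 by lra.
(* The mean of a + b over [0, t] is 0 and differs from a(0) + b(0) by O(t). *)
have key t : 0 < t <= 1 -> `|a0 + b0| <= (Ca + Cb) * t.
  move=> /andP[t0 t1].
  have ic c : leb.-integrable `[0, t] (EFin \o (fun=> c)).
    exact: (@integrable_bounded_itv _ (cst c) `|c| t).
  have iabt : leb.-integrable `[0, t] (EFin \o (fun s => a s + b s)).
    have := @integrableD _ _ _ leb `[0, t]%classic (measurable_itv _) _ _ (iab _ _ _ lF tdp (ltW t0)) (iab _ _ _ lk tpsi (ltW t0)).
    exact: eq_integrable.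
  have cI c : \int[leb]_(s in `[0, t]) c = c * t.
    by rewrite Rintegral_cst_itv// ltW.
  have : `|\int[leb]_(s in `[0, t]) ((a0 + b0) - (a s + b s))| <= (Ca + Cb) * t * t.
    have iD := @integrableB _ _ _ leb `[0, t]%classic (measurable_itv _) _ _ (ic (a0 + b0)) iabt.
    apply: (le_trans (le_normr_Rintegral _ iD)) => //.
    rewrite -cI; apply: le_Rintegral => //; first exact: integrable_norm.
    move=> s /=; rewrite in_itv/= => /andP[s0 st].
    have s1 : 0 <= s <= 1 by rewrite s0 (le_trans st).
    have := ha s s1; have := hb s s1; rewrite -/(a s) -/(b s) -/a0 -/b0 => hb1 ha1.
    rewrite (_ : _ - _ = - ((a s - a0) + (b s - b0))); last by ring.
    rewrite normrN; apply: (le_trans (ler_normD _ _)).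
    have : (Ca + Cb) * s <= (Ca + Cb) * t by rewrite ler_wpM2l// addr_ge0.
    lra.
  rewrite RintegralB// ab ?(ltW t0)// subr0 cI normrM (gtr0_norm t0).
  by rewrite ler_pM2r.
apply/eqP; rewrite -normr_le0; apply/ler_addgt0Pl => eps eps0; rewrite addr0.
have C0 : 0 < Ca + Cb + 1 by lra.
pose t := Num.min 1 (eps / (Ca + Cb + 1)).
have t0 : 0 < t by rewrite lt_min ltr01 divr_gt0.
apply: (le_trans (key t _)); first by rewrite t0 ge_min lexx.
have : t <= eps / (Ca + Cb + 1) by rewrite ge_min lexx orbT.
rewrite ler_pdivlMr//; nra.
Qed.

End weak_line.

(** * The chain rule for primitives *)

Section chain1.
Context {R : realType}.
Local Notation leb := (@lebesgue_measure R).

(** A function that moves at most quadratically in a continuous clock is constant: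
cut the clock in halves, n times. *)
Lemma quadratic_clock_const (Psi A : R -> R) (C T : R) : 0 <= T ->
  {within `[0, T], continuous A} ->
  {in `[0, T] &, {homo A : a b / a <= b}} ->
  (forall a b, 0 <= a -> a <= b -> b <= T -> `|Psi b - Psi a| <= C * (A b - A a) ^+ 2) ->
  Psi T = Psi 0.
Proof.
move=> T0 cA ndA H.
have key m a b : 0 <= a -> a <= b -> b <= T ->
    `|Psi b - Psi a| <= C * (A b - A a) ^+ 2 * 2^-1 ^+ m.
  elim: m a b => [|m IHm] a b a0 ab bT; first by rewrite expr0 mulr1; exact: H.
  have Aab : A a <= A b by apply: ndA => //; rewrite in_itv/=; lra.
  have cAab : {within `[a, b], continuous A}.
    apply: continuous_subspaceW cA => x /=; rewrite !in_itv/=; lra.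
  have [|c] := @IVT _ A a b ((A a + A b) / 2) ab cAab.
    by rewrite /Num.min /Num.max; case: ifPn; lra.
  rewrite in_itv/= => /andP[ac cb] Ac.
  have h1 := IHm a c a0 ac (le_trans cb bT).
  have h2 := IHm c b (le_trans a0 ac) cb bT.
  have := ler_normD (Psi b - Psi c) (Psi c - Psi a); rewrite addrA subrK.
  move: h1 h2; rewrite Ac [2^-1 ^+ m.+1]exprS; set q := 2^-1 ^+ m.
  have -> : C * ((A a + A b) / 2 - A a) ^+ 2 * q = C * (A b - A a) ^+ 2 * q / 4 by field.
  have -> : C * (A b - (A a + A b) / 2) ^+ 2 * q = C * (A b - A a) ^+ 2 * q / 4 by field.
  have -> : C * (A b - A a) ^+ 2 * (2^-1 * q) = C * (A b - A a) ^+ 2 * q / 2 by field.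
  by set X := _ * q => h1 h2 h3; lra.
apply/eqP; rewrite -subr_eq0 -normr_le0; apply/ler_addgt0Pl => e e0; rewrite addr0.
have := key _ 0 T (lexx 0) T0 (lexx T).
set D := C * _ => kD.
have : (`|D| + 1) * 2^-1 ^+ m @[m --> \oo] --> (`|D| + 1) * 0.
  by apply: cvgM; [exact: cvg_cst|apply: cvg_expr; rewrite ger0_norm ?invf_lt1//; lra].
rewrite mulr0 => /cvgr0_norm_le /(_ e e0)[m _ /(_ m (leqnn _))] /=.
apply: le_trans; apply: (le_trans (kD m)); apply: le_trans (ler_norm _).
rewrite ler_wpM2r ?exprn_ge0//; have := ler_norm D; lra.
Qed.

(** G has derivative g, and g is bounded and Lipschitz. Taylor's inequality stands for
differentiability because it is the estimate that the chain rule consumes. *)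
Record C11 (G g : R -> R) : Prop := {
  C11_taylor : forall x y, `|G y - G x - g x * (y - x)| <= (y - x) ^+ 2 ;
  C11_lip : forall x y, `|g y - g x| <= `|y - x| ;
  C11_bound : forall x, `|g x| <= 1 ;
  C11_meas : measurable_fun setT G ;
  C11_dmeas : measurable_fun setT g }.

(** The defect of the chain rule between times a and b is at most quadratic in the variation
of f there, which the integral of |k| measures. *)
Lemma chain_rule_primitive (G g k : R -> R) (c T : R) : C11 G g -> 0 <= T ->
  leb.-integrable `[0, T] (EFin \o k) ->
  let f t := c + \int[leb]_(s in `[0, t]) k s in
  G (f T) - G c = \int[leb]_(s in `[0, T]) (g (f s) * k s).
Proof.
move=> GG T0 ik f.
have sub t : 0 <= t <= T -> `[0, t] `<=` `[0, T].
  by move=> /andP[_ tT] x /=; rewrite !in_itv/=; lra.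
have subo a b : 0 <= a -> b <= T -> `]a, b] `<=` `[0, T].
  by move=> a0 bT x /=; rewrite !in_itv/=; lra.
have iS h a b : leb.-integrable `[0, T] (EFin \o h) -> 0 <= a -> b <= T ->
    leb.-integrable `]a, b] (EFin \o h).
  by move=> ih a0 bT; apply: (@integrableS _ _ _ leb _ _ _ _ _ (subo a b a0 bT) ih).
have iS0 h b : leb.-integrable `[0, T] (EFin \o h) -> 0 <= b <= T ->
    leb.-integrable `[0, b] (EFin \o h).
  by move=> ih bT; apply: (@integrableS _ _ _ leb _ _ _ _ _ (sub b bT) ih).
have itvB h a b : leb.-integrable `[0, T] (EFin \o h) -> 0 <= a -> a <= b -> b <= T ->
    \int[leb]_(s in `[0, b]) h s - \int[leb]_(s in `[0, a]) h s =
    \int[leb]_(s in `]a, b]) h s.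
  by move=> ih a0 ab bT; apply: Rintegral_itvB; rewrite ?bnd_simp//; apply: iS0 => //; lra.
have ink : leb.-integrable `[0, T] (EFin \o (fun s => `|k s|)) by exact: integrable_norm.
pose A t := \int[leb]_(s in `[0, t]) `|k s|.
have cA : {within `[0, T], continuous A}.
  exact: parameterized_integral_continuous T0 ink.
have ndA : {in `[0, T] &, {homo A : a b / a <= b}}.
  move=> a b; rewrite !in_itv/= => /andP[a0 aT] /andP[b0 bT] ab.
  rewrite -subr_ge0 itvB//; exact: Rintegral_ge0.
have cK : {within `[0, T], continuous (fun t => \int[leb]_(s in `[0, t]) k s)}.
  exact: parameterized_integral_continuous T0 ik.
have mK : measurable_fun `[0, T] (fun t => \int[leb]_(s in `[0, t]) k s).
  exact: subspace_continuous_measurable_fun.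
have mf : measurable_fun `[0, T] f by exact: measurable_funD.
have mgf : measurable_fun `[0, T] (fun s => g (f s)).
  exact: measurableT_comp (C11_dmeas GG) mf.
have mk : measurable_fun `[0, T] k by apply/measurable_EFinP; exact: measurable_int ik.
have igk : leb.-integrable `[0, T] (EFin \o (fun s => g (f s) * k s)).
  apply: (@le_integrable _ _ _ leb `[0, T]%classic _ _ (EFin \o k)) => //.
    by apply/measurable_EFinP; exact: measurable_funM.
  by move=> s _ /=; rewrite lee_fin normrM ler_piMl// (C11_bound GG).
have fB a b : 0 <= a -> a <= b -> b <= T -> f b - f a = \int[leb]_(s in `]a, b]) k s.
  by move=> a0 ab bT; rewrite -itvB// /f; ring.
have fA a b : 0 <= a -> a <= b -> b <= T -> `|f b - f a| <= A b - A a.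
  move=> a0 ab bT; rewrite fB// itvB//.
  by apply: le_normr_Rintegral => //; exact: iS.
pose Psi t := G (f t) - \int[leb]_(s in `[0, t]) (g (f s) * k s).
have : Psi T = Psi 0.
  apply: (@quadratic_clock_const Psi A 2 T) => // a b a0 ab bT.
  have iZ : leb.-integrable `]a, b] (EFin \o (fun s => g (f a) * k s)).
    exact: (@integrableZl _ _ _ leb _ (measurable_itv _) (g (f a)) _ (iS _ _ _ ik a0 bT)).
  have -> : Psi b - Psi a = (G (f b) - G (f a) - g (f a) * (f b - f a)) +
      \int[leb]_(s in `]a, b]) (g (f a) * k s - g (f s) * k s).
    rewrite RintegralB//; last exact: iS.
    rewrite RintegralZl//; last exact: iS.
    by rewrite -(fB a b)// -(itvB (fun s => g (f s) * k s) a b)// /Psi; ring.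
  have Aab : 0 <= A b - A a by apply: le_trans (fA a b a0 ab bT).
  have h1 : `|G (f b) - G (f a) - g (f a) * (f b - f a)| <= (A b - A a) ^+ 2.
    apply: (le_trans (C11_taylor GG _ _)).
    have := fA a b a0 ab bT; move: (f b - f a) (A b - A a) Aab => x y y0.
    rewrite ler_norml => /andP[? ?]; nra.
  have iD : leb.-integrable `]a, b] (EFin \o (fun s => g (f a) * k s - g (f s) * k s)).
    have := @integrableB _ _ _ leb `]a, b]%classic (measurable_itv _) _ _ iZ (iS _ _ _ igk a0 bT).
    exact: eq_integrable.
  have h2 : `|\int[leb]_(s in `]a, b]) (g (f a) * k s - g (f s) * k s)| <= (A b - A a) ^+ 2.
    apply: (le_trans (le_normr_Rintegral _ iD)) => //.
    rewrite expr2 {2}itvB// -RintegralZl//; last exact: iS.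
    apply: le_Rintegral => //.
    - exact: integrable_norm.
    - exact: (@integrableZl _ _ _ leb _ (measurable_itv _) (A b - A a) _ (iS _ _ _ ink a0 bT)).
    move=> s /=; rewrite in_itv/= => /andP[sa sb].
    rewrite -mulrBl normrM ler_wpM2r// distrC.
    apply: (le_trans (C11_lip GG _ _)).
    apply: (le_trans (fA a s a0 (ltW sa) (le_trans sb bT))).
    by rewrite lerD2r; apply: ndA => //; rewrite in_itv/=; lra.
  apply: (le_trans (ler_normD _ _)); apply: (le_trans (lerD h1 h2)).
  by rewrite mulr_natl mulr2n.
rewrite /Psi (_ : f 0 = c); last by rewrite /f set_itv1 Rintegral_set1 addr0.
rewrite set_itv1 Rintegral_set1 subr0 => <-.
by rewrite opprB addrC subrK.
Qed.

End chain1.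

(** * The chain rule for weak derivatives *)

Section ae_swap.
Context {d1 d2} {T1 : measurableType d1} {T2 : measurableType d2} {R : realType}.
Variables (m1 : {sigma_finite_measure set T1 -> \bar R})
  (m2 : {sigma_finite_measure set T2 -> \bar R}).

(** By Tonelli's theorem a set all of whose horizontal sections are null has null vertical
sections, up to a null set. *)
Lemma ae_swap (D : T1 * T2 -> R) : measurable_fun setT D ->
  (forall y, {ae m1, forall x, D (x, y) = 0}) ->
  {ae m1, forall x, {ae m2, forall y, D (x, y) = 0}}.
Proof.
move=> mD D0.
have mD1 : measurable_fun setT (fun z => `|(D z)%:E|%E).
  by apply: measurableT_comp => //; exact/measurable_EFinP.
have D0' z : (0 <= `|(D z)%:E|)%E by exact: abse_ge0.
have := fubini_tonelli (m1 := m1) (m2 := m2) _ mD1 D0'.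
rewrite [RHS]integral0_eq; last first.
  move=> y _; apply: (ae_eq_integral_abs m1 measurableT _).2.
    by apply/measurable_EFinP; exact: measurable_fun_pair1.
  by apply: ae_eqT; apply: aeS (D0 y) => x ->.
move=> I0.
have mF := @measurable_fun_fubini_tonelli_F _ _ _ _ R m2 _ mD1 D0'.
have F0 x : (0 <= fubini_F m2 (fun z => `|(D z)%:E|%E) x)%E by exact: integral_ge0.
have /(ae_eq_integral_abs m1 measurableT mF) : (\int[m1]_x `|fubini_F m2 (fun z => `|(D z)%:E|) x| = 0)%E.
  by under eq_integral do rewrite gee0_abs//.
apply: aeS => x /(_ I) /= Fx0.
have mDx : measurable_fun setT (EFin \o (fun y => D (x, y))).
  by apply/measurable_EFinP; exact: measurable_fun_pair2.
have /(ae_eq_integral_abs m2 measurableT mDx) := Fx0.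
by apply: aeS => y /(_ I) [].
Qed.
End ae_swap.

Section chain_line.
Context {R : realType} {n : nat}.
Local Notation V := 'rV[R]_n.
Local Notation mu := (lebesgue_rV R n).
Local Notation leb := (@lebesgue_measure R).
Implicit Types (F h k : V -> R) (x : V) (i : 'I_n) (t : R).
Local Notation e_ i := (delta_mx 0 i : V).

Lemma measurable_line_primitive i k : measurable_fun setT k ->
  measurable_fun setT (fun z : V * R => \int[leb]_(s in `[0, z.2]) k (z.1 + s *: e_ i)).
Proof.
move=> mk; under eq_fun do rewrite Rintegral_indic.
rewrite (_ : (fun _ => _) = fun z : V * R => \int[leb]_s (k (z.1 + s *: e_ i) *
    (\1_(`[0, +oo[%classic) (z.2 - s) * \1_(`[0, +oo[%classic) s))); last first.
  (* The moving interval [0, tau] becomes the fixed condition 0 <= s, 0 <= tau - s. *)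
  apply/funext => z; apply: eq_Rintegral => s _; congr (_ * _).
  rewrite !indicE -natrM mulnb; congr ((_ : bool)%:R).
  by rewrite !mem_setE !in_itv/= !andbT subr_ge0 andbC.
apply: (@measurable_Rintegral_param _ _ (V * R)%type _ _ leb (fun z : (V * R) * R => k (z.1.1 + z.2 *: e_ i) *
    (\1_(`[0, +oo[%classic) (z.1.2 - z.2) * \1_(`[0, +oo[%classic) z.2))).
have m11 : measurable_fun setT (fun z : V * R * R => z.1.1).
  exact: measurableT_comp measurable_fst measurable_fst.
have m12 : measurable_fun setT (fun z : V * R * R => z.1.2).
  exact: measurableT_comp measurable_snd measurable_fst.
have m2 : measurable_fun setT (fun z : V * R * R => z.2) by exact: measurable_snd.
apply: measurable_funM; last first.
  apply: measurable_funM; last by apply: measurableT_comp => //.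
  by apply: measurableT_comp => //; exact: measurable_funB.
have m3 : measurable_fun setT (fun z : V * R * R => (z.1.1, z.2)) by exact/measurable_fun_pair.
exact: (measurableT_comp (measurable_line_comp i mk) m3).
Qed.

(** For almost every x, the restriction of F to the line through x agrees with the primitive
F(x) + \int_0^s k both at the end point t and at almost every s in [0, t]: the former is
the hypothesis for t, the latter its version for all s at once. Then the chain rule for
primitives applies. *)
Lemma line_partial_chain (G g : R -> R) F k i : C11 G g ->
  loc_integrable F -> loc_integrable k -> line_partial F k i ->
  line_partial (fun x => G (F x)) (fun x => g (F x) * k x) i.
Proof.
move=> GG lF lk Fk t t0.
have [mF _] := lF; have [mk _] := lk.
(* The indicator confines the defect to s >= 0, where the hypothesis makes it vanish. *)
pose D (z : V * R) := (F (z.1 + z.2 *: e_ i) - F z.1 -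
   \int[leb]_(s in `[0, z.2]) k (z.1 + s *: e_ i)) * \1_(`[0, +oo[%classic) z.2.
have mD : measurable_fun setT D.
  apply: measurable_funM; last by apply: measurableT_comp => //; exact: measurable_snd.
  apply: measurable_funB; last exact: measurable_line_primitive.
  apply: measurable_funB; first exact: measurable_line_comp.
  exact: measurableT_comp mF measurable_fst.
have D0 : forall tau, {ae mu, forall x, D (x, tau) = 0}.
  move=> tau; have [tau0|tau0] := leP 0 tau.
    by apply: aeS (Fk tau tau0) => x Fx; rewrite /D /= Fx subrr mul0r.
  apply: aeW => x; rewrite /D/= [X in _ * X]indicE memNset ?mulr0//= in_itv/= andbT.
  by apply/negP; rewrite -ltNge.
have aeD := ae_swap leb mD D0.
apply: aeS2 (aeS2 (fun x a b => conj a b) aeD (Fk t t0)) (ae_line_integrable i lk t0).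
move=> x [Dx Fx] ikx.
have := chain_rule_primitive (F x) GG t0 ikx => /=.
have -> : F x + \int[leb]_(s in `[0, t]) k (x + s *: e_ i) = F (x + t *: e_ i).
  by rewrite -Fx addrC subrK.
move=> ->; rewrite [LHS]Rintegral_indic [RHS]Rintegral_indic.
have mFs : measurable_fun setT (fun s : R => F (x + s *: e_ i)).
  exact: measurable_fun_pair2 x (measurable_line_comp i mF).
have mks : measurable_fun setT (fun s : R => k (x + s *: e_ i)).
  exact: measurable_fun_pair2 x (measurable_line_comp i mk).
have mKs : measurable_fun setT (fun s : R => \int[leb]_(r in `[0, s]) k (x + r *: e_ i)).
  exact: measurable_fun_pair2 x (measurable_line_primitive i mk).
have mg := C11_dmeas GG.
apply: ae_Rintegral_congr.
- apply: measurable_funM => //; apply: measurable_funM => //.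
  by apply: (measurableT_comp mg); exact: measurable_funD.
- apply: measurable_funM => //; apply: measurable_funM => //.
  exact: measurableT_comp mg mFs.
apply: aeS Dx => s; rewrite /D/= !indicE.
have [st|st] := boolP (s \in `[0, t]%classic); last by rewrite !mulr0.
rewrite !mulr1 mem_set; last by move: st; rewrite inE/= !in_itv/= => /andP[->].
by move=> /eqP; rewrite mulr1 subr_eq0 => /eqP <-; rewrite addrC subrK.
Qed.

End chain_line.

Section huber.
Context {R : realType}.

Definition clamp (t : R) : R := Num.min (Num.max t 0) 1.

(** A C^{1,1} substitute for the positive part: t^2/2 on [0, 1], then t - 1/2. Writing it
with the derivative clamp makes measurability a matter of products. *)
Definition huber (t : R) : R := clamp t * (t - clamp t / 2).

Lemma clamp_cases (t : R) : [\/ t <= 0 /\ clamp t = 0,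
  (0 <= t <= 1) /\ clamp t = t | 1 <= t /\ clamp t = 1].
Proof.
rewrite /clamp /Num.min /Num.max.
have [t0|t0] := ltP t 0; first by rewrite ltr01; constructor 1; split=> //; exact: ltW.
have [t1|t1] := ltP t 1; first by constructor 2; split=> //; lra.
by constructor 3.
Qed.

Lemma huber_C11 : C11 huber clamp.
Proof.
have mc : measurable_fun setT clamp.
  by apply: measurable_minr => //; exact: measurable_maxr.
split.
- move=> x y; rewrite /huber ler_norml; have sq := sqr_ge0 (y - x).
  by case: (clamp_cases x) => -[hx ->]; case: (clamp_cases y) => -[hy ->]; nra.
- move=> x y; rewrite ler_norml; have := ler_norm (y - x); have := ler_norm (x - y).
  rewrite distrC.
  by case: (clamp_cases x) => -[hx ->]; case: (clamp_cases y) => -[hy ->]; lra.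
- move=> x; rewrite ler_norml.
  by case: (clamp_cases x) => -[hx ->]; lra.
- apply: measurable_funM => //; apply: measurable_funB => //; exact: measurable_funM.
- exact: mc.
Qed.

Lemma huber0 : huber 0 = 0 :> R.
Proof. by rewrite /huber sub0r; case: (clamp_cases 0) => -[hx ->]; lra. Qed.

Lemma huber_lip (x y : R) : `|huber y - huber x| <= `|y - x|.
Proof.
rewrite ler_norml; have := ler_norm (y - x); have := ler_norm (x - y); rewrite distrC /huber.
by case: (clamp_cases x) => -[hx ->]; case: (clamp_cases y) => -[hy ->]; nra.
Qed.

Lemma clamp_ge0 (x : R) : 0 <= clamp x.
Proof. by case: (clamp_cases x) => -[hx ->]; lra. Qed.

Lemma huber_ge0 (x : R) : 0 <= huber x.
Proof. by rewrite /huber; case: (clamp_cases x) => -[hx ->]; nra. Qed.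

Lemma huber_gt0 (x : R) : (0 < huber x) = (0 < x).
Proof.
rewrite /huber; case: (clamp_cases x) => -[hx ->].
- by rewrite mul0r ltxx; apply/esym/negbTE; rewrite -leNgt.
- apply/idP/idP => h; nra.
- apply/idP/idP => h; lra.
Qed.

Lemma huber_mono (x y : R) : x <= y -> huber x <= huber y.
Proof.
rewrite /huber => xy.
by case: (clamp_cases x) => -[hx ->]; case: (clamp_cases y) => -[hy ->]; nra.
Qed.

End huber.

(** * The singular kernel *)

Section kernel.
Context {R : realType} {n : nat}.
Local Notation V := 'rV[R]_n.
Local Notation mu := (lebesgue_rV R n).

Lemma powRD_le (a b m : R) : 0 <= a -> 0 <= b -> 0 < m ->
  (a + b) `^ m <= 2 `^ m * (a `^ m + b `^ m).
Proof.
move=> a0 b0 m0; have m0' := ltW m0.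
wlog ab : a b a0 b0 / a <= b.
  move=> H; have [ab|/ltW ba] := leP a b; first exact: H.
  by rewrite addrC [X in _ * X]addrC; exact: H.
apply: (@le_trans _ _ ((2 * b) `^ m)).
  by apply: ge0_ler_powR; rewrite ?nnegrE//; lra.
rewrite powRM// ler_wpM2l ?powR_ge0// lerDr powR_ge0 //.
Qed.

Lemma geometric_nneseries_lty (c r : R) : 0 <= c -> 0 <= r < 1 ->
  (\sum_(k <oo) (c * r ^+ k)%:E < +oo)%E.
Proof.
move=> c0 /andP[r0 r1].
apply: (@le_lt_trans _ _ (c / (1 - r))%:E); last by rewrite ltry.
apply: lime_le.
  by apply: is_cvg_nneseries => k _ _; rewrite lee_fin mulr_ge0// exprn_ge0.
apply: nearW => k; rewrite sumEFin lee_fin.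
rewrite ler_pdivlMr ?subr_gt0// -mulr_sumr -mulrA ler_piMr//.
rewrite big_mkord mulrC -[X in X * _]opprB mulNr -subrX1 opprB.
by rewrite gerBl exprn_ge0.
Qed.

Lemma lebesgue_rV_cube (M : R) : 0 <= M -> mu (cube M) = ((2 * M) ^+ n)%:E.
Proof.
move=> M0; rewrite lebesgue_rV_box => [|i]; last exact: measurable_itv.
rewrite (eq_bigr (fun=> (2 * M)%:E)); last first.
  move=> i _; rewrite lebesgue_measure_itv/= lte_fin; case: ifPn => [_|].
    by rewrite -EFinB; congr EFin; ring.
  by rewrite -leNgt => h; congr EFin; lra.
by rewrite prodEFin prodr_const card_ord.
Qed.

Lemma cube_norm (h : V) (M : R) : 0 <= M -> `|h| <= M -> cube M h.
Proof.
by move=> M0 hM; apply/cubeE => i; exact: le_trans (coord_le_norm h i) hM.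
Qed.

Lemma dyadic_near (x : R) : 0 < x <= 1 ->
  exists k, 2^-1 ^+ k.+1 < x <= 2^-1 ^+ k.
Proof.
move=> /andP[x0 x1].
have [N hN] : exists N, 2^-1 ^+ N.+1 < x.
  have : (2^-1 : R) ^+ m @[m --> \oo] --> (0 : R).
    by apply: cvg_expr; rewrite ger0_norm ?invr_ge0// invf_lt1 ?ltr1n.
  move=> /cvgr_lt /(_ x x0)[N _ /(_ N.+1 (leqnSn N))] /= h.
  by exists N.
have [k hk kmin] := ex_minnP (ex_intro (fun N => 2^-1 ^+ N.+1 < x) N hN).
exists k; rewrite hk/=; case: k hk kmin => [|k] hk kmin; first by rewrite expr0.
by rewrite leNgt; apply/negP => /kmin; rewrite ltnn.
Qed.

Lemma dyadic_far (x : R) : 1 <= x -> exists k, 2 ^+ k <= x <= 2 ^+ k.+1.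
Proof.
move=> x1.
have [N hN] : exists N, x <= 2 ^+ N.+1.
  exists (Num.truncn x).+1; apply: (le_trans (ltW (truncnS_gt x))).
  rewrite -natrX ler_nat; apply: ltnW; apply: (leq_trans (ltn_expl _ (isT : (1 < 2)%N))).
  by rewrite leq_exp2l.
have [k hk kmin] := ex_minnP (ex_intro (fun N => x <= 2 ^+ N.+1) N hN).
exists k; rewrite hk andbT; case: k hk kmin => [|k] hk kmin; first by rewrite expr0.
by rewrite leNgt; apply/negP => /ltW/kmin; rewrite ltnn.
Qed.

(** The singular kernel |h|^(-a) with the first factor min(1, |h|^m), which bounds the
increments of a Sobolev function up to a constant. *)
Definition kern (m a : R) (h : V) : R := Num.min 1 (`|h| `^ m) / `|h| `^ a.

Lemma measurable_norm_rV : measurable_fun setT (fun h : V => `|h| : R).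
Proof. by apply: continuous_measurable_rV => x; exact: norm_continuous. Qed.

Lemma measurable_kern m a : measurable_fun setT (kern m a).
Proof.
apply: measurable_funM.
  apply: measurable_minr => //.
  exact: (measurableT_comp (measurable_powR m) measurable_norm_rV).
rewrite (_ : (fun _ => _) = (fun h : V => `|h| `^ (- a))); last first.
  by apply/funext => h; rewrite powRN.
exact: (measurableT_comp (measurable_powR (- a)) measurable_norm_rV).
Qed.

Lemma kern_ge0 m a h : 0 <= kern m a h.
Proof. by rewrite /kern divr_ge0 ?powR_ge0// le_min ler01 powR_ge0. Qed.

(** On the shell |h| ~ 2^(-k) the integral is of order 2^(-k(m - ms)), and on the shell
|h| ~ 2^k it is of order 2^(-kms): both series are geometric. *)
Lemma kern_lty (m s : R) : 0 < m -> 0 < s < 1 ->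
  (\int[mu]_h (kern m (n%:R + m * s) h)%:E < +oo)%E.
Proof.
move=> m0 /andP[s0 s1]; set a := n%:R + m * s.
have a0 : 0 < a by rewrite /a ltr_wpDl// mulr_gt0.
pose y k : R := 2^-1 ^+ k; pose z k : R := 2 ^+ k.
have y0 k : 0 < y k by rewrite exprn_gt0// invr_gt0.
have z0 k : 0 < z k by rewrite exprn_gt0.
pose c k : R := y k `^ m / y k.+1 `^ a.
pose d k : R := (z k `^ a)^-1.
have c0 k : 0 <= c k by rewrite divr_ge0 ?powR_ge0.
have d0 k : 0 <= d k by rewrite invr_ge0 powR_ge0.
(* The constants c k and d k bound the kernel on the shells around y k and z k; passing
from shells to cubes keeps the orders of magnitude. *)
pose f k (h : V) : \bar R := ((c k * \1_(cube (y k)) h)%:E + (d k * \1_(cube (z k.+1)) h)%:E)%E.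
have f0 k h : (0 <= f k h)%E by rewrite /f -EFinD lee_fin addr_ge0// mulr_ge0.
have mc M (x : R) : measurable_fun setT (fun h : V => (x * \1_(cube M) h)%:E).
  by apply/measurable_EFinP; apply: measurable_funM => //; apply: measurable_indic; exact: measurable_cube.
have mf k : measurable_fun setT (f k) by exact: emeasurable_funD.
have If k : (\int[mu]_h f k h = (c k * (2 * y k) ^+ n + d k * (2 * z k.+1) ^+ n)%:E)%E.
  rewrite ge0_integralD//; last 2 first.
  - by move=> h _; rewrite lee_fin mulr_ge0.
  - by move=> h _; rewrite lee_fin mulr_ge0.
  have I (M x : R) : 0 <= M -> 0 <= x ->
      (\int[mu]_h (x * \1_(cube M) h)%:E = (x * (2 * M) ^+ n)%:E)%E.
    move=> M0 x0; under eq_integral do rewrite EFinM.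
    rewrite ge0_integralZl//.
      rewrite integral_indic ?setIT//; last exact: measurable_cube.
      by rewrite EFinM; congr (_ * _)%E; exact: lebesgue_rV_cube.
    by apply/measurable_EFinP; apply: measurable_indic; exact: measurable_cube.
  by rewrite !I// ltW.
apply: (@le_lt_trans _ _ (\int[mu]_h \sum_(k <oo) f k h)%E).
  apply: ge0_le_integral => //.
  - by move=> h _; rewrite lee_fin kern_ge0.
  - by apply/measurable_EFinP; exact: measurable_kern.
  - by apply: ge0_emeasurable_sum => // k h _ _.
  move=> h _.
  have fle k : (f k h <= \sum_(k <oo) f k h)%E.
    by rewrite (nneseriesD1 (n := k))// leeDl// nneseries_ge0.
  have fge0 : (0 <= \sum_(k <oo) f k h)%E by exact: nneseries_ge0.
  have [h0|hn0] := eqVneq `|h| 0.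
    by rewrite /kern h0 powR0 ?gt_eqF// (min_idPr ler01) mul0r.
  have hgt0 : 0 < `|h| by rewrite lt_neqAle eq_sym hn0 normr_ge0.
  have [h1|h1] := leP `|h| 1.
    have [k /andP[yh hy]] := dyadic_near (ltac:(by rewrite hgt0) : 0 < `|h| <= 1).
    apply: le_trans (fle k); rewrite /f -EFinD lee_fin.
    rewrite !indicE mem_set ?mulr1; last by apply: cube_norm => //; exact: ltW.
    apply: ler_wpDr; first by rewrite mulr_ge0.
    rewrite /kern /c ler_pM ?invr_ge0 ?powR_ge0// ?le_min ?ler01 ?powR_ge0//.
      rewrite ge_min; apply/orP; right.
      apply: ge0_ler_powR; rewrite ?nnegrE//; exact: ltW.
    rewrite lef_pV2 ?posrE ?powR_gt0//.
    apply: ge0_ler_powR; rewrite ?nnegrE//; exact: ltW.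
  have [k /andP[zh hz]] := dyadic_far (ltW h1).
  apply: le_trans (fle k); rewrite /f -EFinD lee_fin.
  rewrite addrC !indicE mem_set ?mulr1; last by apply: cube_norm => //; exact: ltW.
  apply: ler_wpDr; first by rewrite mulr_ge0.
  rewrite /kern /d -[leRHS]mul1r ler_pM ?invr_ge0 ?powR_ge0// ?le_min ?ler01 ?powR_ge0//.
  rewrite lef_pV2 ?posrE ?powR_gt0//.
  apply: ge0_ler_powR; rewrite ?nnegrE//; exact: ltW.
rewrite integral_nneseries//.
have powX (x b : R) k : 0 <= x -> (x ^+ k) `^ b = (x `^ b) ^+ k.
  by move=> x0; rewrite -(powR_mulrn k x0) -(powR_mulrn k (powR_ge0 x b)) powRAC.
pose b := m - m * s; have b0 : 0 < b by rewrite /b -[X in X - _]mulr1 -mulrBr mulr_gt0// subr_gt0.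
pose e := m * s; have e0 : 0 < e by rewrite mulr_gt0.
have half b' : 0 < b' -> 0 <= (2^-1 : R) `^ b' < 1.
  move=> b'0; rewrite powR_ge0/=.
  have := @gt0_ltr_powR R b' b'0 2^-1 1; rewrite !nnegrE invr_ge0 powR1.
  by apply => //; rewrite invf_lt1// ltr1n.
pose C1 := 2 ^+ n * 2 `^ a; pose C2 := 4 ^+ n : R.
have E k : (c k * (2 * y k) ^+ n + d k * (2 * z k.+1) ^+ n)%:E =
    ((C1 * (2^-1 `^ b) ^+ k)%:E + (C2 * (2^-1 `^ e) ^+ k)%:E)%E.
  rewrite -EFinD; congr (_%:E + _%:E)%E.
    rewrite -powX// -/(y k) /c /C1 /b.
    have -> : y k.+1 = 2^-1 * y k by rewrite /y exprS.
    rewrite powRM ?(ltW (y0 k))// exprMn.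
    have -> : m - m * s = m + (n%:R - a) by rewrite /a; ring.
    rewrite powRD; last by rewrite (gt_eqF (y0 k)) implybT.
    rewrite powRB; last by rewrite (gt_eqF (y0 k)) implybT.
    rewrite powR_mulrn ?(ltW (y0 k))// -(powR_inv1 (_ : 0 <= 2))// -powRrM mulN1r powRN.
    have := powR_gt0 a (y0 k); have : 0 < (2:R) `^ a by rewrite powR_gt0.
    move=> /lt0r_neq0 ? /lt0r_neq0 ?; field; by apply/andP.
  rewrite /d /C2 /z exprS mulrA exprMn -natrM.
  rewrite mulrCA; congr (_ * _); rewrite -powX// exprVn.
  rewrite -/(z k) -(powR_inv1 (ltW (z0 k))) -powRrM mulN1r.
  have -> : - e = n%:R - a by rewrite /a /e; ring.
  rewrite powRB; last by rewrite (gt_eqF (z0 k)) implybT.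
  by rewrite powR_mulrn ?(ltW (z0 k))// mulrC.
under eq_eseriesr do rewrite If E.
rewrite nneseriesD.
- rewrite lte_add_pinfty//; apply: geometric_nneseries_lty; rewrite ?half//.
    by rewrite mulr_ge0 ?powR_ge0// exprn_ge0.
  by rewrite exprn_ge0.
- by move=> k _ _; rewrite lee_fin !mulr_ge0 ?powR_ge0// exprn_ge0 ?powR_ge0.
- by move=> k _ _; rewrite lee_fin mulr_ge0 ?exprn_ge0 ?powR_ge0.
Qed.

End kernel.

(** * Jensen's inequality on an interval *)

Section jensen.
Context {R : realType}.
Local Notation leb := (@lebesgue_measure R).

(** Either a <= A, or a^(m-1) exceeds A^(m-1). *)
Lemma le_split_level (a A m : R) : 0 <= a -> 0 < A -> 1 < m ->
  a <= a `^ m / A `^ (m - 1) + A.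
Proof.
move=> a0 A0 m1; have B0 : 0 < A `^ (m - 1) by exact: powR_gt0.
have [aA|aA] := leP a A; first by rewrite ler_wpDl// divr_ge0 ?powR_ge0// ltW.
rewrite ler_wpDr ?(ltW A0)// ler_pdivlMr// -(mulr_powRB1 a0); last lra.
by rewrite ler_wpM2l//; apply: ge0_ler_powR; rewrite ?nnegrE; lra.
Qed.

(** Jensen's inequality up to the factor 2^m, allowing infinite values on the right. Splitting
|k| at a level A bounds its integral by the sum of r / A^(m-1) and t A, where r is the
integral of |k|^m; the two terms balance when A^m = r / t. *)
Lemma powR_Rintegral_le (k : R -> R) (t m : R) : measurable_fun setT k ->
  0 < t -> 1 < m ->
  ((`|\int[leb]_(s in `[0, t]) k s| `^ m)%:E <=
   (2 `^ m * t `^ (m - 1))%:E * \int[leb]_(s in `[0%R, t]) (`|k s| `^ m)%:E)%E.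
Proof.
move=> mk t0 m1; have m0 : 0 < m by lra.
have c0 : 0 < 2 `^ m * t `^ (m - 1) by rewrite mulr_gt0// powR_gt0.
set I := (\int[leb]_(s in `[0%R, t]) (`|k s| `^ m)%:E)%E.
have I0 : (0 <= I)%E by apply: integral_ge0 => s _; rewrite lee_fin powR_ge0.
have [Ioo|] := eqVneq I +oo%E; first by rewrite Ioo gt0_muley ?leey// lte_fin.
move: (I0); rewrite -ltey => /ge0_fin_numE <- Ifin.
have mkm : measurable_fun setT (fun s => `|k s| `^ m).
  by apply: (measurableT_comp (measurable_powR m)); exact: measurableT_comp.
have ikm : leb.-integrable `[0, t] (EFin \o (fun s => `|k s| `^ m)).
  apply/integrableP; split; first by apply/measurable_EFinP; exact: measurable_funTS.
  rewrite ge0_fin_numE// in Ifin; apply: le_lt_trans Ifin.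
  rewrite /I; apply: ge0_le_integral => //.
  - by apply: measurable_funTS; apply: measurableT_comp => //; exact/measurable_EFinP.
  - by apply: measurable_funTS; exact/measurable_EFinP.
  - by move=> s _ /=; rewrite lee_fin ger0_norm ?powR_ge0.
have ic c : leb.-integrable `[0, t] (EFin \o (fun=> c)).
  exact: (@integrable_bounded_itv _ (cst c) `|c| t).
have isum c A : leb.-integrable `[0, t] (EFin \o (fun s => `|k s| `^ m / c + A)).
  have iZ := @integrableZl _ _ _ leb `[0, t]%classic (measurable_itv _) c^-1 _ ikm.
  have := @integrableD _ _ _ leb `[0, t]%classic (measurable_itv _) _ _ iZ (ic A).
  by apply: eq_integrable => // s _ /=; rewrite -EFinM mulrC.
have ik : leb.-integrable `[0, t] (EFin \o k).
  apply: (@le_integrable _ _ _ leb `[0, t]%classic _ _ _ _ _ (isum (1 `^ (m - 1)) 1)) => //.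
    by apply/measurable_EFinP; exact: measurable_funTS.
  move=> s _ /=; rewrite lee_fin [leRHS]ger0_norm; last first.
    by rewrite addr_ge0// divr_ge0 ?powR_ge0.
  exact: le_split_level.
set r := fine I.
have r0 : 0 <= r by exact: fine_ge0.
have rE : \int[leb]_(s in `[0, t]) (`|k s| `^ m) = r by [].
rewrite -(fineK Ifin) -/r -EFinM lee_fin.
apply/ler_addgt0Pl => e e0.
(* Adding ee to r keeps the level positive when r = 0, and costs e in the end. *)
pose ee := e / (2 `^ m * t `^ (m - 1)).
have ee0 : 0 < ee by rewrite divr_gt0.
pose A := ((r + ee) / t) `^ m^-1.
have A0 : 0 < A by rewrite powR_gt0// divr_gt0//; lra.
pose B := A `^ (m - 1).
have B0 : 0 < B by exact: powR_gt0.
have Am : A `^ m = (r + ee) / t.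
  by rewrite /A -powRrM mulVf ?gt_eqF// powRr1// divr_ge0 ?(ltW t0)//; lra.
have AB : A * B = A `^ m by rewrite /B mulr_powRB1 ?(ltW A0).
have q : `|\int[leb]_(s in `[0, t]) k s| <= 2 * A * t.
  apply: (le_trans (le_normr_Rintegral _ ik)) => //.
  apply: (@le_trans _ _ (\int[leb]_(s in `[0, t]) (`|k s| `^ m / B + A))).
    apply: le_Rintegral => //; first exact: integrable_norm.
    by move=> s _; exact: le_split_level.
  rewrite RintegralD//; last first.
    have := @integrableZl _ _ _ leb `[0, t]%classic (measurable_itv _) B^-1 _ ikm.
    by apply: eq_integrable => // s _ /=; rewrite -EFinM mulrC.
  rewrite RintegralZr// rE Rintegral_cst_itv ?(ltW t0)//.
  have : r / B <= A * t.
    rewrite ler_pdivrMr// mulrAC AB Am divfK ?gt_eqF//; lra.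
  lra.
apply: (@le_trans _ _ ((2 * A * t) `^ m)).
  by apply: ge0_ler_powR; rewrite ?nnegrE// ?(ltW m0)// !mulr_ge0// ltW.
rewrite !powRM ?mulr_ge0 ?(ltW A0) ?(ltW t0)// Am.
rewrite -(mulr_powRB1 (ltW t0) m0).
rewrite (_ : _ * _ * (t * _) = 2 `^ m * t `^ (m - 1) * (r + ee)); last first.
  by field; rewrite gt_eqF.
rewrite mulrDr addrC lerD2r /ee mulrCA divff ?mulr1// gt_eqF//.
Qed.

End jensen.

(** * Increments of Sobolev functions *)

Section gagliardo.
Context {R : realType} {n : nat}.
Local Notation V := 'rV[R]_n.
Local Notation mu := (lebesgue_rV R n).
Local Notation leb := (@lebesgue_measure R).
Implicit Types (w k : V -> R) (x h : V) (i : 'I_n).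
Local Notation e_ i := (delta_mx 0 i : V).

Lemma Lfun_measurable (m : R) w : w \in Lfun mu m%:E -> measurable_fun setT w.
Proof. by move=> /sub_Lfun_mfun; rewrite inE. Qed.

Definition increment (m : R) w h : \bar R := (\int[mu]_x (`|w (x + h) - w x| `^ m)%:E)%E.

Section fixed_w.
Variables (m : R) (w : V -> R).
Hypotheses (m1 : 1 < m) (Lw : w \in Lfun mu m%:E).

Let mw : measurable_fun setT w. Proof. exact: Lfun_measurable Lw. Qed.
Let m0 : 0 < m. Proof. exact: lt_trans ltr01 m1. Qed.

Lemma measurable_powR_norm d (T : measurableType d) (f : T -> R) : measurable_fun setT f ->
  measurable_fun setT (fun z => (`|f z| `^ m)%:E).
Proof.
move=> mf; apply/measurable_EFinP; apply: (measurableT_comp (measurable_powR m)).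
exact: measurableT_comp.
Qed.

Lemma measurable_increment h : measurable_fun setT (fun x => (`|w (x + h) - w x| `^ m)%:E).
Proof.
apply: measurable_powR_norm; apply: measurable_funB => //.
by apply: (measurableT_comp mw); exact: measurable_shift.
Qed.

Lemma incrementN h : increment m w (- h) = increment m w h.
Proof.
rewrite /increment -[LHS](ge0_integral_shift h (measurable_increment (- h))).
  by apply: eq_integral => x _; rewrite addrK distrC.
by move=> x; rewrite lee_fin powR_ge0.
Qed.

Lemma increment0 : increment m w 0 = 0%E.
Proof.
by apply: integral0_eq => x _; rewrite addr0 subrr normr0 powR0 ?gt_eqF.
Qed.

Lemma incrementD h h' :
  (increment m w (h + h') <= (2 `^ m)%:E * (increment m w h + increment m w h'))%E.
Proof.
have c0 : 0 <= (2:R) `^ m by exact: powR_ge0.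
have -> : increment m w h' = (\int[mu]_x (`|w (x + h + h') - w (x + h)| `^ m)%:E)%E.
  rewrite /increment -[LHS](ge0_integral_shift h (measurable_increment h'))//.
have msh : measurable_fun setT (fun x => (`|w (x + h + h') - w (x + h)| `^ m)%:E).
  exact: (measurableT_comp (measurable_increment h') (measurable_shift h)).
rewrite /increment -ge0_integralD//; last exact: measurable_increment.
rewrite -ge0_integralZl//; last 2 first.
- by apply: emeasurable_funD => //; exact: measurable_increment.
- by move=> x xT; rewrite adde_ge0.
apply: ge0_le_integral => //.
- exact: measurable_increment.
- apply: measurable_funeM; apply: emeasurable_funD => //; exact: measurable_increment.
move=> x _; rewrite -EFinD -EFinM lee_fin addrA [X in _ * X]addrC.
apply: le_trans (powRD_le _ _ m0) => //.
apply: ge0_ler_powR; rewrite ?nnegrE ?(ltW m0)//.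
rewrite (_ : w (x + h + h') - w x = (w (x + h + h') - w (x + h)) + (w (x + h) - w x)).
  exact: ler_normD.
by ring.
Qed.

Lemma increment_le_norm h : (increment m w h <=
  (2 `^ m)%:E * (\int[mu]_x (`|w (x + h)%R| `^ m)%:E + \int[mu]_x (`|w x| `^ m)%:E))%E.
Proof.
have c0 : 0 <= (2:R) `^ m by exact: powR_ge0.
have msh := measurableT_comp (measurable_powR_norm mw) (measurable_shift h).
have mw' := measurable_powR_norm mw.
rewrite -ge0_integralD//.
rewrite -ge0_integralZl//; last 2 first.
- by apply: emeasurable_funD.
- by move=> x xT; rewrite adde_ge0.
apply: ge0_le_integral => //.
- exact: measurable_increment.
- by apply: measurable_funeM; apply: emeasurable_funD.
move=> x _; rewrite -EFinD -EFinM lee_fin.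
apply: le_trans (powRD_le _ _ m0) => //.
by apply: ge0_ler_powR; rewrite ?nnegrE ?(ltW m0)//; exact: ler_normB.
Qed.

Lemma increment_bounded : exists2 C, 0 <= C & forall h, (increment m w h <= C%:E)%E.
Proof.
have iw := Lfun_integrable (ltW m1) Lw.
have Ifin := integrable_fin_num measurableT iw.
have Ish h : (\int[mu]_x (`|w (x + h)%R| `^ m)%:E = \int[mu]_x (`|w x| `^ m)%:E)%E.
  by apply: (ge0_integral_shift h (measurable_powR_norm mw)) => x; rewrite lee_fin powR_ge0.
have I0 : (0 <= \int[mu]_x (`|w x| `^ m)%:E)%E.
  by apply: integral_ge0 => x _; rewrite lee_fin powR_ge0.
have H h := increment_le_norm h; move: H I0 Ifin.
set I := (\int[mu]_x (`|w x| `^ m)%:E)%E => H I0 Ifin.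
exists (fine ((2 `^ m)%:E * (I + I))%E).
  by rewrite fine_ge0// mule_ge0 ?lee_fin ?powR_ge0// adde_ge0.
move=> h; rewrite fineK; last by rewrite fin_numM// fin_numD Ifin.
by apply: (le_trans (H h)); rewrite Ish.
Qed.

(** The increment is the integral of k over a segment of length t, almost everywhere. Jensen's
inequality costs t^(m-1), and the integration over the segment gives the last factor t. *)
Lemma increment_coord_ge0 i k (t : R) : k \in Lfun mu m%:E -> line_partial w k i ->
  0 < t -> (increment m w (t *: e_ i) <=
            (2 `^ m * t `^ m)%:E * \int[mu]_x (`|k x| `^ m)%:E)%E.
Proof.
move=> Lk wk t0; have mk := Lfun_measurable Lk.
have mkm := measurable_powR_norm mk.
pose J x := \int[leb]_(s in `[0, t]) k (x + s *: e_ i).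
have mJ : measurable_fun setT J by exact: measurable_line_Rintegral.
have -> : increment m w (t *: e_ i) = (\int[mu]_x (`|J x| `^ m)%:E)%E.
  apply: ae_eq_integral => //; [exact: measurable_increment|exact: measurable_powR_norm|].
  by apply: ae_eqT; apply: aeS (wk t (ltW t0)) => x ->.
pose f (z : V * R) : \bar R := (`|k (z.1 + z.2 *: e_ i)| `^ m * \1_(`[0, t]%classic) z.2)%:E.
have mf : measurable_fun setT f.
  apply/measurable_EFinP; apply: measurable_funM; last exact: measurable_indic_itv.
  apply: (measurableT_comp (measurable_powR m)); apply: measurableT_comp => //.
  exact: measurable_line_comp.
have f0 z : (0 <= f z)%E by rewrite lee_fin mulr_ge0// powR_ge0.
have c0 : 0 <= 2 `^ m * t `^ (m - 1) by rewrite mulr_ge0// powR_ge0.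
have mF := measurable_fun_fubini_tonelli_F (m2 := leb) f mf f0.
apply: (@le_trans _ _ (\int[mu]_x ((2 `^ m * t `^ (m - 1))%:E * \int[leb]_s f (x, s)))%E).
  apply: ge0_le_integral => //.
  - exact: measurable_powR_norm.
  - exact: measurable_funeM.
  move=> x _.
  have mkx : measurable_fun setT (fun s : R => k (x + s *: e_ i)).
    exact: measurable_fun_pair2 x (measurable_line_comp i mk).
  apply: (le_trans (powR_Rintegral_le mkx t0 m1)).
  rewrite lee_wpmul2l ?lee_fin// integral_mkcond le_eqVlt; apply/orP; left; apply/eqP.
  apply: eq_integral => s _; rewrite /f/= patchE indicE.
  by case: ifPn => _; rewrite ?mulr1 ?mulr0.
rewrite ge0_integralZl//; last by move=> x xT; exact: integral_ge0.
have -> : (\int[mu]_x \int[leb]_s f (x, s) = \int[leb]_s ((\1_(`[0, t]%classic) s)%:E * \int[mu]_x (`|k x| `^ m)%:E))%E.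
  transitivity (\int[leb]_s \int[mu]_x f (x, s))%E; first exact: fubini_tonelli.
  apply: eq_integral => s _.
  rewrite -(ge0_integral_shift (s *: e_ i) mkm); last by move=> x; rewrite lee_fin powR_ge0.
  rewrite -ge0_integralZl//; last exact: (measurableT_comp mkm (measurable_shift (s *: e_ i))).
  by apply: eq_integral => x _; rewrite /f/= mulrC EFinM.
rewrite ge0_integralZr//; [|by apply/measurable_EFinP|by apply: integral_ge0].
rewrite integral_indic// setIT muleA.
have lE : leb `[0, t]%classic = t%:E by rewrite lebesgue_measure_itv/= lte_fin t0 -EFinB subr0.
rewrite [X in (_ * X * _)%E](_ : _ = t%:E); last exact: lE.
by rewrite -EFinM -mulrA [_ * t]mulrC mulr_powRB1 ?(ltW t0).
Qed.

Lemma increment_coord i k : k \in Lfun mu m%:E -> line_partial w k i ->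
  exists2 C, 0 <= C & forall t : R, (increment m w (t *: e_ i) <= (C * `|t| `^ m)%:E)%E.
Proof.
move=> Lk wk; have ik := Lfun_integrable (ltW m1) Lk.
have Kfin := integrable_fin_num measurableT ik.
set K := (\int[mu]_x (`|k x| `^ m)%:E)%E in Kfin.
have K0 : (0 <= K)%E by apply: integral_ge0 => x _; rewrite lee_fin powR_ge0.
exists (2 `^ m * fine K); first by rewrite mulr_ge0 ?powR_ge0 ?fine_ge0.
have pos t : 0 < t -> (increment m w (t *: e_ i) <= (2 `^ m * fine K * `|t| `^ m)%:E)%E.
  move=> t0; apply: (le_trans (increment_coord_ge0 Lk wk t0)).
  by rewrite gtr0_norm// -/K -(fineK Kfin) -EFinM mulrAC.
move=> t; have [t0|t0|->] := ltgtP t 0; last 2 first.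
- exact: pos.
- by rewrite scale0r increment0 lee_fin mulr_ge0 ?powR_ge0// mulr_ge0 ?powR_ge0 ?fine_ge0.
- by rewrite -(opprK t) scaleNr incrementN normrN; apply: pos; rewrite oppr_gt0.
Qed.

(** A general translation is a composition of translations along the coordinate axes. *)
Lemma increment_le (g : V -> V) :
  (forall i, (fun x => g x 0 i) \in Lfun mu m%:E) ->
  (forall i, line_partial w (fun x => g x 0 i) i) ->
  exists2 C, 0 <= C & forall h, (increment m w h <= (C * `|h| `^ m)%:E)%E.
Proof.
move=> Lg wg.
have H (s : seq 'I_n) : exists2 C, 0 <= C &
    forall h, (increment m w (\sum_(i <- s) h 0 i *: e_ i) <= (C * `|h| `^ m)%:E)%E.
  elim: s => [|i s [C C0 hC]].
    by exists 0 => // h; rewrite big_nil increment0 mul0r.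
  have [D D0 hD] := increment_coord (Lg i) (wg i).
  exists (2 `^ m * (D + C)); first by rewrite mulr_ge0 ?powR_ge0// addr_ge0.
  move=> h; rewrite big_cons; apply: (le_trans (incrementD _ _)).
  rewrite -mulrA EFinM lee_wpmul2l ?lee_fin ?powR_ge0// mulrDl EFinD; apply: leeD => //.
  apply: (le_trans (hD _)); rewrite lee_fin ler_wpM2l//.
  by apply: ge0_ler_powR; rewrite ?nnegrE ?(ltW m0)// coord_le_norm.
have [C C0 hC] := H (index_enum 'I_n); exists C; first exact: C0.
by move=> h; have := hC h; rewrite -row_sum_delta.
Qed.

End fixed_w.

Lemma measurable_enorm : measurable_fun setT (@enorm R n).
Proof.
have ms : measurable_fun setT (@Num.sqrt R).
  by apply: continuous_measurable_fun; exact: sqrt_continuous.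
apply: (measurableT_comp ms); rewrite /edot.
apply: measurable_sum => i; apply: measurable_funM; exact: measurable_rV_coord.
Qed.

Lemma enormN (x : V) : enorm (- x) = enorm x.
Proof. by rewrite /enorm /edot; congr Num.sqrt; apply: eq_bigr => i _; rewrite !mxE mulrNN. Qed.

Lemma norm_le_enorm (x : V) : `|x| <= enorm x.
Proof.
rewrite [leLHS]/Num.norm /= mx_normrE; apply/bigmax_leP; split; first exact: sqrtr_ge0.
case=> o i _ /=; rewrite ord1.
rewrite -sqrtr_sqr; apply: ler_wsqrtr; rewrite /edot (bigD1 i)//= -expr2 lerDl.
by apply: sumr_ge0 => j _; rewrite -expr2 sqr_ge0.
Qed.

End gagliardo.

(** * The Gagliardo seminorm *)

Section gagliardo_seminorm.
Context {R : realType} {n : nat}.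
Local Notation V := 'rV[R]_n.
Local Notation mu := (lebesgue_rV R n).
Implicit Types (w : V -> R) (x h : V).

Definition gagliardo (m s : R) w (z : V * V) : R :=
  `|w z.1 - w z.2| `^ m / enorm (z.1 - z.2) `^ (n%:R + m * s).

Lemma measurable_enormB (a : R) :
  measurable_fun setT (fun z : V * V => (enorm (z.1 - z.2) `^ a)^-1).
Proof.
rewrite (_ : (fun _ => _) = (fun z : V * V => enorm (z.1 - z.2) `^ (- a))); last first.
  by apply/funext => z; rewrite powRN.
apply: (measurableT_comp (measurable_powR (- a))).
apply: (measurableT_comp measurable_enorm).
apply: measurable_fun_rV => i.
rewrite (_ : _ \o _ = (fun z : V * V => rV_coord i z.1 - rV_coord i z.2)); last first.
  by apply/funext => z; rewrite /rV_coord/= !mxE.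
apply: measurable_funB.
  exact: (measurableT_comp (@measurable_rV_coord R n i) measurable_fst).
exact: (measurableT_comp (@measurable_rV_coord R n i) measurable_snd).
Qed.

Lemma measurable_diff w : measurable_fun setT w ->
  measurable_fun setT (fun z : V * V => w z.1 - w z.2).
Proof.
move=> mw; apply: measurable_funB.
  exact: (measurableT_comp mw measurable_fst).
exact: (measurableT_comp mw measurable_snd).
Qed.

Lemma measurable_gagliardo m s w : measurable_fun setT w ->
  measurable_fun setT (gagliardo m s w).
Proof.
move=> mw; apply: measurable_funM; last exact: measurable_enormB.
apply: (measurableT_comp (measurable_powR m)); apply: measurableT_comp => //.
exact: measurable_diff.
Qed.

Lemma gagliardo_ge0 m s w z : 0 <= gagliardo m s w z.
Proof. by rewrite /gagliardo divr_ge0 ?powR_ge0. Qed.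

(** In the variables (x, h) with h = y - x the double integral of the Gagliardo quotient
is the integral in h of the increments of w against |h|^-(n + ms). *)
Lemma gagliardo_lty m s w (g : V -> V) : 1 < m -> 0 < s < 1 ->
  w \in Lfun mu m%:E ->
  (forall i, (fun x => g x 0 i) \in Lfun mu m%:E) ->
  (forall i, line_partial w (fun x => g x 0 i) i) ->
  (mu \x mu)%E.-integrable setT (EFin \o gagliardo m s w).
Proof.
move=> m1 hs Lw Lg wg; have m0 : 0 < m by lra.
have mw := Lfun_measurable Lw.
have mG := measurable_gagliardo m s mw.
have mGE : measurable_fun setT (EFin \o gagliardo m s w) by exact/measurable_EFinP.
set a := n%:R + m * s.
have a0 : 0 < a by rewrite /a ltr_wpDl// mulr_gt0//; lra.
have [C C0 hC] := increment_le m1 Lw Lg wg.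
have [D D0 hD] := increment_bounded m1 Lw.
apply: (integrable12ltyP _ _ mGE).2.
pose f (z : V * V) : \bar R := (gagliardo m s w (z.1, z.2 + z.1))%:E.
have mf : measurable_fun setT f.
  apply/measurable_EFinP; apply: (measurableT_comp mG).
  apply/measurable_fun_pair; first exact: measurable_fst.
  apply: measurable_fun_rV => i.
  rewrite (_ : _ \o _ = (fun z : V * V => rV_coord i z.2 + rV_coord i z.1)); last first.
    by apply/funext => z; rewrite /rV_coord/= !mxE.
  apply: measurable_funD.
    exact: (measurableT_comp (@measurable_rV_coord R n i) measurable_snd).
  exact: (measurableT_comp (@measurable_rV_coord R n i) measurable_fst).
have f0 z : (0 <= f z)%E by rewrite lee_fin gagliardo_ge0.
have -> : (\int[mu]_x \int[mu]_y `|(EFin \o gagliardo m s w) (x, y)| =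
           \int[mu]_x \int[mu]_h f (x, h))%E.
  apply: eq_integral => x _; rewrite -[RHS]/(\int[mu]_h (fun y => (gagliardo m s w (x, y))%:E) (h + x)%R)%E.
  rewrite ge0_integral_shift; last 2 first.
  - exact: measurable_fun_pair2 x mGE.
  - by move=> y; rewrite lee_fin gagliardo_ge0.
  by apply: eq_integral => y _ /=; rewrite ger0_norm ?gagliardo_ge0.
have -> : (\int[mu]_x \int[mu]_h f (x, h) = \int[mu]_h \int[mu]_x f (x, h))%E.
  exact: fubini_tonelli.
have mk := @measurable_kern R n m a.
apply: (@le_lt_trans _ _ (\int[mu]_h ((D + C)%:E * (kern m a h)%:E))%E); last first.
  rewrite ge0_integralZl//; last 3 first.
  - exact/measurable_EFinP.
  - by move=> h _; rewrite lee_fin kern_ge0.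
  - by rewrite lee_fin addr_ge0.
  rewrite lte_mul_pinfty ?lee_fin ?addr_ge0//.
  exact: kern_lty.
apply: ge0_le_integral => //.
- by move=> h hT; apply: integral_ge0.
- exact: measurable_fun_fubini_tonelli_G.
- by apply: measurable_funeM; exact/measurable_EFinP.
move=> h _.
have -> : (\int[mu]_x f (x, h) = ((enorm h `^ a)^-1)%:E * increment m w h)%E.
  rewrite /increment -ge0_integralZl//; last 2 first.
  - exact: (measurable_increment Lw h).
  - by rewrite lee_fin invr_ge0 powR_ge0.
  apply: eq_integral => x _; rewrite /f /gagliardo/= -EFinM; congr EFin.
  by rewrite opprD addrCA subrr addr0 enormN mulrC distrC [h + x]addrC.
have [h0|hn0] := eqVneq `|h| 0.
  have := normr0_eq0 h0 => ->; rewrite increment0// mule0 -EFinM lee_fin mulr_ge0 ?addr_ge0//.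
  exact: kern_ge0.
have hp : 0 < `|h| by rewrite lt_neqAle eq_sym hn0/=.
have ha : (enorm h `^ a)^-1 <= (`|h| `^ a)^-1.
  have hle := norm_le_enorm h.
  rewrite lef_pV2 ?posrE ?powR_gt0//; last by exact: lt_le_trans hle.
  by apply: ge0_ler_powR; rewrite ?nnegrE// ?(ltW a0)// (le_trans _ hle).
have Ih : (increment m w h <= ((D + C) * Num.min 1 (`|h| `^ m))%:E)%E.
  rewrite /Num.min; case: ifPn => _.
    by rewrite mulr1; apply: (le_trans (hD h)); rewrite lee_fin lerDl.
  apply: (le_trans (hC h)); rewrite lee_fin ler_wpM2r ?powR_ge0//; lra.
apply: (@le_trans _ _ (((enorm h `^ a)^-1)%:E * ((D + C) * Num.min 1 (`|h| `^ m))%:E)%E).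
  by rewrite lee_wpmul2l// lee_fin invr_ge0 powR_ge0.
rewrite -!EFinM lee_fin /kern mulrC -mulrA ler_wpM2l ?addr_ge0//.
by rewrite ler_wpM2l// le_min ler01 powR_ge0.
Qed.

End gagliardo_seminorm.

(** * Finsler-Minkowski norms *)

Section finsler.
Context {R : realType} {n : nat}.
Local Notation V := 'rV[R]_n.
Implicit Types (x y xi eta zeta : V).
Variable H : V -> R.
Hypothesis hH : finsler_minkowski H.
Local Notation e_ i := (delta_mx 0 i : V).

Let H_ge0 x : 0 <= H x. Proof. exact: finsler_ge0 hH x. Qed.
Let H0 : H 0 = 0. Proof. exact/(finsler_eq0 hH). Qed.
Let HZ (t : R) x : H (t *: x) = `|t| * H x. Proof. exact: finsler_homo hH t x. Qed.

Lemma finsler_triangle x y : H (x + y) <= H x + H y.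
Proof.
have [xy|] := boolP (free [:: x; y]); first exact/ltW/(finsler_strict hH).
rewrite free_cons seq1_free negb_and !negbK => /orP[|/eqP->]; last by rewrite addr0 H0 addr0.
rewrite span_seq1 => /vlineP[k ->].
rewrite -[X in H (_ + X)]scale1r -scalerDl !HZ -[X in _ <= _ + X]mul1r -mulrDl ler_wpM2r//.
by apply: (le_trans (ler_normD _ _)); rewrite normr1.
Qed.

Lemma finsler_sum x : H x <= \sum_i `|x 0 i| * H (e_ i).
Proof.
rewrite {1}(row_sum_delta x).
apply: (big_ind2 (fun (y : V) (r : R) => H y <= r)) => [|y r z q yr zq|i _].
- by rewrite H0.
- exact: le_trans (finsler_triangle y z) (lerD yr zq).
- by rewrite HZ.
Qed.

Lemma finsler_quotient x y (h : R) : h != 0 -> `|h^-1 * (H (h *: y + x) - H x)| <= H y.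
Proof.
move=> h0; rewrite normrM normfV ler_pdivrMl ?normr_gt0// -HZ ler_norml.
have h1 := finsler_triangle (h *: y) x.
have h2 := finsler_triangle (- (h *: y)) (h *: y + x).
have HN z : H (- z) = H z by rewrite -scaleN1r HZ normrN normr1 mul1r.
rewrite addKr HN in h2; apply/andP; split; lra.
Qed.

Lemma finsler_differentiable x : x != 0 -> differentiable H x.
Proof. by move=> /eqP x0; have [+ _] := finsler_C1 hH; apply. Qed.

Lemma edot_grad x y : x != 0 -> edot (grad H x) y = 'D_y H x.
Proof.
move=> x0; have dH := finsler_differentiable x0.
rewrite deriveE// {2}(row_sum_delta y) linear_sum /edot; apply: eq_bigr => i _.
by rewrite linearZ mxE /partial deriveE// /GRing.scale/= mulrC.
Qed.

(** By the triangle inequality the difference quotients in the direction y are bounded by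
H(y). *)
Lemma derive_finsler_le x y : x != 0 -> `|'D_y H x| <= H y.
Proof.
move=> x0; have dH := @diff_derivable _ _ _ _ _ y (finsler_differentiable x0).
have cv : (fun h : R => `|h^-1 *: ((H \o shift x) (h *: y) - H x)|) @ 0^' --> `|'D_y H x|.
  exact: cvg_norm dH.
apply: (ler_cvg_to cv (cvg_cst (H y))).
by near=> h; apply: finsler_quotient; near: h; exact: nbhs_dnbhs_neq.
Unshelve. all: by end_near. Qed.

(** Euler's identity: by homogeneity the difference quotients at x in the direction x are
constant near 0. *)
Lemma derive_finsler_self x : x != 0 -> 'D_x H x = H x.
Proof.
move=> x0; apply: cvg_lim => //; apply: (@cvg_near_cst _ _ _ _ _ (dnbhs_filter _)).
near=> h.
have h0 : h != 0 by near: h; exact: nbhs_dnbhs_neq.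
have h1 : `|h| <= 1 by near: h; exact: dnbhs0_le.
have hp : 0 <= h + 1 by move: h1; rewrite ler_norml; lra.
rewrite /= -[X in h *: x + X]scale1r -scalerDl HZ ger0_norm// /GRing.scale/=.
by rewrite mulrDl mul1r addrK mulrA mulVf// mul1r.
Unshelve. all: by end_near. Qed.

Variable m : R.
Hypothesis m1 : 1 < m.
Local Notation flux := (finsler_flux H m).

Lemma edotZl (c : R) x y : edot (c *: x) y = c * edot x y.
Proof. by rewrite /edot mulr_sumr; apply: eq_bigr => i _; rewrite mxE mulrA. Qed.
Lemma edotZr (c : R) x y : edot x (c *: y) = c * edot x y.
Proof. by rewrite /edot mulr_sumr; apply: eq_bigr => i _; rewrite mxE mulrCA. Qed.
Lemma edotBl x x' y : edot (x - x') y = edot x y - edot x' y.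
Proof. by rewrite /edot -sumrB; apply: eq_bigr => i _; rewrite !mxE mulrBl. Qed.
Lemma edotBr x y y' : edot x (y - y') = edot x y - edot x y'.
Proof. by rewrite /edot -sumrB; apply: eq_bigr => i _; rewrite !mxE mulrBr. Qed.
Lemma edot0l y : edot 0 y = 0.
Proof. by rewrite /edot big1// => i _; rewrite mxE mul0r. Qed.

Lemma edot_flux_self xi : edot (flux xi) xi = H xi `^ (m - 1) * H xi.
Proof.
rewrite /finsler_flux; case: ifPn => [/eqP->|xi0]; first by rewrite edot0l H0 mulr0.
by rewrite edotZl edot_grad// derive_finsler_self.
Qed.

Lemma edot_flux_le xi zeta : `|edot (flux xi) zeta| <= H xi `^ (m - 1) * H zeta.
Proof.
rewrite /finsler_flux; case: ifPn => [_|xi0].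
  by rewrite edot0l normr0 mulr_ge0 ?powR_ge0.
rewrite edotZl edot_grad// normrM ger0_norm ?powR_ge0// ler_wpM2l ?powR_ge0//.
exact: derive_finsler_le.
Qed.

(** With A = H(xi) and B = H(eta), Euler's identity and the bound on the derivative give the
lower bound (A^(m-1) - B^(m-1)) (A - B). *)
Lemma flux_monotone xi eta : 0 <= edot (flux xi - flux eta) (xi - eta).
Proof.
rewrite edotBl !edotBr !edot_flux_self.
have := edot_flux_le xi eta; have := edot_flux_le eta xi.
move: (H_ge0 xi) (H_ge0 eta); set A := H xi; set B := H eta => A0 B0.
rewrite !ler_norml => /andP[_ h1] /andP[_ h2].
suff : 0 <= (A `^ (m - 1) - B `^ (m - 1)) * (A - B) by nra.
have mono a b : 0 <= a -> a <= b -> a `^ (m - 1) <= b `^ (m - 1).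
  by move=> a0 ab; apply: ge0_ler_powR; rewrite ?nnegrE//; [by rewrite subr_ge0 ltW|exact: le_trans ab].
have [AB|/ltW BA] := leP A B.
  by rewrite mulr_le0// subr_le0// mono.
by rewrite mulr_ge0// subr_ge0// mono.
Qed.

Lemma edot_flux_bound xi zeta : `|edot (flux xi) zeta| <= H xi `^ m + H zeta `^ m.
Proof.
apply: (le_trans (edot_flux_le xi zeta)).
have m0 : 0 < m by exact: lt_trans ltr01 m1.
rewrite -(mulr_powRB1 (H_ge0 xi) m0) -(mulr_powRB1 (H_ge0 zeta) m0) mulrC.
have [h|/ltW h] := leP (H zeta) (H xi).
  apply: ler_wpDr; first by rewrite mulr_ge0 ?powR_ge0.
  by rewrite ler_wpM2r ?powR_ge0.
apply: ler_wpDl; first by rewrite mulr_ge0 ?powR_ge0.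
by rewrite ler_wpM2l//; apply: ge0_ler_powR; rewrite ?nnegrE// subr_ge0 ltW.
Qed.

(** A function continuous off the origin is Borel once its value at the origin is fixed: the
preimage of an interval is open up to one point. *)
Lemma measurable_off0 (f : V -> R) : (forall x, x != 0 -> {for x, continuous f}) ->
  measurable_fun setT (fun x => if x == 0 then 0 else f x).
Proof.
move=> cf; apply: (measurability _ (RGenOpens.measurableE R)) => //.
move=> _ [_ [a [b ->] <-]]; rewrite setTI.
set I := `]a, b[%classic.
rewrite (_ : _ @^-1` I = (if 0 \in I then [set 0] else set0) `|` ((~` [set 0]) `&` (f @^-1` I))).
  apply: measurableU.
    case: ifP => _ //; apply: closed_measurable_rV; apply: compact_closed.
      exact: norm_hausdorff.
    exact: compact_set1.
  apply: open_measurable_rV; rewrite openE => x [x0 fx]; rewrite /interior.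
  apply: filterI.
    apply: open_nbhs_nbhs; split => //; apply: closed_openC; apply: compact_closed.
      exact: norm_hausdorff.
    exact: compact_set1.
  apply: (cf x); first exact/eqP.
  by apply: open_nbhs_nbhs; split => //; exact: interval_open.
apply/seteqP; split => x /=.
  have [->|x0] := eqVneq x 0; first by move=> I0; left; rewrite mem_set.
  by move=> fx; right; split => //; exact/eqP.
case=> [|[/eqP/negbTE -> //]].
by case: ifPn => [/set_mem I0 -> |//]; rewrite eqxx.
Qed.

Lemma measurable_finsler : measurable_fun setT H.
Proof.
rewrite (_ : H = fun x => if x == 0 then 0 else H x).
  apply: measurable_off0 => x x0; apply: differentiable_continuous.
  exact: finsler_differentiable.
by apply/funext => x; case: eqVneq => [->|].
Qed.

Lemma measurable_flux i : measurable_fun setT (fun x => flux x 0 i).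
Proof.
rewrite (_ : (fun _ => _) = (fun x => H x `^ (m - 1) * (if x == 0 then 0 else partial i H x))).
  apply: measurable_funM.
    exact: (measurableT_comp (measurable_powR (m - 1)) measurable_finsler).
  apply: measurable_off0 => x /eqP x0.
  by have [_ /(_ i)/= h] := finsler_C1 hH; exact: h.
by apply/funext => x; rewrite /finsler_flux; case: ifPn => _; rewrite !mxE ?mulr0.
Qed.

End finsler.

(** * Sobolev functions and their gradients *)

Section sobolev_facts.
Context {R : realType} {n : nat}.
Local Notation V := 'rV[R]_n.
Local Notation mu := (lebesgue_rV R n).
Implicit Types (w f : V -> R) (g : V -> V) (x : V) (i : 'I_n).

Lemma LfunI (m : R) f : 1 < m -> measurable_fun setT f ->
  (\int[mu]_x (`|f x| `^ m)%:E < +oo)%E -> f \in Lfun mu m%:E.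
Proof.
move=> m1 mf If; have m0 : 0 < m by lra.
rewrite inE; apply/andP; split; rewrite inE//=.
rewrite /finite_norm unlock /=; apply: poweR_lty.
exact: If.
Qed.

Lemma Lfun_le (m : R) f w : 1 < m -> measurable_fun setT f ->
  (forall x, `|f x| <= `|w x|) -> w \in Lfun mu m%:E -> f \in Lfun mu m%:E.
Proof.
move=> m1 mf fw Lw; have m0 : 0 < m by lra.
have mw := Lfun_measurable Lw.
apply: LfunI => //; have /integrableP[_] := Lfun_integrable (ltW m1) Lw.
apply: le_lt_trans; apply: ge0_le_integral => //.
- exact: measurable_powR_norm.
- by apply: measurableT_comp => //; exact: measurable_powR_norm.
move=> x _ /=; rewrite lee_fin [leRHS]ger0_norm ?powR_ge0//.
by apply: ge0_ler_powR; rewrite ?nnegrE ?(ltW m0).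
Qed.

Lemma Lfun_ae (m : R) f w : 1 < m -> measurable_fun setT f ->
  {ae mu, forall x, w x = f x} -> w \in Lfun mu m%:E -> f \in Lfun mu m%:E.
Proof.
move=> m1 mf wf Lw; have m0 : 0 < m by lra.
have mw := Lfun_measurable Lw.
apply: LfunI => //.
have -> : (\int[mu]_x (`|f x| `^ m)%:E = \int[mu]_x (`|w x| `^ m)%:E)%E.
  apply: ae_eq_integral => //; [exact: measurable_powR_norm|exact: measurable_powR_norm|].
  by apply: ae_eqT; apply: aeS wf => x ->.
have := integrable_fin_num measurableT (Lfun_integrable (ltW m1) Lw).
by rewrite ge0_fin_numE//; apply: integral_ge0 => x _; rewrite lee_fin powR_ge0.
Qed.

Lemma LfunD (m : R) f w : 1 < m -> f \in Lfun mu m%:E -> w \in Lfun mu m%:E ->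
  (fun x => f x + w x) \in Lfun mu m%:E.
Proof.
move=> m1 Lf Lw; have p1 : (1 <= m%:E)%E by rewrite lee_fin ltW.
by have [_ /(_ _ _ Lf Lw)] := Lfun_addr_closed mu p1.
Qed.

Lemma LfunZ (m c : R) f : 1 < m -> f \in Lfun mu m%:E ->
  (fun x => c * f x) \in Lfun mu m%:E.
Proof.
move=> m1 Lf; have mf := Lfun_measurable Lf.
apply: LfunI => //; first exact: measurable_funM.
have := integrableZl measurableT (`|c| `^ m) (Lfun_integrable (ltW m1) Lf).
move=> /(integrable_fin_num measurableT); rewrite ge0_fin_numE; last first.
  by apply: integral_ge0 => x _; rewrite lee_fin mulr_ge0 ?powR_ge0.
by under eq_integral do rewrite -EFinM -powRM// -normrM.
Qed.

Lemma LfunB (m : R) f w : 1 < m -> f \in Lfun mu m%:E -> w \in Lfun mu m%:E ->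
  (fun x => f x - w x) \in Lfun mu m%:E.
Proof.
move=> m1 Lf /(LfunZ (-1) m1) /(LfunD m1 Lf).
by under eq_fun do rewrite mulN1r.
Qed.

Lemma Lfun_normr (m : R) f : 1 < m -> f \in Lfun mu m%:E ->
  (fun x => `|f x|) \in Lfun mu m%:E.
Proof.
move=> m1 Lf; have mf := Lfun_measurable Lf.
by apply: Lfun_le Lf => // [|x]; [exact: measurableT_comp|rewrite normr_id].
Qed.

(** |f| <= |f|^m + 1, and cubes have finite measure. *)
Lemma Lfun_loc_integrable (m : R) f : 1 < m -> f \in Lfun mu m%:E -> loc_integrable f.
Proof.
move=> m1 Lf; have mf := Lfun_measurable Lf; have mfE : measurable_fun setT (EFin \o f) by exact/measurable_EFinP.
apply/loc_integrable_cube; split=> // M.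
have mM : measurable (cube M : set V) by exact: measurable_cube.
have i1 : mu.-integrable (cube M) (EFin \o (fun=> 1)).
  apply/integrableP; split; first by apply/measurable_EFinP.
  rewrite (eq_integral (cst 1%E)); last by move=> x _ /=; rewrite normr1.
  by rewrite integral_cst// mul1e; exact: lebesgue_rV_cube_lty.
have i2 := integrableS measurableT mM (@subsetT _ _) (Lfun_integrable (ltW m1) Lf).
apply: (le_integrable mM _ _ (integrableD mM i2 i1)); first exact: measurable_funTS.
move=> x _ /=; rewrite lee_fin [leRHS]ger0_norm ?addr_ge0 ?powR_ge0//.
by have := le_split_level (normr_ge0 (f x)) ltr01 m1; rewrite powR1 divr1.
Qed.

Lemma weak_grad_unique w g g' : is_weak_grad w g -> is_weak_grad w g' ->
  forall i, {ae mu, forall x, g x 0 i = g' x 0 i}.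
Proof.
move=> [lg wg] [lg' wg'] i.
have H := fundamental_lemma (loc_integrableB (lg i) (lg' i)).
apply: aeS (H _) => [x /eqP|psi tpsi]; first by rewrite subr_eq0 => /eqP.
under eq_Rintegral do rewrite mulrBl.
rewrite RintegralB//; [|exact: loc_integrableM_test|exact: loc_integrableM_test].
have := wg psi tpsi i; rewrite (wg' psi tpsi i) => /oppr_inj ->; exact: subrr.
Qed.

Lemma wgradP w g : is_weak_grad w g -> is_weak_grad w (wgrad w).
Proof. by move=> wg; apply: (@xgetPex _ (fun=> 0) [set g | is_weak_grad w g]); exists g. Qed.

Lemma sobolev_wgrad (m : R) w : 1 < m -> sobolev m w ->
  is_weak_grad w (wgrad w) /\ forall i, (fun x => wgrad w x 0 i) \in Lfun mu m%:E.
Proof.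
move=> m1 [Lw [g [wg Lg]]]; have ww := wgradP wg; split=> // i.
by apply: Lfun_ae (weak_grad_unique wg ww i) (Lg i) => //; have [/(_ i)[]] := ww.
Qed.

Lemma sobolev_gagliardo (m s : R) w : 1 < m -> 0 < s < 1 -> sobolev m w ->
  (mu \x mu)%E.-integrable setT (EFin \o gagliardo m s w).
Proof.
move=> m1 hs sw; have [Lw _] := sw; have [[lg wg] Lg] := sobolev_wgrad m1 sw.
apply: (gagliardo_lty (g := wgrad w)) => // i.
apply: weak_partial_line => //; first exact: Lfun_loc_integrable Lw.
by move=> psi tpsi; exact: wg.
Qed.

(** The chain rule on lines, transported to weak derivatives in both directions. *)
Lemma weak_grad_huberB u v gu gv : loc_integrable u -> loc_integrable v ->
  is_weak_grad u gu -> is_weak_grad v gv ->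
  is_weak_grad (fun x => huber (u x - v x)) (fun x => clamp (u x - v x) *: (gu x - gv x)).
Proof.
move=> lu lv [lgu wu] [lgv wv].
have lw := loc_integrableB lu lv.
have lg i := loc_integrableB (lgu i) (lgv i).
have mc : measurable_fun setT (fun x => clamp (u x - v x)).
  by have [mw _] := lw; exact: measurableT_comp (C11_dmeas huber_C11) mw.
have lcg i : loc_integrable (fun x => clamp (u x - v x) * (gu x 0 i - gv x 0 i)).
  apply: (loc_integrable_le _ (lg i)); first by apply: measurable_funM => //; have [] := lg i.
  by move=> x; rewrite normrM ler_piMl// (C11_bound huber_C11).
have cgE i : (fun x => (clamp (u x - v x) *: (gu x - gv x)) 0 i) =
    (fun x => clamp (u x - v x) * (gu x 0 i - gv x 0 i)).
  by apply/funext => x; rewrite !mxE.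
split=> [i|psi tpsi i]; first by rewrite cgE.
have wp : weak_partial (fun x => u x - v x) (fun x => gu x 0 i - gv x 0 i) i.
  move=> chi tchi; have tp := test_function_partial i tchi.
  under eq_Rintegral do rewrite mulrBl.
  under [in RHS]eq_Rintegral do rewrite mulrBl.
  rewrite !RintegralB//; try exact: loc_integrableM_test.
  by rewrite wu// wv// opprB opprK addrC.
have := line_partial_weak _ _ (line_partial_chain huber_C11 lw (lg i) (weak_partial_line lw (lg i) wp)).
have lh : loc_integrable (fun x => huber (u x - v x)).
  apply: (loc_integrable_le _ lw).
    by have [mw _] := lw; exact: measurableT_comp (C11_meas huber_C11) mw.
  by move=> x; have := huber_lip 0 (u x - v x); rewrite huber0 !subr0.
move=> /(_ lh (lcg i) psi tpsi) ->; congr (- _).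
by apply: eq_Rintegral => x _; rewrite (congr1 (@^~ x) (cgE i)).
Qed.

End sobolev_facts.

(** * The comparison principle *)

Section signed_power.
Context {R : realType}.
Variables (m : R) (m1 : 1 < m).

Definition spow (a : R) : R := `|a| `^ (m - 2) * a.

Lemma spow_ge0E a : 0 <= a -> spow a = a `^ (m - 1).
Proof.
move=> a0; have m1' : 0 < m - 1 by rewrite subr_gt0.
rewrite /spow ger0_norm// -(mulr_powRB1 a0 m1') mulrC.
by congr (_ * _ `^ _); ring.
Qed.

Lemma spowN a : spow (- a) = - spow a.
Proof. by rewrite /spow normrN mulrN. Qed.

Lemma spow_lt a b : a < b -> spow a < spow b.
Proof.
have m1' : 0 < m - 1 by rewrite subr_gt0.
have pos x y : 0 <= x -> x < y -> spow x < spow y.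
  move=> x0 xy; have y0 : 0 <= y by lra.
  by rewrite !spow_ge0E//; apply: gt0_ltr_powR; rewrite ?nnegrE.
have sgn x : 0 < x -> 0 < spow x.
  by move=> x0; rewrite spow_ge0E ?(ltW x0)// powR_gt0.
move=> ab; have [a0|a0] := leP 0 a; first exact: pos.
have [b0|b0] := leP b 0.
  have := pos (- b) (- a); rewrite !spowN ltrN2 oppr_ge0 ltrN2; exact.
have := sgn b b0; have := sgn (- a); rewrite oppr_gt0 spowN => /(_ a0); lra.
Qed.

Lemma spow_mul_bound (a b : R) : `|spow a * b| <= `|a| `^ m + `|b| `^ m.
Proof.
have m0 : 0 < m by exact: lt_trans ltr01 m1.
have -> : `|spow a * b| = `|a| `^ (m - 1) * `|b|.
  by rewrite -(spow_ge0E (normr_ge0 a)) /spow normrM normrM normr_id ger0_norm ?powR_ge0.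
rewrite -(mulr_powRB1 (normr_ge0 a) m0) -(mulr_powRB1 (normr_ge0 b) m0) mulrC.
have [h|/ltW h] := leP `|b| `|a|.
  apply: ler_wpDr; first by rewrite mulr_ge0 ?powR_ge0.
  by rewrite ler_wpM2r ?powR_ge0.
apply: ler_wpDl; first by rewrite mulr_ge0 ?powR_ge0.
by rewrite ler_wpM2l//; apply: ge0_ler_powR; rewrite ?nnegrE// subr_ge0 ltW.
Qed.

End signed_power.

Section nonlocal.
Context {R : realType} {n : nat}.
Local Notation V := 'rV[R]_n.
Local Notation mu := (lebesgue_rV R n).
Implicit Types (u v w phi : V -> R) (x : V).
Variables (m s : R).
Hypotheses (m1 : 1 < m) (hs : 0 < s < 1).

Definition nonlocal_integrand w phi (z : V * V) : R :=
  `|w z.1 - w z.2| `^ (m - 2) * (w z.1 - w z.2) * (phi z.1 - phi z.2)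
     / enorm (z.1 - z.2) `^ (n%:R + m * s).

Lemma integrable_nonlocal w phi : sobolev m w -> sobolev m phi ->
  (mu \x mu)%E.-integrable setT (EFin \o nonlocal_integrand w phi).
Proof.
move=> sw sp.
have mw := Lfun_measurable sw.1; have mp := Lfun_measurable sp.1.
have iw := sobolev_gagliardo m1 hs sw; have ip := sobolev_gagliardo m1 hs sp.
apply: (le_integrable measurableT _ _ (integrableD measurableT iw ip)).
  apply/measurable_EFinP; apply: measurable_funM; last exact: measurable_enormB.
  apply: measurable_funM; last exact: measurable_diff.
  apply: measurable_funM; last exact: measurable_diff.
  apply: (measurableT_comp (measurable_powR (m - 2))); apply: measurableT_comp => //.
  exact: measurable_diff.
move=> z _ /=; rewrite lee_fin [leRHS]ger0_norm ?addr_ge0 ?gagliardo_ge0//.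
rewrite /nonlocal_integrand /gagliardo -mulrDl normrM [X in _ * X]ger0_norm ?invr_ge0 ?powR_ge0//.
by rewrite ler_wpM2r ?invr_ge0 ?powR_ge0//; exact: spow_mul_bound.
Qed.

Variables (u v : V -> R).
Let w x := u x - v x.
Let phi x := huber (w x).
Hypotheses (su : sobolev m u) (sv : sobolev m v) (sphi : sobolev m phi).

(** The increment of w = u - v is the difference of those of u and v, so the difference of
the signed powers has its sign, and so has phi(x) - phi(y) unless it is 0. *)
Lemma nonlocal_integrand_le z : nonlocal_integrand v phi z <= nonlocal_integrand u phi z /\
  (nonlocal_integrand v phi z = nonlocal_integrand u phi z -> phi z.1 = phi z.2).
Proof.
case: z => x y; rewrite /nonlocal_integrand/=.
rewrite -!/(spow _ _).
have [->|xy] := eqVneq x y; first by rewrite !subrr !mulr0 mul0r.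
have K0 : 0 < (enorm (x - y) `^ (n%:R + m * s))^-1.
  rewrite invr_gt0 powR_gt0//; apply: lt_le_trans (norm_le_enorm _).
  by rewrite normr_gt0 subr_eq0.
move: K0; set K := _^-1 => K0.
have [->|pxy] := eqVneq (phi x) (phi y); first by rewrite subrr !mulr0 mul0r.
have wxy : w x - w y = (u x - u y) - (v x - v y) by rewrite /w; ring.
suff lt : spow m (v x - v y) * (phi x - phi y) < spow m (u x - u y) * (phi x - phi y).
  split; first by rewrite ler_pM2r// ltW.
  by move=> /(mulIf (lt0r_neq0 K0)) e; rewrite e ltxx in lt.
have [h|h] := leP (w x) (w y).
  have plt : phi x < phi y by rewrite lt_neqAle pxy huber_mono.
  rewrite ltr_nM2r ?subr_lt0//; apply: spow_lt => //.
  have : w x != w y by apply: contra_neq pxy; rewrite /phi => ->.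
  rewrite neq_lt => /orP[|]; lra.
have plt : phi y < phi x by rewrite lt_neqAle eq_sym pxy huber_mono// ltW.
by rewrite ltr_pM2r ?subr_gt0//; apply: spow_lt => //; lra.
Qed.

Lemma nonlocal_form_le : nonlocal_form s m v phi <= nonlocal_form s m u phi.
Proof.
apply: le_Rintegral => //; [exact: integrable_nonlocal|exact: integrable_nonlocal|].
by move=> z _; have [] := nonlocal_integrand_le z.
Qed.

Lemma nonlocal_form_eq : nonlocal_form s m v phi = nonlocal_form s m u phi ->
  {ae (mu \x mu)%E, forall z, phi z.1 = phi z.2}.
Proof.
move=> E; have iu := integrable_nonlocal su sphi; have iv := integrable_nonlocal sv sphi.
have iD := integrableB measurableT iu iv.
have mD := measurable_int _ iD.
have : (\int[(mu \x mu)]_z `|(EFin \o nonlocal_integrand u phi) z - (EFin \o nonlocal_integrand v phi) z| = 0)%E.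
  under eq_integral do rewrite gee0_abs ?sube_ge0 ?lee_fin ?(nonlocal_integrand_le _).1//.
  rewrite -[LHS]fineK; last exact: integrable_fin_num.
  congr EFin; transitivity (\int[(mu \x mu)%E]_z (nonlocal_integrand u phi z - nonlocal_integrand v phi z)) => //.
  by rewrite RintegralB//; apply/eqP; rewrite subr_eq0; apply/eqP/esym.
move=> /(ae_eq_integral_abs (mu \x mu)%E measurableT mD).
apply: aeS => z /(_ I) /= [/eqP]; rewrite subr_eq0 => /eqP e.
by apply: (nonlocal_integrand_le z).2; rewrite e.
Qed.

End nonlocal.

Section local.
Context {R : realType} {n : nat}.
Local Notation V := 'rV[R]_n.
Local Notation mu := (lebesgue_rV R n).
Implicit Types (u v w phi : V -> R) (x : V).
Variables (H : V -> R) (Omega : set V) (m : R).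
Hypotheses (hH : finsler_minkowski H) (m1 : 1 < m) (mO : measurable Omega).

Lemma Lfun_finsler (g : V -> V) : (forall i, (fun x => g x 0 i) \in Lfun mu m%:E) ->
  (fun x => H (g x)) \in Lfun mu m%:E.
Proof.
move=> Lg.
have mg : measurable_fun setT g.
  by apply: measurable_fun_rV => i; exact: Lfun_measurable (Lg i).
have mHg : measurable_fun setT (fun x => H (g x)).
  exact: measurableT_comp (measurable_finsler hH) mg.
have Ls (r : seq 'I_n) : (fun x => \sum_(i <- r) `|g x 0 i| * H (delta_mx 0 i)) \in Lfun mu m%:E.
  elim: r => [|i r IHr].
    under eq_fun do rewrite big_nil.
    apply: LfunI => //; rewrite integral0_eq// => x _.
    by rewrite normr0 powR0// gt_eqF// (lt_trans ltr01).
  under eq_fun do rewrite big_cons.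
  apply: LfunD => //; under eq_fun do rewrite mulrC.
  by apply: LfunZ => //; exact: Lfun_normr.
apply: Lfun_le (Ls (index_enum 'I_n)) => // x.
rewrite ger0_norm ?(finsler_ge0 hH)//; apply: (le_trans (finsler_sum hH (g x))).
exact: ler_norm.
Qed.

Lemma measurable_edot_flux (g h : V -> V) : (forall i, measurable_fun setT (fun x => g x 0 i)) ->
  (forall i, measurable_fun setT (fun x => h x 0 i)) ->
  measurable_fun setT (fun x => edot (finsler_flux H m (g x)) (h x)).
Proof.
move=> mg mh; rewrite /edot; apply: measurable_sum => i; apply: measurable_funM => //.
apply: (measurableT_comp (measurable_flux hH m i)).
by apply: measurable_fun_rV => j; exact: mg.
Qed.

Lemma integrable_local (g h : V -> V) : (forall i, (fun x => g x 0 i) \in Lfun mu m%:E) ->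
  (forall i, (fun x => h x 0 i) \in Lfun mu m%:E) ->
  mu.-integrable Omega (EFin \o (fun x => edot (finsler_flux H m (g x)) (h x))).
Proof.
move=> Lg Lh; apply: (integrableS measurableT mO (@subsetT _ _)).
have ig := Lfun_integrable (ltW m1) (Lfun_finsler Lg).
have ih := Lfun_integrable (ltW m1) (Lfun_finsler Lh).
apply: (le_integrable measurableT _ _ (integrableD measurableT ig ih)).
  apply/measurable_EFinP; apply: measurable_edot_flux => i.
    exact: Lfun_measurable (Lg i).
  exact: Lfun_measurable (Lh i).
move=> x _ /=; rewrite lee_fin [leRHS]ger0_norm ?addr_ge0 ?powR_ge0//.
rewrite (ger0_norm (finsler_ge0 hH (g x))) (ger0_norm (finsler_ge0 hH (h x))).
exact: edot_flux_bound.
Qed.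

(** The difference of the integrands is c(x) times the monotonicity expression of the flux,
almost everywhere. *)
Lemma local_form_le u v phi (c : V -> R) : sobolev m u -> sobolev m v -> sobolev m phi ->
  (forall x, 0 <= c x) ->
  (forall i, {ae mu, forall x, wgrad phi x 0 i = c x * (wgrad u x 0 i - wgrad v x 0 i)}) ->
  local_form H Omega m v phi <= local_form H Omega m u phi.
Proof.
move=> su sv sp c0 hc.
have [_ Lu] := sobolev_wgrad m1 su; have [_ Lv] := sobolev_wgrad m1 sv.
have [_ Lp] := sobolev_wgrad m1 sp.
have iu := integrable_local Lu Lp; have iv := integrable_local Lv Lp.
pose D x := edot (finsler_flux H m (wgrad u x)) (wgrad phi x) -
  edot (finsler_flux H m (wgrad v x)) (wgrad phi x).
have iD : mu.-integrable Omega (EFin \o D) by exact: (integrableB mO iu iv).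
have E : \int[mu]_(x in Omega) D x = local_form H Omega m u phi - local_form H Omega m v phi.
  exact: (RintegralB mO iu iv).
rewrite -subr_ge0 -E.
(* Replacing D by its positive part reduces the claim to a pointwise sign. *)
have aeP : {ae mu, forall x, D x = Num.max (D x) 0}.
  have H1 : {ae mu, forall x, forall i, wgrad phi x 0 i = c x * (wgrad u x 0 i - wgrad v x 0 i)}.
    have /ae_foralln : forall k, {ae mu, forall x, forall (kn : (k < n)%N),
        wgrad phi x 0 (Ordinal kn) = c x * (wgrad u x 0 (Ordinal kn) - wgrad v x 0 (Ordinal kn))}.
      move=> k; have [kn|nk] := pselect (k < n)%N; last by apply: aeW => x kn; case: nk.
      by apply: aeS (hc (Ordinal kn)) => x h kn'; rewrite (bool_irrelevance kn' kn).
    by apply: aeS => x h [i hi]; exact: h.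
  apply: aeS H1 => x hx; apply/esym/max_idPl; rewrite /D -edotBl.
  have -> : wgrad phi x = c x *: (wgrad u x - wgrad v x).
    by apply/rowP => i; rewrite hx !mxE.
  by rewrite edotZr mulr_ge0//; exact: flux_monotone.
have -> : \int[mu]_(x in Omega) D x = \int[mu]_(x in Omega) Num.max (D x) 0; last first.
  by apply: Rintegral_ge0 => x _; rewrite le_max lexx orbT.
congr fine; apply: ae_eq_integral => //.
- exact: measurable_int iD.
- apply/measurable_EFinP; apply: measurable_maxr => //.
  by apply/measurable_EFinP; exact: measurable_int iD.
- by apply: aeS aeP => x e _ /=; rewrite -e.
Qed.

End local.

Section conclusion.
Context {R : realType} {n : nat}.
Local Notation V := 'rV[R]_n.
Local Notation mu := (lebesgue_rV R n).
Implicit Types (u v w phi : V -> R) (x : V).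

(** The product of the sets where phi is nonzero and where it is zero is a null set of
pairs. The latter has positive measure, since it contains almost all of a unit box outside
the bounded set; so the former is null. *)
Lemma ae_const_bounded_support (Omega : set V) phi : (0 < n)%N -> bounded_set Omega ->
  measurable_fun setT phi ->
  {ae mu, forall x, ~ Omega x -> phi x = 0} ->
  {ae (mu \x mu)%E, forall z, phi z.1 = phi z.2} ->
  {ae mu, forall x, phi x = 0}.
Proof.
move=> n0 bO mphi phi0 phiC.
pose A := phi @^-1` (~` [set 0]); pose B := phi @^-1` [set 0].
have mA : measurable A by rewrite -[A]setTI; apply: mphi => //; exact: measurableC.
have mB : measurable B by rewrite -[B]setTI; exact: mphi.
have AB0 : (mu A * mu B = 0)%E.
  rewrite -product_measure1E//; apply/eqP; rewrite eq_le measure_ge0 andbT.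
  have [N [mN N0 hN]] := phiC; rewrite -N0; apply: le_measure; rewrite ?inE//.
    exact: measurableX.
  move=> [x y] [/= Ax By]; apply: hN => /= e; apply: Ax; rewrite /= e; exact: By.
have B0 : (0 < mu B)%E.
  have [M hM] := bounded_sub_cube bO.
  (* A unit box outside the cube that contains Omega. *)
  pose Q : set V := box (fun=> `]M, (M + 1)[%classic).
  have mQ : measurable Q by apply: measurable_box => i; exact: measurable_itv.
  have Q1 : mu Q = 1%E.
    rewrite lebesgue_rV_box => [|i]; last exact: measurable_itv.
    rewrite big1// => i _; rewrite lebesgue_measure_itv/= lte_fin ltrDl ltr01 -EFinB.
    by congr EFin; ring.
  have [N [mN N0 hN]] := phi0.
  have QBN : Q `<=` B `|` N.
    move=> x Qx; have [px|px] := pselect (phi x = 0); first by left.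
    right; apply: hN => /= h; apply: px; apply: h => /hM /cubeE /(_ (Ordinal n0)).
    have /= := Qx (Ordinal n0); rewrite in_itv/= => /andP[h1 _].
    by rewrite leNgt => /negP; apply; apply: lt_le_trans h1 (ler_norm _).
  have : (mu Q <= mu (B `|` N))%E.
    by apply: le_measure; rewrite ?inE//; exact: measurableU.
  rewrite Q1 measureU0// => h; exact: lt_le_trans h.
have A0 : mu A = 0%E.
  by move/eqP: AB0; rewrite mule_eq0 => /orP[/eqP//|/eqP e]; rewrite e ltxx in B0.
by exists A; split => // x /= px; exact: px.
Qed.

Lemma squeeze_le_sum (a a' b b' c c' d d' : R) :
  a' <= a -> b' <= b -> c' <= c -> d' <= d ->
  (a + b) + (c + d) <= (a' + b') + (c' + d') -> b' = b.
Proof. by move=> *; lra. Qed.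

End conclusion.

Theorem theorem2p14 (R : realType) (N : nat) (hN : (2 <= N)%N)
  (Omega : set 'rV[R]_N) (hOmega : bounded_C1_domain Omega)
  (H : 'rV[R]_N -> R) (hH : finsler_minkowski H)
  (p q s : R) (hp : 1 < p) (hq : 1 < q) (hs0 : 0 < s) (hs1 : s < 1)
  (u v : 'rV[R]_N -> R)
  (hup : sobolev p u) (huq : sobolev q u)
  (hvp : sobolev p v) (hvq : sobolev q v)
  (hle : weak_le H Omega s p q u v)
  (hout : {ae lebesgue_rV R N, forall x, ~ Omega x -> u x <= v x}) :
  {ae lebesgue_rV R N, forall x, Omega x -> u x <= v x}.
Proof.
have [_ oO _ bO _] := hOmega.
have mO := open_measurable_rV oO.
have hs : 0 < s < 1 by rewrite hs0.
pose phi x := huber (u x - v x).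
pose c x := clamp (u x - v x).
have lu := Lfun_loc_integrable hp hup.1.
have lv := Lfun_loc_integrable hp hvp.1.
have [wu _] := sobolev_wgrad hp hup; have [wv _] := sobolev_wgrad hp hvp.
have wphi := weak_grad_huberB lu lv wu wv.
have mphi : measurable_fun setT phi.
  by have [mw _] := loc_integrableB lu lv; exact: measurableT_comp (C11_meas huber_C11) mw.
have sphi m : 1 < m -> sobolev m u -> sobolev m v -> sobolev m phi.
  move=> m1 su sv; have [_ Lu] := sobolev_wgrad m1 su; have [_ Lv] := sobolev_wgrad m1 sv.
  split.
    apply: (Lfun_le m1 mphi _ (LfunB m1 su.1 sv.1)) => x.
    by have := huber_lip 0 (u x - v x); rewrite huber0 !subr0.
  exists (fun x => c x *: (wgrad u x - wgrad v x)); split=> // i.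
  apply: (Lfun_le m1 _ _ (LfunB m1 (Lu i) (Lv i))).
    by have [/(_ i)[]] := wphi.
  by move=> x; rewrite !mxE normrM ler_piMl// (C11_bound huber_C11).
have hc i : {ae lebesgue_rV R N, forall x,
    wgrad phi x 0 i = c x * (wgrad u x 0 i - wgrad v x 0 i)}.
  by apply: aeS (weak_grad_unique (wgradP wphi) wphi i) => x ->; rewrite !mxE.
have c0 x : 0 <= c x by exact: clamp_ge0.
have sp := sphi p hp hup hvp; have sq := sphi q hq huq hvq.
have phi0 : {ae lebesgue_rV R N, forall x, ~ Omega x -> phi x = 0}.
  apply: aeS hout => x h /h uv; apply/eqP; rewrite eq_le huber_ge0 andbT leNgt huber_gt0.
  by rewrite subr_gt0 -leNgt.
(* The four differences of forms are nonnegative, and the hypothesis bounds their sum by 0. *)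
have := hle phi (conj sp phi0) (conj sq phi0) (aeW _ (fun x => huber_ge0 (u x - v x))).
have Lp := local_form_le hH hp mO hup hvp sp c0 hc.
have Lq := local_form_le hH hq mO huq hvq sq c0 hc.
have Np := nonlocal_form_le hp hs hup hvp sp.
have Nq := nonlocal_form_le hq hs huq hvq sq.
rewrite /mixed_form => ineq.
have E : nonlocal_form s p v phi = nonlocal_form s p u phi.
  exact: (squeeze_le_sum Lp Np Lq Nq ineq).
have := ae_const_bounded_support (ltnW hN) bO mphi phi0 (nonlocal_form_eq hp hs hup hvp sp E).
apply: aeS => x /eqP; rewrite -[_ <= _]negbK -ltNge -subr_gt0 -huber_gt0 -/(phi x) => /eqP -> _.
by rewrite ltxx.
Qed.
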